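(* Let $n\ge 2$ and let $\Omega\subset\mathbb{C}^n$ be a bounded domain. Suppose that there exists a connected open set $U\subset\mathbb{C}^n$ with $\partial\Omega\cap U\neq\emptyset$ such that $\Omega\cap U$ is log-type convex. Then for any open set $V\subset U$ with $\overline{V}\subset U$ there exists $K>0$ such that $$K_{\Omega}(p,q)\le K_{\Omega\cap U}(p,q)\le K_{\Omega}(p,q)+K$$ for all $p,q\in V\cap\Omega$.
   Context: For a domain $D\subset\mathbb{C}^n$, $x\in D$ and $v\in\mathbb{C}^n\setminus\{0\}$, put $\delta_D(x)=\inf\{|x-\xi|:\xi\in\partial D\}$ and $\delta_D(x;v)=\inf\{|x-\xi|:\xi\in\partial D\cap(x+\mathbb{C}v)\}$, with $|\cdot|$ the Euclidean norm. A bounded convex domain $D\subset\mathbb{C}^n$, $n\ge2$, is called log-type convex if there exist $\nu,C>0$ such that $\delta_D(z;v)\le \dfrac{C}{|\log\delta_D(z)|^{1+\nu}}$ for all $z\in D$ and all $v\in\mathbb{C}^n\setminus\{0\}$. The Kobayashi metric of $D$ is $k_D(x;v)=\inf\{|\xi|: f\in\mathrm{Hol}(\mathbb{D},D),\ f(0)=x,\ d(f)_0(\xi)=v\}$, where $\mathbb{D}$ is the unit disc, and the Kobayashi (pseudo-)distance is $K_D(x,y)=\inf_\sigma\int_a^b k_D(\sigma(t);\sigma'(t))\,dt$, the infimum being over absolutely continuous curves $\sigma:[a,b]\to D$ with $\sigma(a)=x$, $\sigma(b)=y$. *)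

(* Defs.v *)
From HB Require Import structures.
From mathcomp Require Import all_boot all_order all_algebra complex.
From mathcomp Require Import all_classical all_reals all_analysis.

Set Implicit Arguments.
Unset Strict Implicit.
Unset Printing Implicit Defensive.

Import Order.TTheory GRing.Theory Num.Theory.
Import numFieldNormedType.Exports.

Local Open Scope classical_set_scope.
Local Open Scope ring_scope.
Local Open Scope complex_scope.

(* R[i] as a normed module over itself: 'rV[R[i]]_n then gets the usual
   topology of C^n, and [differentiable] for maps R[i] -> 'rV[R[i]]_n means
   complex differentiability. *)
HB.instance Definition _ (R : realType) :=
  NormedModule.copy R[i] (R[i] : numFieldType).

Section Domains.
Context {R : realType} {n : nat}.
Implicit Types (D : set 'rV[R[i]]_n) (x y v : 'rV[R[i]]_n).

(* The library norm on 'rV[R[i]]_n is the R[i]-valued sup norm. *)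
Definition enorm x : R :=
  Num.sqrt (\sum_(j < n) ComplexField.Normc.normc (x 0 j) ^+ 2).

Definition boundary D : set 'rV[R[i]]_n := closure D `\` interior D.

Definition is_domain D : Prop := [/\ D !=set0, open D & connected D].

(* Only meaningful when the set of distances is nonempty, which holds for
   x in a bounded domain D (and v != 0 in the case of [delta_dir]). *)
Definition delta D x : R := inf [set enorm (x - xi) | xi in boundary D].

Definition delta_dir D x v : R :=
  inf [set enorm (x - xi) |
       xi in boundary D `&` [set x + c *: v | c in [set: R[i]]]].

(* [convex_set] quantifies over weights in [{i01 R[i]}]; for the order of R[i]
   these are exactly the real numbers of [0, 1], so this is real convexity.
   The inequality is in \bar R, where C%:E / 0 = +oo: it is vacuous where
   ln (delta D z) = 0. *)
Definition log_type_convex D : Prop :=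
  [/\ is_domain D, bounded_set D, convex_set D &
      exists nu C : R, [/\ 0 < nu, 0 < C &
        forall z v, D z -> v != 0 ->
          ((delta_dir D z v)%:E <=
             C%:E / (`|ln (delta D z)| `^ (1 + nu))%R%:E)%E]].

Definition hol_disc D (f : R[i] -> 'rV[R[i]]_n) : Prop :=
  forall z : R[i], `|z| < 1 -> differentiable f z /\ D (f z).

Definition kobayashi_metric D x v : \bar R :=
  ereal_inf [set (ComplexField.Normc.normc xi)%:E | xi in
    [set xi : R[i] | exists f : R[i] -> 'rV[R[i]]_n,
       [/\ hol_disc D f, f 0 = x & 'd f (0 : R[i]) xi = v]]].

Definition abs_continuous (a b : R) (s : R -> 'rV[R[i]]_n) : Prop :=
  forall e : R, 0 < e -> exists2 d : R, 0 < d &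
    forall (m : nat) (l r : 'I_m -> R),
      (forall i, a <= l i /\ l i <= r i /\ r i <= b) ->
      (forall i j, i != j -> r i <= l j \/ r j <= l i) ->
      \sum_(i < m) (r i - l i) < d ->
      \sum_(i < m) enorm (s (r i) - s (l i)) < e.

(* Derivative in the real variable, taken on real and imaginary parts of the
   coordinates.  It is an arbitrary value where s is not differentiable, which
   for an absolutely continuous s is a negligible set. *)
Definition velocity (s : R -> 'rV[R[i]]_n) (t : R) : 'rV[R[i]]_n :=
  \row_(j < n) (derive1 (fun u => complex.Re (s u 0 j)) t
                +i* derive1 (fun u => complex.Im (s u 0 j)) t).

Definition kobayashi_length D (a b : R) (s : R -> 'rV[R[i]]_n) : \bar R :=
  (\int[lebesgue_measure]_(t in `[a, b]%classic)
     kobayashi_metric D (s t) (velocity s t))%E.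

Definition kobayashi_dist D x y : \bar R :=
  ereal_inf [set L : \bar R | exists (a b : R) (s : R -> 'rV[R[i]]_n),
    [/\ a <= b, abs_continuous a b s,
        (forall t, a <= t -> t <= b -> D (s t)),
        s a = x /\ s b = y & L = kobayashi_length D a b s]].

End Domains.

(* Main.v *)
(* Write D = Omega `&` U and kappa = K_D(o, .) + 1.  The half-plane estimate
   k_D(z; v) >= |v| / (16 delta_D(z; v)) for convex D and the logarithmic upper bound
   on K_D(o, .) turn log-type convexity into k_D(z; v) >= c kappa(z)^(1+nu) |v|.

   Near V, k_Omega and k_D are comparable, so a curve that is K_Omega-minimal up to
   1 has length O(kappa) between its points while its displacement is at most
   O(kappa^(-1-nu)) times its length.  Cutting the curve at dyadic levels of kappa
   gives a geometric series: a near-geodesic staying where kappa is large is short,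
   i.e. near-geodesics of definite size pass through points where kappa is bounded
   (visibility).  Hence K_Omega(x, Omega `\` U) >= c kappa(x) - C, and Royden's
   localization improves to k_D <= (1 + C kappa^-2) k_Omega.  Summing this error
   over the dyadic levels again, the K_D-distance of the ends of a near-geodesic
   staying near V exceeds its K_Omega-length by a bounded amount.  A near-geodesic
   from p to q that leaves this region has visible points after p and before q,
   which are at bounded K_D-distance from each other; the two outer arcs stay in the
   region. *)

(* Geodesics for K_Omega need not exist, so curves minimal up to 1 take their place; superadditivity
   of the length and the triangle inequality pass the defect 1 on to every subarc. Bounding a
   displacement by a length requires |h(b) - h(a)| to be at most the integral of |h'| for absolutely
   continuous h, under a majorant of |h'| that need not be measurable; this is why total variation
   and Radon-Nikodym densities occur.

   The function theory of the discs rests on a single Cauchy estimate at the centre of the unit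
   disc, obtained from Goursat's theorem on a square. Its constant 8, and the resulting 16 of the
   half-plane estimate, are not sharp: all constants are absorbed in c, C and K. Likewise hyperbolic
   distances are replaced by dyadic steps towards the unit circle, each of bounded cost.

   Royden's error is exponentially small in kappa. It is weakened to kappa^-2 so that the dyadic
   argument, which handles any decay kappa^(-1-nu) with nu > 0, applies to it with nu = 1. Depth is
   measured by K_D although the curves are minimal for K_Omega; since K_Omega <= K_D, the depths of
   the ends still bound the length. *)
From HB Require Import structures.
Require Import Defs.
From mathcomp Require Import all_boot all_order all_algebra complex.
From mathcomp Require Import all_classical all_reals all_analysis.
From mathcomp Require Import measurable_realfun lebesgue_integral_differentiation.
From mathcomp Require Import ring lra.
Set Implicit Arguments.
Unset Strict Implicit.
Unset Printing Implicit Defensive.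
Import Order.TTheory GRing.Theory Num.Theory.
Import numFieldNormedType.Exports.
Local Open Scope classical_set_scope.
Local Open Scope ring_scope.
Local Open Scope complex_scope.

(** * Integrals without measurability *)

(* [k_D(s; s')] is not known to be measurable.  For a nonnegative integrand the
   library integral is then the lower integral, which is still monotone and
   superadditive in the interval; this is all that is used of it. *)
Section lower_integral.
Local Open Scope ereal_scope.
Context d (T : measurableType d) (R : realType) (mu : {measure set T -> \bar R}).
Implicit Types (D E : set T) (f g : T -> \bar R).

Lemma lint_le D E f g :
  (forall x, D x -> 0 <= f x) -> (forall x, E x -> 0 <= g x) ->
  (forall x, D x -> E x /\ f x <= g x) ->
  \int[mu]_(x in D) f x <= \int[mu]_(x in E) g x.
Proof.
move=> f0 g0 fg; rewrite !ge0_integralE //=; apply: ge_ereal_sup => _ [h/= hfS] <-.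
apply: ereal_sup_ubound; exists h => //= x; apply: (le_trans (hfS x)).
rewrite !patchE; case: ifPn; rewrite ?inE => Dx.
  by have [Ex fx] := fg _ Dx; rewrite mem_set.
by case: ifPn => //; rewrite inE; exact: g0.
Qed.

Import HBNNSimple.

(** Reduction to the simple functions below [f]: these are measurable, so additivity and scaling of
    the integral are available for them. *)
Lemma lint_ub D f c : measurable D -> (forall x, D x -> 0 <= f x) ->
  (forall h : {nnsfun T >-> R}, (forall x, D x -> (h x)%:E <= f x) ->
     \int[mu]_(x in D) (h x)%:E <= c) ->
  \int[mu]_(x in D) f x <= c.
Proof.
move=> mD f0 H; rewrite ge0_integralE //=; apply: ge_ereal_sup => _ [h/= hfS] <-.
have hD x : ~ D x -> h x = 0%R.
  move=> Dx; apply/eqP; rewrite eq_le fun_ge0 andbT -lee_fin.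
  by have := hfS x; rewrite patchE memNset.
apply: le_trans (H h _).
  rewrite -integralT_nnsfun (integral_mkcond D).
  apply: lint_le => x _ //=; first by rewrite lee_fin fun_ge0.
    by rewrite patchE; case: ifP => // _; rewrite lee_fin fun_ge0.
  split => //; rewrite patchE; case: ifPn => //; rewrite notin_setE => /hD ->.
  by rewrite lexx.
by move=> x Dx; have := hfS x; rewrite patchE mem_set.
Qed.

(** The null set is removed from the integral of the measurable [g]; putting it back into the domain
    afterwards can only increase the integral of the nonnegative [f]. *)
Lemma ae_le_lint D f g : measurable D -> measurable_fun D g ->
  (forall x, D x -> 0 <= f x) -> (forall x, D x -> 0 <= g x) ->
  {ae mu, forall x, D x -> g x <= f x} ->
  \int[mu]_(x in D) g x <= \int[mu]_(x in D) f x.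
Proof.
move=> mD mg f0 g0 [N [mN muN gfN]].
rewrite (ge0_negligible_integral _ _ _ _ muN)//.
apply: lint_le => // x [Dx Nx]; first exact: g0.
split => //; have /= := subsetCl gfN; move=> /(_ x Nx); exact.
Qed.

End lower_integral.

(** * Absolutely continuous real functions *)

Section abs_cont_real.
Context {R : realType}.
Implicit Types (a b : R) (h F : R -> R).
Local Notation mu := (@lebesgue_measure R).

Definition acR (a b : R) (h : R -> R) : Prop :=
  forall e : R, 0 < e -> exists2 d : R, 0 < d &
    forall (m : nat) (l r : 'I_m -> R),
      (forall i, a <= l i /\ l i <= r i /\ r i <= b) ->
      (forall i j, i != j -> r i <= l j \/ r j <= l i) ->
      \sum_(i < m) (r i - l i) < d ->
      \sum_(i < m) `|h (r i) - h (l i)| < e.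

Lemma acRB a b f h : acR a b f -> acR a b h -> acR a b (fun x => f x - h x).
Proof.
move=> af ah e e0; have e20 : 0 < e / 2 by lra.
have [d1 d10 H1] := af _ e20; have [d2 d20 H2] := ah _ e20.
exists (Num.min d1 d2); first by rewrite lt_min d10.
move=> m l r lr dis; rewrite lt_min => /andP[s1 s2].
have := ltrD (H1 _ _ _ lr dis s1) (H2 _ _ _ lr dis s2).
rewrite -splitr -big_split/=; apply: le_lt_trans; apply: ler_sum => i _.
by rewrite (_ : _ - _ - _ = (f (r i) - f (l i)) - (h (r i) - h (l i))) ?ler_normB //; ring.
Qed.

(** Needed because the subintervals of several partitions are naturally indexed by dependent
    pairs. *)
Lemma acR_finType a b h e : acR a b h -> 0 < e -> exists2 d : R, 0 < d &
    forall (I : finType) (l r : I -> R),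
      (forall i, a <= l i /\ l i <= r i /\ r i <= b) ->
      (forall i j, i != j -> r i <= l j \/ r j <= l i) ->
      \sum_(i : I) (r i - l i) < d ->
      \sum_(i : I) `|h (r i) - h (l i)| < e.
Proof.
move=> ah e0; have [d d0 H] := ah _ e0; exists d => // I l r lr dis.
have E (f : I -> R) : \sum_(i : I) f i = \sum_(i < #|I|) f (enum_val i).
  by rewrite (reindex (@enum_val _ I))//; exact/onW_bij/enum_val_bij.
rewrite !(E _) => s.
apply: (H _ (l \o enum_val) (r \o enum_val)) => // [i|i j ij] /=; first exact: lr.
by apply: dis; rewrite (inj_eq enum_val_inj).
Qed.

Lemma acR_cont a b h : acR a b h -> forall e, 0 < e -> exists2 d, 0 < d &
  forall x y, a <= x -> x <= y -> y <= b -> y - x < d -> `|h y - h x| < e.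
Proof.
move=> ah e e0; have [d d0 H] := ah _ e0; exists d => // x y ax xy yb yx.
have := H 1%N (fun=> x) (fun=> y); rewrite !big_ord1; apply => // i j.
by rewrite !ord1 eqxx.
Qed.

(** Composition with [clamp a b] extends a function from [a, b] to the line by its end values,
    keeping monotonicity and continuity; the Stieltjes measure requires a function on the whole
    line. *)
Definition clamp a b x := Num.max a (Num.min b x).

Lemma clamp_ge a b x : a <= clamp a b x.
Proof. by rewrite /clamp le_max lexx. Qed.

Lemma clamp_le a b x : a <= b -> clamp a b x <= b.
Proof. by move=> ab; rewrite /clamp ge_max ab ge_min lexx. Qed.

Lemma clamp_id a b x : a <= x -> x <= b -> clamp a b x = x.
Proof. by move=> ax xb; rewrite /clamp min_r// max_r. Qed.

Lemma clamp_homo a b x y : x <= y -> clamp a b x <= clamp a b y.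
Proof.
move=> xy; rewrite /clamp ge_max !le_max lexx/=.
by apply/orP; right; rewrite le_min !ge_min lexx xy orbT.
Qed.

Lemma clamp_lip a b x y : x <= y -> clamp a b y - clamp a b x <= y - x.
Proof.
move=> xy; rewrite /clamp.
have [by_|by_] := leP b y; have [bx|bx] := leP b x;
  set u := (X in Num.max a X - _); set v := (X in _ - Num.max a X);
  have [au|au] := leP a u; have [av|av] := leP a v; rewrite /u /v in au av *; lra.
Qed.

Lemma acR_clamp_continuous a b h : a <= b -> acR a b h -> continuous (h \o clamp a b).
Proof.
move=> ab ah x; apply/cvgrPdist_lt => e e0.
have [d d0 H] := acR_cont ah e0.
have cl y z : y <= z -> z - y < d -> `|h (clamp a b z) - h (clamp a b y)| < e.
  move=> yz zy; apply: H; [exact: clamp_ge|exact: clamp_homo|exact: clamp_le|].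
  exact: le_lt_trans (clamp_lip _ _ yz) zy.
near=> y.
have : `|x - y| < d by near: y; apply: cvgr_dist_lt.
have [xy|/ltW xy] := leP x y.
  by rewrite (distrC x) ger0_norm ?subr_ge0// => yx; rewrite distrC; exact: cl.
by rewrite ger0_norm ?subr_ge0//; exact: cl.
Unshelve. all: by end_near. Qed.

(* The intervals of [acR] all lie in [a, b]; for the clamped function they may
   be arbitrary. *)
Lemma acR_clamp a b h e : a <= b -> acR a b h -> 0 < e -> exists2 d : R, 0 < d &
    forall m (l r : 'I_m -> R), (forall i, l i <= r i) ->
      (forall i j, i != j -> r i <= l j \/ r j <= l i) ->
      \sum_(i < m) (r i - l i) < d ->
      \sum_(i < m) `|h (clamp a b (r i)) - h (clamp a b (l i))| < e.
Proof.
move=> ab ah e0; have [d d0 H] := ah _ e0; exists d => // m l r lr dis s.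
apply: (H m (clamp a b \o l) (clamp a b \o r)) => /= [i|i j ij|].
- by rewrite clamp_ge clamp_homo// clamp_le.
- by have [rl|rl] := dis i j ij; [left|right]; exact: clamp_homo.
- by apply: le_lt_trans s; apply: ler_sum => i _; exact: clamp_lip.
Qed.

End abs_cont_real.

Section open_interval_components.
Context {R : realType}.
Implicit Types (I : set R).

Lemma open_interval_itv I (x : R) : open I -> is_interval I -> I x ->
  has_lbound I -> has_ubound I -> inf I < sup I /\ I = `]inf I, sup I[%classic.
Proof.
move=> oI iI Ix lI uI.
have H : I = `]inf I, sup I[%classic.
  apply/seteqP; split=> y /=.
    move=> Iy; have := oI _ Iy; rewrite -nbhs_ballE => -[e /= e0 He].
    rewrite in_itv/=; apply/andP; split.
      apply: (@le_lt_trans _ _ (y - e / 2)); last by lra.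
      apply: ge_inf => //; apply: He; rewrite /ball/= opprB addrCA subrr addr0.
      by rewrite gtr0_norm; lra.
    apply: (@lt_le_trans _ _ (y + e / 2)); first by lra.
    apply: ub_le_sup => //; apply: He; rewrite /ball/= opprD addrA subrr sub0r normrN.
    by rewrite gtr0_norm; lra.
  rewrite in_itv/= => /andP[ly yr].
  have [z Iz zy] : exists2 z, I z & z < y.
    by apply: inf_lt => //; exists x.
  have [w Iw yw] : exists2 w, I w & y < w.
    by apply: sup_gt => //; exists x.
  by apply: (iI z w) => //; rewrite !ltW.
by split=> //; move: Ix; rewrite {1}H /= in_itv/= => /andP[]; exact: lt_trans.
Qed.

End open_interval_components.

(** * Densities of monotone absolutely continuous functions *)

Section density.
Context {R : realType}.
Implicit Types (a b : R) (F : R -> R).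
Local Notation mu := (@lebesgue_measure R).

Section stieltjes.
Variables (a b : R) (F : R -> R).
Hypotheses (ab : a <= b) (aF : acR a b F).
Hypothesis ndF : {in `[a, b] &, nondecreasing_fun F}.

Definition clamped := F \o clamp a b.

Lemma clamped_nd : {homo clamped : x y / x <= y}.
Proof.
move=> x y xy; apply: ndF; rewrite ?in_itv/= ?clamp_ge ?clamp_le//.
exact: clamp_homo.
Qed.

Lemma clamped_rc : right_continuous clamped.
Proof. by move=> x; apply: cvg_at_right_filter; exact: acR_clamp_continuous. Qed.

HB.instance Definition _ := isCumulative.Build R _ R clamped clamped_nd clamped_rc.

Local Notation m := (lebesgue_stieltjes_measure clamped).

Lemma stieltjes_itv x y : x <= y -> m `]x, y]%classic = (clamped y - clamped x)%:E.
Proof.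
move=> xy; rewrite /lebesgue_stieltjes_measure /measure_extension.
by rewrite measurable_mu_extE/=; [rewrite wlength_itv_bnd|exact: is_ocitv].
Qed.

(** An open set is a countable disjoint union of intervals. Any finite number of them has total
    length below [d], so the hypothesis bounds every partial sum of the measure by [e]. *)
Lemma stieltjes_open (U : set R) e d : 0 < e ->
  (forall n (l r : 'I_n -> R), (forall i, l i <= r i) ->
      (forall i j, i != j -> r i <= l j \/ r j <= l i) ->
      \sum_(i < n) (r i - l i) < d ->
      \sum_(i < n) `|clamped (r i) - clamped (l i)| < e) ->
  open U -> has_lbound U -> has_ubound U -> (mu U < d%:E)%E -> (m U <= e%:E)%E.
Proof.
move=> e0 H oU lU uU Ud.
pose I := open_disjoint_itv oU.
have UE : U = \bigcup_q I q by exact: open_disjoint_itv_bigcup.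
have IU q : I q `<=` U by move=> x Ix; rewrite UE; exists q.
have oI q : open (I q) by exact: open_disjoint_itv_open.
have tI : trivIset [set: nat] I by exact: open_disjoint_itv_trivIset.
have mI q : measurable (I q) by exact: open_measurable.
have lI q : has_lbound (I q) by case: lU => y yU; exists y => z /IU; exact: yU.
have uI q : has_ubound (I q) by case: uU => y yU; exists y => z /IU; exact: yU.
have [a0 a0U] := lU.
(* An empty component becomes the degenerate interval at the lower bound [a0] of [U]; it lies to the
   left of all the others, so the family stays non-overlapping. *)
pose l q := if I q == set0 then a0 else inf (I q).
pose r q := if I q == set0 then a0 else sup (I q).
have HI q x : I q x -> [/\ l q < r q, l q = inf (I q), r q = sup (I q) & I q = `]l q, r q[%classic].
  move=> Ix; have I0 : I q != set0 by apply/set0P; exists x.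
  rewrite /l /r (negbTE I0).
  by have [] := open_interval_itv (oI q) (@open_disjoint_itv_is_interval _ _ oU q) Ix (lI q) (uI q).
have lr q : l q <= r q.
  have [I0|/set0P[x /HI[/ltW//]]] := eqVneq (I q) set0.
  by rewrite /l /r I0 eqxx.
have a0l q : a0 <= l q.
  rewrite /l; case: ifPn => // /set0P I0.
  by apply: lb_le_inf => // y /IU; exact: a0U.
have muI q : mu (I q) = (r q - l q)%:E.
  have [I0|/set0P[x /HI[lrq _ _ ->]]] := eqVneq (I q) set0.
    by rewrite /l /r I0 eqxx measure0 subrr.
  by rewrite lebesgue_measure_itv/= lte_fin lrq EFinB.
have mIr q : (m (I q) <= (clamped (r q) - clamped (l q))%:E)%E.
  rewrite -(stieltjes_itv (lr q)); apply: le_measure; rewrite ?inE.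
  - exact: mI.
  - exact: measurable_itv.
  have [->//|/set0P[x /HI[_ _ _ ->]]] := eqVneq (I q) set0.
  by move=> z /=; rewrite !in_itv/= => /andP[-> /ltW].
rewrite UE measure_bigcup//; last by move=> i _; exact: mI.
apply: lime_le.
  by apply: is_cvg_nneseries => *; exact: measure_ge0.
apply: nearW => n; rewrite big_mkcond/=.
under eq_bigr do rewrite in_setT.
apply: (@le_trans _ _ (\sum_(0 <= q < n) (clamped (r q) - clamped (l q))%:E)%E).
  by apply: lee_sum => q _; exact: mIr.
rewrite sumEFin lee_fin big_mkord.
apply: le_trans (ltW (H n (fun q => l q) (fun q => r q) _ _ _)) => //.
- by apply: ler_sum => q _; exact: ler_norm.
- move=> i j ij; have [I0|/set0P[x Ix]] := eqVneq (I i) set0.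
    by left; rewrite {1}/r I0 eqxx.
  have [J0|/set0P[y Iy]] := eqVneq (I j) set0.
    by right; rewrite {1}/r J0 eqxx.
  have [lri _ _ Ei] := HI _ _ Ix; have [lrj _ _ Ej] := HI _ _ Iy.
  have [|rl] := leP (r i) (l j); first by left.
  have [|rl'] := leP (r j) (l i); first by right.
  exfalso; pose z := (Num.max (l i) (l j) + Num.min (r i) (r j)) / 2.
  have [zi zj] : I i z /\ I j z.
    rewrite Ei Ej /= !in_itv/= /z.
    by have [?|?] := leP (l i) (l j); have [?|?] := leP (r i) (r j); split; apply/andP; split; lra.
  move/trivIsetP : tI => /(_ i j Logic.I Logic.I); rewrite (inj_eq val_inj) => /(_ ij).
  by move/seteqP => [+ _] => /(_ z); exact.
- rewrite -lte_fin; apply: le_lt_trans Ud.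
  rewrite -sumEFin -(big_mkord xpredT (fun q => (r q - l q)%:E)) UE measure_bigcup//; last by move=> i _; exact: mI.
  apply: le_trans (nneseries_lim_ge n _) => //.
  rewrite [leRHS]big_mkcond/=; apply: lee_sum => q _.
  by rewrite in_setT muI.
Qed.

(** The Stieltjes measure of [clamped] on ]a, b] is dominated by Lebesgue measure: a null set has an
    open neighbourhood of small measure, whose Stieltjes mass is small by [stieltjes_open]. Then [g]
    is the Radon-Nikodym derivative. *)
Lemma acR_density : exists g : R -> R,
  [/\ forall x, 0 <= g x, mu.-integrable setT (EFin \o g) &
    forall x, a <= x -> x <= b ->
      (\int[mu]_(t in `]a, x]) (g t)%:E = (F x - F a)%:E)%E].
Proof.
have mab : (m `]a, b]%classic < +oo)%E by rewrite stieltjes_itv// ltry.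
have mI : measurable (`]a, b]%classic : set (measurableTypeR R)) by exact: measurable_itv.
pose nu : {finite_measure set (measurableTypeR R) -> \bar R} := mfrestr mI mab.
have dom : nu `<< mu.
  apply/null_content_dominatesP => A mA A0.
  rewrite /nu /= /mfrestr /mrestr.
  apply/eqP; rewrite eq_le measure_ge0 andbT; apply/lee_addgt0Pr => e e0; rewrite add0e.
  have [d d0 Hd] := acR_clamp ab aF e0.
  have [|U [oU AU Ud]] := lebesgue_regularity_outer mA _ d0; first by rewrite A0 ltry.
  (* Cutting [U] down to a bounded interval provides the two bounds that [stieltjes_open] asks
     for. *)
  pose U' := U `&` `]a - 1, b + 1[%classic.
  have oU' : open U' by apply: openI => //; exact: interval_open.
  have mU' : measurable U' by exact: open_measurable.
  have mU : measurable U by exact: open_measurable.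
  have sub : A `&` `]a, b]%classic `<=` U'.
    move=> x [/AU Ux /=]; rewrite in_itv/= => /andP[ax xb]; split => //=.
    by rewrite in_itv/=; apply/andP; split; lra.
  have mAI : measurable (A `&` `]a, b]%classic) by exact: measurableI.
  apply: (@le_trans _ _ (m U')).
    by apply: le_measure; rewrite ?inE.
  apply: (stieltjes_open e0 Hd oU').
  - by exists (a - 1) => x [_ /=]; rewrite in_itv/= => /andP[/ltW].
  - by exists (b + 1) => x [_ /=]; rewrite in_itv/= => /andP[_ /ltW].
  - apply: le_lt_trans Ud.
    apply: (@le_trans _ _ (mu ((U `\` A) `|` A))).
      apply: le_measure; rewrite ?inE//; first by apply: measurableU => //; exact: measurableD.
      by move=> x [Ux _]; have [Ax|Ax] := pselect (A x); [right|left].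
    apply: (le_trans (measureU2 _ _ _)) => //; first exact: measurableD.
    by rewrite [X in (_ + X)%E](_ : _ = 0%E) ?adde0.
have [f [f0 ffin intf fE]] := radon_nikodym_sigma_finite dom.
exists (fine \o f); split.
- by move=> x; exact/fine_ge0/f0.
- by apply: eq_integrable intf => // x _ /=; rewrite fineK.
- move=> x ax xb.
  under eq_integral do rewrite /= fineK//.
  rewrite -fE; last exact: measurable_itv.
  rewrite /nu /= /mfrestr /mrestr (_ : _ `&` _ = `]a, x]%classic).
    by rewrite stieltjes_itv//= /clamped/= !clamp_id.
  apply/seteqP; split => [y [] //|y /=]; rewrite !in_itv/= => /andP[ay yx].
  by rewrite ay yx (le_trans yx).
Qed.

End stieltjes.
End density.

(** * Total variation of absolutely continuous functions *)

Section variation_of_acR.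
Context {R : realType}.
Implicit Types (a b : R) (h : R -> R).

Lemma itv_partition_nth_homo (x y : R) s i j : itv_partition x y s ->
  (i <= j)%N -> (j <= size s)%N -> nth y (x :: s) i <= nth y (x :: s) j.
Proof.
move=> [ps _] ij js; apply: (@Order.POrderTheory.le_sorted_leq_nth _ R y (x :: s)) => //.
- exact: (@sub_path _ <%O <=%O (@ltW _ R)).
- by rewrite inE /= ltnS (leq_trans ij).
Qed.

(* All the subintervals of the partitions [s i] of the intervals [l i, r i] form
   one admissible family. *)
Lemma acR_partitions a b h e : acR a b h -> 0 < e -> exists2 d : R, 0 < d &
  forall n (l r : 'I_n -> R) (s : 'I_n -> seq R),
    (forall i, a <= l i /\ l i <= r i /\ r i <= b) ->
    (forall i j, i != j -> r i <= l j \/ r j <= l i) ->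
    (forall i, itv_partition (l i) (r i) (s i)) ->
    \sum_(i < n) (r i - l i) < d ->
    \sum_(i < n) variation (l i) (r i) h (s i) < e.
Proof.
move=> ah e0; have [d d0 H] := acR_finType ah e0; exists d => // n l r s lr dis ps sd.
pose p i j := nth (r i) (l i :: s i) j.
have p_ge i j : (j <= size (s i))%N -> l i <= p i j.
  by move=> js; exact: (@itv_partition_nth_homo _ _ _ 0).
have p_le i j : (j <= size (s i))%N -> p i j <= r i.
  move=> js; rewrite -[leRHS](itv_partition_nth_size (r i) (ps i)).
  exact: itv_partition_nth_homo.
pose T := {i : 'I_n & 'I_(size (s i))}.
have HT : \sum_(t : T) (p (tag t) (tagged t).+1 - p (tag t) (tagged t)) < d.
  rewrite -(sig_big_dep xpredT (fun=> xpredT)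
    (fun (i : 'I_n) (j : 'I_(size (s i))) => p i j.+1 - p i j))/=.
  apply: le_lt_trans sd; apply: ler_sum => i _.
  rewrite -(big_mkord xpredT (fun j => p i j.+1 - p i j)) GRing.telescope_sumr//.
  by rewrite /p (itv_partition_nth_size (r i) (ps i)).
have := H T (fun t => p (tag t) (tagged t)) (fun t => p (tag t) (tagged t).+1) _ _ HT.
rewrite -(sig_big_dep xpredT (fun=> xpredT)
    (fun (i : 'I_n) (j : 'I_(size (s i))) => `|h (p i j.+1) - h (p i j)|))/=.
under eq_bigr do rewrite -(big_mkord xpredT (fun j => `|h (p _ j.+1) - h (p _ j)|)).
apply.
- move=> [i j]/=; split; first by apply: (le_trans (proj1 (lr i))); exact/p_ge/ltnW.
  split; first exact: itv_partition_nth_homo.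
  by apply: (le_trans (p_le _ _ _)) => //; case: (lr i) => _ [].
- move=> [i j] [i' j']/= ij; have [ii'|ii'] := eqVneq i i'.
    subst i'; have [jj|jj|jj] := ltngtP j j'.
    + by left; apply: itv_partition_nth_homo => //; exact: ltnW.
    + by right; apply: itv_partition_nth_homo => //; exact: ltnW.
    + by move: ij; rewrite (val_inj jj) eqxx.
  have [rl|rl] := dis _ _ ii'; [left|right].
    by rewrite (le_trans (p_le _ _ _))// (le_trans rl)// p_ge// ltnW.
  by rewrite (le_trans (p_le _ _ _))// (le_trans rl)// p_ge// ltnW.
Qed.

(** On an interval shorter than the [d] belonging to [e = 1] the variation is at most 1, and [a, x]
    is covered by finitely many steps of length [d / 2]. *)
Lemma acR_TV_fin a b h : acR a b h -> forall x, a <= x -> x <= b ->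
  total_variation a x h \is a fin_num.
Proof.
move=> ah; have [d d0 H] := acR_partitions ah ltr01.
have short x y : a <= x -> x <= y -> y <= b -> y - x < d -> total_variation x y h \is a fin_num.
  move=> ax xy yb yx; apply/(bounded_variationP _ xy).
  exists 1 => _ [s ps <-]; apply/ltW.
  have := H 1%N (fun=> x) (fun=> y) (fun=> s); rewrite !big_ord1; apply => // i j.
  by rewrite !ord1 eqxx.
have step k : forall x, a <= x -> x <= b -> x - a <= k%:R * (d / 2) ->
    total_variation a x h \is a fin_num.
  elim: k => [x ax xb|k IH x ax xb].
    rewrite mul0r subr_le0 => xa.
    by rewrite (_ : x = a) ?total_variationxx//; apply/eqP; rewrite eq_le xa.
  rewrite -natr1 mulrDl mul1r => xk.
  pose y := Num.max a (x - d / 2).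
  have ay : a <= y by rewrite /y le_max lexx.
  have yx : y <= x by rewrite /y ge_max ax/=; lra.
  rewrite (total_variationD _ ay yx) fin_numD; apply/andP; split.
    apply: IH => //; first exact: le_trans xb.
    rewrite /y; have [?|?] := leP a (x - d / 2); first by rewrite lerBlDr lerBlDr in xk *; lra.
    by rewrite subrr mulr_ge0//; lra.
  by apply: short => //; rewrite /y; have [?|?] := leP a (x - d / 2); lra.
move=> x ax xb; apply: (step (Num.bound ((x - a) / (d / 2)))) => //.
rewrite -ler_pdivrMr ?divr_gt0//; apply: le_trans (ltW (archi_boundP _)) => //.
by rewrite divr_ge0 ?subr_ge0//; lra.
Qed.

(** The increment of the total variation over an interval is the variation there, a supremum over
    partitions. Partitions optimal up to [z / n.+1] on all the intervals together fall under
    [acR_partitions]; [e / 2] leaves room for the passage to the supremum. *)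
Lemma acR_TV a b h : acR a b h -> acR a b (fun x => fine (total_variation a x h)).
Proof.
move=> ah e e0; have e20 : 0 < e / 2 by lra.
have [d d0 H] := acR_partitions ah e20; exists d => // n l r lr dis sd.
have TVlr i : total_variation (l i) (r i) h \is a fin_num.
  have [al [lri rb]] := lr i.
  have := acR_TV_fin ah (le_trans al lri) rb.
  by rewrite (total_variationD _ al lri) fin_numD => /andP[].
have E i : `|fine (total_variation a (r i) h) - fine (total_variation a (l i) h)| =
    fine (total_variation (l i) (r i) h).
  have [al [lri rb]] := lr i.
  rewrite (total_variationD _ al lri) fineD//; last exact: acR_TV_fin (le_trans lri rb).
  rewrite addrAC subrr add0r ger0_norm// fine_ge0//; exact: total_variation_ge0.
under eq_bigr do rewrite E.
apply: (@le_lt_trans _ _ (e / 2)); last by lra.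
apply/ler_addgt0Pr => z z0.
have zn0 : 0 < z / n.+1%:R by rewrite divr_gt0.
have /choice[s Hs] : forall i, exists s, itv_partition (l i) (r i) s /\
    fine (total_variation (l i) (r i) h) <= variation (l i) (r i) h s + z / n.+1%:R.
  move=> i; have [al [lri rb]] := lr i.
  have [_ [_ [s ps <-] <-] +] := ub_ereal_sup_adherent zn0 (TVlr i).
  rewrite -/(total_variation _ _ _) -(fineK (TVlr i)) -EFinB lte_fin => /ltW.
  by rewrite lerBlDr => ?; exists s.
apply: (@le_trans _ _ (\sum_(i < n) (variation (l i) (r i) h (s i) + z / n.+1%:R))).
  by apply: ler_sum => i _; case: (Hs i).
rewrite big_split/= lerD//.
  by apply/ltW/H => // i; case: (Hs i).
rewrite sumr_const card_ord -[_ *+ n]mulr_natr mulrAC ler_pdivrMr// ler_pM2l//.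
by rewrite ler_nat.
Qed.

End variation_of_acR.

(** * Fundamental theorem of calculus for absolutely continuous functions *)

Section fundamental_theorem.
Context {R : realType}.
Implicit Types (a b : R) (h : R -> R).
Local Notation mu := (@lebesgue_measure R).

Lemma density_FTC a b F (g : R -> R) : mu.-integrable setT (EFin \o g) ->
  (forall x, a <= x -> x <= b ->
      (\int[mu]_(t in `]a, x]) (g t)%:E = (F x - F a)%:E)%E) ->
  {ae mu, forall x, a < x -> x < b -> is_derive x 1 F (g x)}.
Proof.
move=> ig gF.
have ig' y : mu.-integrable [set` Interval (BRight a) (BRight y)] (EFin \o g).
  exact: integrableS ig.
have := FTC1 ig' (open_integrable_locally openT ig); apply: filterS; first exact: (ae_filter_ringOfSetsType mu).
move=> x /= H ax xb.
have [dF F'] := H ax.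
pose G y := \int[mu]_(t in `]a, y]) g t + F a.
apply: (@near_eq_is_derive _ _ _ G).
  near=> y; have : y \in `]a, b[.
    by near: y; apply: near_in_itvoo; rewrite in_itv/= ax xb.
  rewrite in_itv/= => /andP[/ltW ay /ltW yb].
  by rewrite /G /Rintegral gF//= subrK.
rewrite -[g x]addr0; apply: is_deriveD.
by apply: DeriveDef; [exact: dF|rewrite -derive1E F'].
Unshelve. all: by end_near. Qed.

(** Jordan decomposition: [h = V - W] with [V] the total variation, both parts nondecreasing and
    absolutely continuous. Their densities give h' = g1 - g2 almost everywhere, with integral h(b) -
    h(a). The measurable |g1 - g2| can be compared with [phi] outside a null set. *)
Lemma acR_le_lint a b h (phi : R -> \bar R) : a <= b -> acR a b h ->
  (forall t, a <= t -> t <= b -> (0 <= phi t)%E) ->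
  (forall t, a < t -> t < b -> (`|derive1 h t|%:E <= phi t)%E) ->
  (`|h b - h a|%:E <= \int[mu]_(t in `[a, b]) phi t)%E.
Proof.
move=> ab ah phi0 hphi.
pose V x := fine (total_variation a x h); pose W x := V x - h x.
have Vfin x : a <= x -> x <= b -> total_variation a x h \is a fin_num by exact: acR_TV_fin.
have VB x y : a <= x -> x <= y -> y <= b -> `|h y - h x| <= V y - V x.
  move=> ax xy yb; have xb := le_trans xy yb; have ay := le_trans ax xy.
  rewrite -lee_fin /V EFinB !fineK ?Vfin// (total_variationD _ ax xy).
  by rewrite addeAC subee ?Vfin// add0e total_variation_ge.
have Vnd : {in `[a, b] &, nondecreasing_fun V}.
  move=> x y; rewrite !in_itv/= => /andP[ax xb] /andP[ay yb] xy.
  by rewrite -subr_ge0 (le_trans _ (VB _ _ ax xy yb)).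
have Wnd : {in `[a, b] &, nondecreasing_fun W}.
  move=> x y; rewrite !in_itv/= => /andP[ax xb] /andP[ay yb] xy.
  by have := VB _ _ ax xy yb; rewrite /W ler_norml => /andP[_]; lra.
have aV : acR a b V by exact: acR_TV.
have aW : acR a b W by exact: acRB.
have [g1 [g10 ig1 g1V]] := acR_density ab aV Vnd.
have [g2 [g20 ig2 g2W]] := acR_density ab aW Wnd.
have D1 := density_FTC ig1 g1V; have D2 := density_FTC ig2 g2W.
have igB : mu.-integrable setT (EFin \o (fun x => g1 x - g2 x)).
  by have := integrableB measurableT ig1 ig2.
have mab : measurable (`]a, b[%classic : set R) by exact: measurable_itv.
have E : (`|h b - h a|%:E = `|\int[mu]_(t in `]a, b]) (g1 t - g2 t)%:E|)%E.
  under eq_integral do rewrite EFinB.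
  rewrite integralB_EFin//; [|exact: integrableS ig1|exact: integrableS ig2].
  rewrite g1V// g2W// -EFinB /= /W; congr (`|_|%:E); ring.
rewrite {}E; apply: (@le_trans _ _ (\int[mu]_(t in `]a, b[) `|(g1 t - g2 t)%:E|)%E).
  rewrite [leRHS]integral_itv_bndo_bndc; last first.
    apply: measurableT_comp => //; apply: measurable_funTS.
    exact: measurable_int igB.
  apply: le_abse_integral => //.
  by apply: measurable_funTS; exact: measurable_int igB.
apply: (@le_trans _ _ (\int[mu]_(t in `]a, b[) phi t)%E).
  apply: ae_le_lint.
  - exact: mab.
  - apply: measurableT_comp => //; apply: measurable_funTS.
    exact: measurable_int igB.
  - by move=> x /=; rewrite in_itv/= => /andP[/ltW ax /ltW xb]; exact: phi0.
  - by move=> x _; exact: abse_ge0.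
  apply: (filterS2 (ae_filter_ringOfSetsType mu) _ D1 D2).
  move=> x d1 d2 /=; rewrite in_itv/= => /andP[ax xb].
  have := hphi x ax xb; rewrite (_ : derive1 h x = g1 x - g2 x)//.
  have d12 : is_derive x 1 h (g1 x - g2 x).
    rewrite [h](_ : _ = V - W); first exact: is_deriveB (d1 ax xb) (d2 ax xb).
    by apply/funext => y; rewrite /W !fctE opprB addrC subrK.
  by rewrite derive1E; exact: (@derive_val _ _ _ _ _ _ _ d12).
apply: lint_le => x /=; rewrite !in_itv/= => /andP[].
- by move=> /ltW ? /ltW ?; exact: phi0.
- by move=> ? ?; exact: phi0.
- by move=> /ltW ax /ltW xb; rewrite ax xb.
Qed.

End fundamental_theorem.

(** * Complex differentiable functions *)

Notation normc := ComplexField.Normc.normc.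

Section complex_modulus.
Context {R : realType}.
Implicit Types (z w : R[i]).

Lemma normcE z : `|z| = (normc z)%:C.
Proof. by case: z => a b; rewrite normc_def. Qed.

Lemma normc_ge0 z : 0 <= normc z.
Proof. by case: z => a b; exact: sqrtr_ge0. Qed.

Lemma normc_eq0 z : (normc z == 0) = (z == 0).
Proof.
apply/eqP/eqP => [|->]; last exact: ComplexField.Normc.normc0.
exact: ComplexField.Normc.eq0_normc.
Qed.

Lemma normc_gt0 z : (0 < normc z) = (z != 0).
Proof. by rewrite lt_def normc_ge0 andbT normc_eq0. Qed.

Lemma normcD z w : normc (z + w) <= normc z + normc w.
Proof. exact: le_normcD. Qed.

Lemma normcN z : normc (- z) = normc z.
Proof. exact: complex.normcN. Qed.

Lemma normcB z w : normc (z - w) <= normc z + normc w.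
Proof. by rewrite -(normcN w); exact: normcD. Qed.

Lemma distcC z w : normc (z - w) = normc (w - z).
Proof. by rewrite -normcN opprB. Qed.

Lemma normcM z w : normc (z * w) = normc z * normc w.
Proof. exact: ComplexField.Normc.normcM. Qed.

Lemma normcV z : normc z^-1 = (normc z)^-1.
Proof. exact: ComplexField.Normc.normcV. Qed.

Lemma normc_real (x : R) : normc x%:C = `|x|.
Proof. by rewrite /= expr0n/= addr0 sqrtr_sqr. Qed.

Lemma normc1 : normc (1 : R[i]) = 1.
Proof. exact: ComplexField.Normc.normc1. Qed.

Lemma normc_Re z : `|complex.Re z| <= normc z.
Proof.
case: z => a b /=; rewrite -{1}(sqrtr_sqr a) ler_wsqrtr// lerDl.
exact: sqr_ge0.
Qed.

Lemma normc_Im z : `|complex.Im z| <= normc z.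
Proof.
case: z => a b /=; rewrite -{1}(sqrtr_sqr b) ler_wsqrtr// lerDr.
exact: sqr_ge0.
Qed.

Lemma normc_le_ReIm z : normc z <= `|complex.Re z| + `|complex.Im z|.
Proof.
rewrite {1}(_ : z = (complex.Re z)%:C + 'i%C * (complex.Im z)%:C); last first.
  by case: z => a b; apply/eqP; rewrite eq_complex/=; apply/andP; split; apply/eqP; ring.
apply: (le_trans (normcD _ _)); rewrite normc_real lerD2l normcM normc_real.
by rewrite /= expr0n/= add0r expr1n sqrtr1 mul1r.
Qed.

Lemma gt0_complex (d : R[i]) : 0 < d -> exists2 e : R, 0 < e & d = e%:C.
Proof.
case: d => a b; rewrite ltcE/= => /andP[/eqP -> a0]; by exists a.
Qed.

Lemma nbhs_normcP z (A : set R[i]) :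
  nbhs z A <-> exists2 e : R, 0 < e & forall w, normc (w - z) < e -> A w.
Proof.
rewrite -nbhs_ballE; split.
  move=> [d /= /gt0_complex[e e0 ->] H]; exists e => // w we; apply: H.
  by rewrite -ball_normE/= normcE ltcR distcC.
move=> [e e0 H]; exists e%:C; first by rewrite /= ltcR.
by move=> w; rewrite -ball_normE/= normcE ltcR distcC; exact: H.
Qed.

Lemma derivable_normc (f : R[i] -> R[i]) z : derivable f z 1 ->
  forall e : R, 0 < e -> exists2 d : R, 0 < d & forall w, normc (w - z) < d ->
    normc (f w - f z - 'D_1 f z * (w - z)) <= e * normc (w - z).
Proof.
move=> df e e0.
have : (fun h : R[i] => h^-1 *: ((f \o shift z) (h *: 1) - f z)) @ 0^' --> 'D_1 f z.
  exact: df.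
move=> /cvgrPdist_le/(_ e%:C); rewrite ltcR => /(_ e0).
rewrite near_withinE => /nbhs_normcP[d d0 H]; exists d => // w wd.
have [->|wz] := eqVneq w z.
  by rewrite !subrr mulr0 subrr ComplexField.Normc.normc0 mulr0.
have wz0 : w - z != 0 by rewrite subr_eq0.
have := H (w - z); rewrite subr0 => /(_ wd wz0).
rewrite normcE lecR /= [_ *: 1]mulr1 subrK => {}H.
rewrite [X in normc X](_ : _ = - (('D_1 f z - (w - z)^-1 * (f w - f z)) * (w - z))).
  by rewrite normcN normcM ler_wpM2r// normc_ge0.
by rewrite mulrBl mulrAC mulVf// mul1r opprB.
Qed.

End complex_modulus.

(** * Integrals along the sides of a rectangle *)

Section segment_integral.
Context {R : realType}.
Implicit Types (f g : R -> R) (a b c m M : R).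
Local Notation mu := (@lebesgue_measure R).

Definition segint f a b : R := (\int[mu]_(x in `[a, b]) f x)%R.

Definition continuous_on f a b := forall x, a <= x -> x <= b -> {for x, continuous f}.

Lemma continuous_on_integrable f a b : continuous_on f a b ->
  mu.-integrable `[a, b] (EFin \o f).
Proof.
move=> cf; apply: continuous_compact_integrable; first exact: segment_compact.
apply: continuous_in_subspaceT => x; rewrite inE/= in_itv/= => /andP[ax xb].
exact: cf.
Qed.

Lemma continuous_onS f a b a' b' : a <= a' -> b' <= b ->
  continuous_on f a b -> continuous_on f a' b'.
Proof. by move=> aa bb H x ax xb; apply: H; [exact: le_trans ax|exact: le_trans bb]. Qed.

Lemma segint_cst a b m : a <= b -> segint (fun=> m) a b = m * (b - a).
Proof.
move=> ab; transitivity (m * fine (mu `[a, b]%classic)).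
  by apply: Rintegral_cst; exact: measurable_itv.
rewrite lebesgue_measure_itv/= lte_fin; case: ltP => [//|ba].
by rewrite (_ : b = a) ?subrr ?mulr0//; apply/eqP; rewrite eq_le ba.
Qed.

Lemma le_segint f g a b : continuous_on f a b -> continuous_on g a b ->
  (forall x, a <= x -> x <= b -> f x <= g x) -> segint f a b <= segint g a b.
Proof.
move=> cf cg fg; apply: le_Rintegral.
- exact: measurable_itv.
- exact: continuous_on_integrable.
- exact: continuous_on_integrable.
- by move=> x /=; rewrite in_itv/= => /andP[]; exact: fg.
Qed.

Lemma segint_le f a b M : a <= b -> continuous_on f a b ->
  (forall x, a <= x -> x <= b -> f x <= M) -> segint f a b <= M * (b - a).
Proof.
move=> ab cf fM; rewrite -segint_cst//; apply: le_segint => // x _ _; exact: cvg_cst.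
Qed.

Lemma segint_ge f a b m : a <= b -> continuous_on f a b ->
  (forall x, a <= x -> x <= b -> m <= f x) -> m * (b - a) <= segint f a b.
Proof.
move=> ab cf fM; rewrite -segint_cst//; apply: le_segint => // x _ _; exact: cvg_cst.
Qed.

Lemma segint_near f a b c e : a <= b -> continuous_on f a b ->
  (forall x, a <= x -> x <= b -> `|f x - c| <= e) ->
  `|segint f a b - c * (b - a)| <= e * (b - a).
Proof.
move=> ab cf H; have Hp x (ax : a <= x) (xb : x <= b) := H x ax xb.
have l : segint f a b <= (c + e) * (b - a).
  by apply: segint_le => // x ax xb; have := Hp _ ax xb; rewrite ler_norml; lra.
have g : (c - e) * (b - a) <= segint f a b.
  by apply: segint_ge => // x ax xb; have := Hp _ ax xb; rewrite ler_norml; lra.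
by rewrite ler_norml; lra.
Qed.

Lemma segint_split f a c b : a <= c -> c <= b -> continuous_on f a b ->
  segint f a b = segint f a c + segint f c b.
Proof.
move=> ac cb cf; have icb : mu.-integrable `[c, b] (EFin \o f).
  by apply: continuous_on_integrable; exact: continuous_onS cf.
rewrite /segint (_ : `[a, b]%classic = `[a, c] `|` `]c, b]).
  rewrite Rintegral_setU//.
  - rewrite (Rintegral_itv_obnd_cbnd (r := c))//.
    by apply: integrableS icb => // x /=; rewrite !in_itv/= => /andP[/ltW -> ->].
  - rewrite (_ : _ `|` _ = `[a, b]%classic); first exact: continuous_on_integrable.
    apply/seteqP; split => x /=; rewrite !in_itv/=.
      by move=> [/andP[-> /le_trans ->]//|/andP[cx ->]]; rewrite (le_trans ac (ltW cx)).
    by move=> /andP[ax xb]; have [xc|xc] := leP x c; [left; rewrite ax|right].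
  - apply/disj_setPS => x [/=]; rewrite !in_itv/= => /andP[_ xc] /andP[cx _].
    by have := lt_le_trans cx xc; rewrite ltxx.
apply/seteqP; split => x /=; rewrite !in_itv/=.
  by move=> /andP[ax xb]; have [xc|xc] := leP x c; [left; rewrite ax|right].
by move=> [/andP[-> /le_trans ->]//|/andP[cx ->]]; rewrite (le_trans ac (ltW cx)).
Qed.

Lemma segintD f g a b : continuous_on f a b -> continuous_on g a b ->
  segint (fun x => f x + g x) a b = segint f a b + segint g a b.
Proof.
move=> cf cg; apply: RintegralD; first exact: measurable_itv.
- exact: continuous_on_integrable.
- exact: continuous_on_integrable.
Qed.

End segment_integral.

(** * Goursat's theorem *)

Section rectangle_subdivision.
Context {R : realType}.
Variables (T : R -> R -> R -> R -> R) (x1 x2 y1 y2 : R).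
Hypotheses (x12 : x1 <= x2) (y12 : y1 <= y2).
Hypothesis Tx : forall a c b y y', x1 <= a -> a <= c -> c <= b -> b <= x2 ->
  y1 <= y -> y <= y' -> y' <= y2 -> T a b y y' = T a c y y' + T c b y y'.
Hypothesis Ty : forall x x' a c b, x1 <= x -> x <= x' -> x' <= x2 ->
  y1 <= a -> a <= c -> c <= b -> b <= y2 -> T x x' a b = T x x' a c + T x x' c b.
Hypothesis Tloc : forall x y e, x1 <= x -> x <= x2 -> y1 <= y -> y <= y2 -> 0 < e ->
  exists2 d, 0 < d & forall a b a' b', x1 <= a -> b <= x2 -> y1 <= a' -> b' <= y2 ->
    a <= x -> x <= b -> a' <= y -> y <= b' -> b - a < d -> b' - a' < d ->
    `|T a b a' b'| <= e * ((b - a) + (b' - a')) ^+ 2.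

(** Bisection for an additive function of rectangles. If |T| exceeds e (w + h)^2 on a rectangle, it
    does so on one of the four quarters, since the bound is divided by exactly four. The nested bad
    rectangles shrink to a point, where [Tloc] is contradicted. *)
Lemma rectangle_subdivision : T x1 x2 y1 y2 = 0.
Proof.
have x12v := x12; have y12v := y12.
apply/eqP; rewrite -normr_le0; apply/ler_addgt0Pr => e0 e00; rewrite add0r.
pose w n := (x2 - x1) / 2 ^+ n; pose h n := (y2 - y1) / 2 ^+ n.
have wS n : w n = w n.+1 + w n.+1.
  by rewrite /w exprS invfM; move: (2 ^+ n)^-1 => t; field.
have hS n : h n = h n.+1 + h n.+1.
  by rewrite /h exprS invfM; move: (2 ^+ n)^-1 => t; field.
have w0 n : 0 <= w n by rewrite /w divr_ge0// ?subr_ge0// exprn_ge0//; lra.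
have h0 n : 0 <= h n by rewrite /h divr_ge0// ?subr_ge0// exprn_ge0//; lra.
pose s := (x2 - x1) + (y2 - y1).
have s0 : 0 <= s by rewrite /s addr_ge0 ?subr_ge0.
have [e e_gt0 es] : exists2 e, 0 < e & e * s ^+ 2 <= e0.
  exists (e0 / (s ^+ 2 + 1)); first by rewrite divr_gt0// ltr_pwDr// sqr_ge0.
  have ? := sqr_ge0 s.
  by rewrite mulrAC ler_pdivrMr ?ltr_pwDr// ler_pM2l//; lra.
apply: le_trans es; rewrite leNgt; apply/negP => bad0.
pose inr n (p : R * R) := [/\ x1 <= p.1, p.1 + w n <= x2, y1 <= p.2 & p.2 + h n <= y2].
pose bad n (p : R * R) := inr n p /\
  e * (w n + h n) ^+ 2 < `|T p.1 (p.1 + w n) p.2 (p.2 + h n)|.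
(* The implication stands under the existential so that [choice] yields a total successor function,
   defined on good rectangles as well. *)
have step np : exists q : R * R, bad np.1 np.2 ->
   [/\ bad np.1.+1 q, np.2.1 <= q.1, q.1 + w np.1.+1 <= np.2.1 + w np.1,
       np.2.2 <= q.2 & q.2 + h np.1.+1 <= np.2.2 + h np.1].
  case: np => n [x y] /=; apply: contrapT => /forallNP no.
  have bxy : bad n (x, y) by apply: contrapT => nb; exact: (no (x, y)).
  case: bxy => -[/= xx1 xx2 yy1 yy2].
  have wSn := wS n; have hSn := hS n; have wSn0 := w0 n.+1; have hSn0 := h0 n.+1.
  pose E := e * (w n.+1 + h n.+1) ^+ 2.
  have good dx dy : (dx = 0 \/ dx = w n.+1) -> (dy = 0 \/ dy = h n.+1) ->
      `|T (x + dx) (x + dx + w n.+1) (y + dy) (y + dy + h n.+1)| <= E.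
    move=> Hdx Hdy; rewrite leNgt; apply/negP => lt; apply: (no (x + dx, y + dy)) => _.
    have /andP[dx0 dx1] : 0 <= dx <= w n.+1 by case: Hdx => ->; rewrite lexx ?wSn0.
    have /andP[dy0 dy1] : 0 <= dy <= h n.+1 by case: Hdy => ->; rewrite lexx ?hSn0.
    by split => /=; [split => //; split => /=; clear -xx1 xx2 yy1 yy2 wSn hSn dx0 dx1 dy0 dy1|..]; lra.
  have := good 0 0 (or_introl erefl) (or_introl erefl).
  have := good (w n.+1) 0 (or_intror erefl) (or_introl erefl).
  have := good 0 (h n.+1) (or_introl erefl) (or_intror erefl).
  have := good (w n.+1) (h n.+1) (or_intror erefl) (or_intror erefl).
  rewrite !addr0 -!addrA -wSn -hSn => G1 G2 G3 G4.
  have -> : e * (w n + h n) ^+ 2 = E *+ 4.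
    by rewrite /E wSn hSn; ring.
  rewrite (@Tx _ (x + w n.+1))//; try lra.
  rewrite (@Ty _ _ _ (y + h n.+1))//; try lra.
  rewrite (@Ty (x + w n.+1) _ _ (y + h n.+1))//; try lra.
  apply/negP; rewrite -leNgt.
  apply: (le_trans (ler_normD _ _)).
  have := ler_normD (T x (x + w n.+1) y (y + h n.+1)) (T x (x + w n.+1) (y + h n.+1) (y + h n)).
  have := ler_normD (T (x + w n.+1) (x + w n) y (y + h n.+1)) (T (x + w n.+1) (x + w n) (y + h n.+1) (y + h n)).
  lra.
have [nxt Hnxt] := choice step.
pose p := fix p n := if n is m.+1 then nxt (m, p m) else (x1, y1).
have badp n : bad n (p n).
  elim: n => [|n IH]; last by have [] := Hnxt (n, p n) IH.
  rewrite /bad /inr /= /w /h expr0 !divr1 !lexx !subrKC lexx; split => //.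
have mono n : [/\ (p n).1 <= (p n.+1).1, (p n.+1).1 + w n.+1 <= (p n).1 + w n,
    (p n).2 <= (p n.+1).2 & (p n.+1).2 + h n.+1 <= (p n).2 + h n].
  by have [] := Hnxt (n, p n) (badp n).
have lo n m : (n <= m)%N -> [/\ (p n).1 <= (p m).1, (p m).1 + w m <= (p n).1 + w n,
    (p n).2 <= (p m).2 & (p m).2 + h m <= (p n).2 + h n].
  elim: m => [|m IH]; first by rewrite leqn0 => /eqP ->.
  rewrite leq_eqVlt => /predU1P[->//|]; rewrite ltnS => /IH[a1 a2 a3 a4].
  have [b1 b2 b3 b4] := mono m; split; lra.
(* Every lower left corner is below every upper right corner, so the suprema [X] and [Y] of the
   former lie in all the rectangles. *)
have cross n m : [/\ (p n).1 <= (p m).1 + w m & (p n).2 <= (p m).2 + h m].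
  have [nm|/ltnW mn] := leqP n m.
    by have [a1 a2 a3 a4] := lo _ _ nm; have := w0 m; have := h0 m; split; lra.
  by have [a1 a2 a3 a4] := lo _ _ mn; have := w0 n; have := h0 n; split; lra.
pose X := sup (range (fun n => (p n).1)); pose Y := sup (range (fun n => (p n).2)).
have ubX m : ubound (range (fun n => (p n).1)) ((p m).1 + w m).
  by move=> _ [n _ <-]; have [] := cross n m.
have ubY m : ubound (range (fun n => (p n).2)) ((p m).2 + h m).
  by move=> _ [n _ <-]; have [] := cross n m.
have Xl n : (p n).1 <= X by apply: ub_le_sup; [exists ((p 0%N).1 + w 0%N)|exists n].
have Yl n : (p n).2 <= Y by apply: ub_le_sup; [exists ((p 0%N).2 + h 0%N)|exists n].
have Xu n : X <= (p n).1 + w n by apply: ge_sup => //; exists (p 0%N).1; exists 0%N.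
have Yu n : Y <= (p n).2 + h n by apply: ge_sup => //; exists (p 0%N).2; exists 0%N.
have [[_ _ _ _] _] := badp 0%N.
have [d d0 Hd] : exists2 d, 0 < d & forall a b a' b', x1 <= a -> b <= x2 -> y1 <= a' -> b' <= y2 ->
    a <= X -> X <= b -> a' <= Y -> Y <= b' -> b - a < d -> b' - a' < d ->
    `|T a b a' b'| <= e * ((b - a) + (b' - a')) ^+ 2.
  have := Xl 0%N; have := Xu 0%N; have := Yl 0%N; have := Yu 0%N.
  rewrite /= /w /h expr0 !divr1 => *; apply: Tloc => //; lra.
have [n Hn] : exists n, s / 2 ^+ n < d.
  have sd0 : 0 <= s / d by rewrite divr_ge0// ltW.
  exists (Num.bound (s / d)); rewrite ltr_pdivrMr ?exprn_gt0//.
  rewrite mulrC -ltr_pdivrMr//; apply: (lt_trans (archi_boundP sd0)).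
  by rewrite -natrX ltr_nat ltn_expl.
have [[i1 i2 i3 i4]] := badp n; apply/negP; rewrite -leNgt.
have /= Hs : w n + h n < d by rewrite /w /h -mulrDl.
have := Hd (p n).1 ((p n).1 + w n) (p n).2 ((p n).2 + h n) i1 i2 i3 i4
  (Xl n) (Xu n) (Yl n) (Yu n).
have -> : (p n).1 + w n - (p n).1 = w n by rewrite addrAC subrr add0r.
have -> : (p n).2 + h n - (p n).2 = h n by rewrite addrAC subrr add0r.
have wn0 := w0 n; have hn0 := h0 n; apply; lra.
Qed.

End rectangle_subdivision.

Section goursat.
Context {R : realType}.
Implicit Types (phi f : R[i] -> R[i]) (x y a b c e : R).

Lemma derivable_continuous_normc phi z : derivable phi z 1 ->
  forall e, 0 < e -> exists2 d : R, 0 < d &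
    forall w, normc (w - z) < d -> normc (phi w - phi z) < e.
Proof.
move=> dphi e e0.
have : {for z, continuous phi}.
  exact/differentiable_continuous/derivable1_diffP.
move=> /cvgrPdist_lt/(_ e%:C); rewrite ltcR => /(_ e0)/nbhs_normcP[d d0 H].
exists d => // w /H; by rewrite normcE ltcR distcC.
Qed.

Lemma derivable_continuous_line phi (G : R[i] -> R) (g : R -> R[i]) x :
  (forall z w, `|G z - G w| <= normc (z - w)) ->
  (forall s t, normc (g s - g t) = `|s - t|) ->
  derivable phi (g x) 1 -> {for x, continuous (G \o phi \o g)}.
Proof.
move=> HG Hg dphi; apply/cvgrPdist_lt => e e0.
have [d d0 H] := derivable_continuous_normc dphi e0.
near=> y; apply: le_lt_trans (HG _ _) _; rewrite distcC; apply: H.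
rewrite Hg distrC; near: y; exact: cvgr_dist_lt.
Unshelve. all: by end_near. Qed.

Lemma Re_lip (z w : R[i]) : `|complex.Re z - complex.Re w| <= normc (z - w).
Proof. by rewrite -raddfB; exact: normc_Re. Qed.

Lemma Im_lip (z w : R[i]) : `|complex.Im z - complex.Im w| <= normc (z - w).
Proof. by rewrite -raddfB; exact: normc_Im. Qed.

Lemma horiz_isom y s t : normc ((s +i* y) - (t +i* y)) = `|s - t|.
Proof. by rewrite /= subrr expr0n/= addr0 sqrtr_sqr. Qed.

Lemma vert_isom x s t : normc ((x +i* s) - (x +i* t)) = `|s - t|.
Proof. by rewrite /= subrr expr0n/= add0r sqrtr_sqr. Qed.

Definition bottom_top phi y1 y2 x :=
  complex.Re (phi (x +i* y1)) - complex.Re (phi (x +i* y2)).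
Definition right_left phi x1 x2 y :=
  complex.Im (phi (x2 +i* y)) - complex.Im (phi (x1 +i* y)).

(* The real part of the integral of [phi] along the boundary of the rectangle
   [x1, x2] x [y1, y2]. *)
Definition rectint phi x1 x2 y1 y2 : R :=
  segint (bottom_top phi y1 y2) x1 x2 - segint (right_left phi x1 x2) y1 y2.

Lemma bottom_top_cont phi y1 y2 a b :
  (forall x, a <= x -> x <= b -> derivable phi (x +i* y1) 1) ->
  (forall x, a <= x -> x <= b -> derivable phi (x +i* y2) 1) ->
  continuous_on (bottom_top phi y1 y2) a b.
Proof.
move=> d1 d2 x ax xb; apply: (@cvgB _ R).
- exact: (derivable_continuous_line (g := fun t => t +i* y1) Re_lip (horiz_isom y1) (d1 x ax xb)).
- exact: (derivable_continuous_line (g := fun t => t +i* y2) Re_lip (horiz_isom y2) (d2 x ax xb)).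
Qed.

Lemma right_left_cont phi x1 x2 a b :
  (forall y, a <= y -> y <= b -> derivable phi (x1 +i* y) 1) ->
  (forall y, a <= y -> y <= b -> derivable phi (x2 +i* y) 1) ->
  continuous_on (right_left phi x1 x2) a b.
Proof.
move=> d1 d2 y ay yb; apply: (@cvgB _ R).
- exact: (derivable_continuous_line (g := fun t => x2 +i* t) Im_lip (vert_isom x2) (d2 y ay yb)).
- exact: (derivable_continuous_line (g := fun t => x1 +i* t) Im_lip (vert_isom x1) (d1 y ay yb)).
Qed.

Lemma rectint_splitx phi a c b y1 y2 : a <= c -> c <= b ->
  (forall x, a <= x -> x <= b -> derivable phi (x +i* y1) 1 /\ derivable phi (x +i* y2) 1) ->
  (forall y, y1 <= y -> y <= y2 ->
    [/\ derivable phi (a +i* y) 1, derivable phi (c +i* y) 1 & derivable phi (b +i* y) 1]) ->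
  rectint phi a b y1 y2 = rectint phi a c y1 y2 + rectint phi c b y1 y2.
Proof.
move=> ac cb dh dv; rewrite /rectint (segint_split ac cb); last first.
  by apply: bottom_top_cont => x ax xb; case: (dh x ax xb).
rewrite (_ : right_left phi a b = fun y => right_left phi c b y + right_left phi a c y).
  rewrite segintD; first ring.
  - by apply: right_left_cont => y ay yb; case: (dv y ay yb).
  - by apply: right_left_cont => y ay yb; case: (dv y ay yb).
by apply/funext => y; rewrite /right_left; ring.
Qed.

Lemma rectint_splity phi x1 x2 a c b : a <= c -> c <= b ->
  (forall y, a <= y -> y <= b -> derivable phi (x1 +i* y) 1 /\ derivable phi (x2 +i* y) 1) ->
  (forall x, x1 <= x -> x <= x2 ->
    [/\ derivable phi (x +i* a) 1, derivable phi (x +i* c) 1 & derivable phi (x +i* b) 1]) ->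
  rectint phi x1 x2 a b = rectint phi x1 x2 a c + rectint phi x1 x2 c b.
Proof.
move=> ac cb dv dh; rewrite /rectint (segint_split (f := right_left _ _ _) ac cb); last first.
  by apply: right_left_cont => x ax xb; case: (dv x ax xb).
rewrite (_ : bottom_top phi a b = fun y => bottom_top phi a c y + bottom_top phi c b y).
  rewrite segintD; first ring.
  - by apply: bottom_top_cont => y ay yb; case: (dh y ay yb).
  - by apply: bottom_top_cont => y ay yb; case: (dh y ay yb).
by apply/funext => y; rewrite /bottom_top; ring.
Qed.

(** Both integrals have the main term l (x2 - x1) (y2 - y1), and these cancel. In [goursat] the
    number [l] is the imaginary part of the derivative, the slope that an affine function gives to
    both differences; with [l = 0] this is the plain bound by the perimeter. *)
Lemma rectint_near phi x1 x2 y1 y2 l eta : x1 <= x2 -> y1 <= y2 ->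
  (forall x, x1 <= x -> x <= x2 -> derivable phi (x +i* y1) 1 /\ derivable phi (x +i* y2) 1) ->
  (forall y, y1 <= y -> y <= y2 -> derivable phi (x1 +i* y) 1 /\ derivable phi (x2 +i* y) 1) ->
  (forall x, x1 <= x -> x <= x2 -> `|bottom_top phi y1 y2 x - l * (y2 - y1)| <= eta) ->
  (forall y, y1 <= y -> y <= y2 -> `|right_left phi x1 x2 y - l * (x2 - x1)| <= eta) ->
  `|rectint phi x1 x2 y1 y2| <= eta * ((x2 - x1) + (y2 - y1)).
Proof.
move=> x12 y12 dh dv H1 H2.
have c1 : continuous_on (bottom_top phi y1 y2) x1 x2.
  by apply: bottom_top_cont => x ax xb; case: (dh x ax xb).
have c2 : continuous_on (right_left phi x1 x2) y1 y2.
  by apply: right_left_cont => x ax xb; case: (dv x ax xb).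
have := segint_near x12 c1 H1; have := segint_near y12 c2 H2.
rewrite /rectint; set s1 := segint _ _ _; set s2 := segint _ _ _ => h2 h1.
rewrite (_ : s2 - s1 = (s2 - l * (y2 - y1) * (x2 - x1)) - (s1 - l * (x2 - x1) * (y2 - y1))); last ring.
by apply: le_trans (ler_normB _ _) _; rewrite [leRHS]mulrDr lerD.
Qed.

Fact bottom_top_affine (p l z1 z2 : R[i]) x y t a b :
  complex.Re (p + l * ((t +i* a) - (x +i* y)) + z1) -
  complex.Re (p + l * ((t +i* b) - (x +i* y)) + z2) - complex.Im l * (b - a) =
  complex.Re z1 - complex.Re z2.
Proof. by case: z1 z2 l p => [z11 z12] [z21 z22] [l1 l2] [p1 p2] /=; ring. Qed.

Fact right_left_affine (p l z1 z2 : R[i]) x y t a b :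
  complex.Im (p + l * ((b +i* t) - (x +i* y)) + z2) -
  complex.Im (p + l * ((a +i* t) - (x +i* y)) + z1) - complex.Im l * (b - a) =
  complex.Im z2 - complex.Im z1.
Proof. by case: z1 z2 l p => [z11 z12] [z21 z22] [l1 l2] [p1 p2] /=; ring. Qed.

Lemma goursat phi x1 x2 y1 y2 : x1 <= x2 -> y1 <= y2 ->
  (forall x y, x1 <= x -> x <= x2 -> y1 <= y -> y <= y2 -> derivable phi (x +i* y) 1) ->
  rectint phi x1 x2 y1 y2 = 0.
Proof.
move=> x12 y12 dphi.
apply: (rectangle_subdivision x12 y12 (T := rectint phi)).
- move=> a c b y y' xa ac cb bx yy yy' yy2; apply: rectint_splitx => // [x ax xb|y0 a1 a2].
    by split; apply: dphi => //; lra.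
  by split; apply: dphi => //; lra.
- move=> x x' a c b xx xx' xx2 ya ac cb by_; apply: rectint_splity => // [y ay yb|x0 a1 a2].
    by split; apply: dphi => //; lra.
  by split; apply: dphi => //; lra.
- move=> x y e xx1 xx2 yy1 yy2 e0.
  have e20 : 0 < e / 2 by lra.
  have [d d0 Hd] := derivable_normc (dphi x y xx1 xx2 yy1 yy2) e20.
  exists (d / 2); first by lra.
  move=> a b a' b' xa bx ya by_ ax xb a'y yb' ba b'a'.
  set l := 'D_1 phi (x +i* y); set s := (b - a) + (b' - a').
  have s_lt : s < d by rewrite /s; lra.
  pose r w := phi w - phi (x +i* y) - l * (w - (x +i* y)).
  have rb u v : a <= u -> u <= b -> a' <= v -> v <= b' -> normc (r (u +i* v)) <= e / 2 * s.
    move=> au ub a'v vb'.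
    have us : normc ((u +i* v) - (x +i* y)) <= s.
      apply: le_trans (normc_le_ReIm _) _ => /=.
      by rewrite /s lerD// ler_norml; lra.
    apply: le_trans (Hd _ (le_lt_trans us s_lt)) _.
    by rewrite ler_pM2l.
  have phiE w : phi w = phi (x +i* y) + l * (w - (x +i* y)) + r w by rewrite /r; ring.
  rewrite (_ : e * s ^+ 2 = e * s * s); last by ring.
  apply: (rectint_near (l := complex.Im l)); try lra.
  + by move=> t at_ tb; split; apply: dphi; lra.
  + by move=> t at_ tb; split; apply: dphi; lra.
  + move=> t at_ tb; rewrite /bottom_top (phiE (t +i* a')) (phiE (t +i* b')).
    have r1 := rb t a' at_ tb (lexx _) ltac:(lra).
    have r2 := rb t b' at_ tb ltac:(lra) (lexx _).
    move: (r (t +i* a')) (r (t +i* b')) r1 r2 => z1 z2 r1 r2.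
    rewrite bottom_top_affine.
    apply: le_trans (ler_normB _ _) _.
    have := normc_Re z1; have := normc_Re z2; lra.
  + move=> t at_ tb; rewrite /right_left (phiE (a +i* t)) (phiE (b +i* t)).
    have r1 := rb a t (lexx _) ltac:(lra) at_ tb.
    have r2 := rb b t ltac:(lra) (lexx _) at_ tb.
    move: (r (a +i* t)) (r (b +i* t)) r1 r2 => z1 z2 r1 r2.
    rewrite right_left_affine.
    apply: le_trans (ler_normB _ _) _.
    have := normc_Im z1; have := normc_Im z2; lra.
Qed.

End goursat.

(** * Cauchy's estimate at the origin *)

Section cauchy_estimate.
Context {R : realType}.
Implicit Types (x y e : R).

Lemma normc_lt x y e : 0 < e -> x ^+ 2 + y ^+ 2 < e ^+ 2 -> normc (x +i* y) < e.
Proof.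
move=> e0 H; rewrite /= -(ger0_norm (ltW e0)) -sqrtr_sqr ltr_sqrt// exprn_gt0//.
Qed.

Variables (f : R[i] -> R[i]) (M : R).
Hypothesis df : forall z, normc z < 1 -> derivable f z 1.
Hypothesis fM : forall z, normc z < 1 -> normc (f z) <= M.

Let D : R[i] := 'D_1 f 0.
Let m := normc D.

Section twisted.
Variable lam : R[i].
Hypothesis lam1 : normc lam = 1.
Hypothesis lamD : lam * D = 0 +i* (- m).

Let F z := lam * ((f z - f 0) * (z^-1 * z^-1)).
(* [phi z = lam * (f z - f 0 - D z) / z^2] is o(1/z) at the origin, so that its
   integral along the boundary of a square centered there vanishes. *)
Let phi z := F z - lam * D * z^-1.

Let phi_derivable z : z != 0 -> normc z < 1 -> derivable phi z 1.
Proof.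
move=> z0 z1.
have dV : derivable (fun w : R[i] => w^-1) z 1.
  by apply: derivableV => //; exact: derivable_id.
have dV2 : derivable (fun w : R[i] => w^-1 * w^-1) z 1 := derivableM dV dV.
have d1 : derivable (fun w => f w - f 0) z 1.
  exact: (derivableB (df z1) (derivable_cst (f 0) z 1)).
have d2 : derivable (fun w => (f w - f 0) * (w^-1 * w^-1)) z 1 := derivableM d1 dV2.
have d3 : derivable F z 1 := derivableM (derivable_cst lam z 1) d2.
have d4 : derivable (fun w : R[i] => lam * D * w^-1) z 1.
  exact: (derivableM (derivable_cst (lam * D) z 1) dV).
exact: (derivableB d3 d4).
Qed.

Let phi_small e : 0 < e -> exists2 d : R, 0 < d & forall z, z != 0 -> normc z < d ->
  normc (phi z) <= e / normc z.
Proof.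
move=> e0; have d0 : derivable f 0 1 by apply: df; rewrite ComplexField.Normc.normc0.
have [d dp Hd] := derivable_normc d0 e0; exists d => // z z0 zd.
have -> : phi z = lam * ((f z - f 0 - D * z) * (z^-1 * z^-1)).
  rewrite /phi /F -(mulrA lam D) -mulrBr; congr (lam * _).
  rewrite [RHS]mulrBl; congr (_ - _).
  by rewrite mulrA mulfK.
have := Hd z; rewrite subr0 => /(_ zd) H.
have nz : 0 < normc z by rewrite normc_gt0.
rewrite !normcM lam1 mul1r !normcV mulrA ler_pM2r ?invr_gt0// ler_pdivrMr//.
Qed.

Let r : R := 1 / 2.

Let sqr_le x : `|x| <= r -> x ^+ 2 <= r ^+ 2.
Proof.
by move=> xr; rewrite -[x ^+ 2]real_normK ?num_real// lerXn2r// nnegrE /r; lra.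
Qed.

Let square_deriv x y : `|x| <= r -> `|y| <= r -> x != 0 \/ y != 0 ->
  derivable phi (x +i* y) 1.
Proof.
move=> xr yr xy; apply: phi_derivable.
  by rewrite eq_complex/= negb_and; case: xy => ->; rewrite ?orbT.
apply: normc_lt => //.
have := sqr_le xr.
have := sqr_le yr.
rewrite /r; nra.
Qed.

(** The region between the squares is cut into four rectangles avoiding the origin: full-height
    strips on the left and right, then the remaining pieces below and above. [goursat] kills each of
    them. *)
Let outer_inner e : 0 < e -> e < r -> rectint phi (- r) r (- r) r = rectint phi (- e) e (- e) e.
Proof.
move=> e0 er; have r0 : 0 < r by rewrite /r; lra.
have nz x : e <= x -> x != 0 by move=> ex; rewrite gt_eqF//; lra.
have nz' x : x <= - e -> x != 0 by move=> ex; rewrite lt_eqF//; lra.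
have ab x : - r <= x -> x <= r -> `|x| <= r by move=> *; rewrite ler_norml; lra.
rewrite (rectint_splitx (c := - e)); first last.
- by move=> y ry yr; split; apply: square_deriv; try (by apply: ab; lra); left;
    rewrite ?oppr_eq0 gt_eqF.
- by move=> x rx xr; split; apply: square_deriv; try (by apply: ab; lra); right;
    rewrite ?oppr_eq0 gt_eqF.
- lra.
- lra.
rewrite (rectint_splitx (a := - e) (c := e)); first last.
- by move=> y ry yr; split; apply: square_deriv; try (by apply: ab; lra); left;
    rewrite ?oppr_eq0 gt_eqF.
- by move=> x rx xr; split; apply: square_deriv; try (by apply: ab; lra); right;
    rewrite ?oppr_eq0 gt_eqF.
- lra.
- lra.
rewrite goursat; first last.
- by move=> x y ? ? ? ?; apply: square_deriv; try (by apply: ab; lra); left; exact: nz'.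
- lra.
- lra.
rewrite (goursat (x1 := e)); first last.
- by move=> x y ? ? ? ?; apply: square_deriv; try (by apply: ab; lra); left; exact: nz.
- lra.
- lra.
rewrite add0r addr0 (rectint_splity (c := - e)); first last.
- by move=> x rx xr; split; apply: square_deriv; try (by apply: ab; lra); right;
    rewrite ?oppr_eq0 gt_eqF.
- by move=> y ry yr; split; apply: square_deriv; try (by apply: ab; lra); left;
    rewrite ?oppr_eq0 gt_eqF.
- lra.
- lra.
rewrite goursat; first last.
- by move=> x y ? ? ? ?; apply: square_deriv; try (by apply: ab; lra); right; exact: nz'.
- lra.
- lra.
rewrite add0r (rectint_splity (a := - e) (c := e)); first last.
- by move=> x rx xr; split; apply: square_deriv; try (by apply: ab; lra); right;
    rewrite ?oppr_eq0 gt_eqF.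
- by move=> y ry yr; split; apply: square_deriv; try (by apply: ab; lra); left;
    rewrite ?oppr_eq0 gt_eqF.
- lra.
- lra.
rewrite (goursat (y1 := e)) ?addr0//.
- lra.
- lra.
- by move=> x y ? ? ? ?; apply: square_deriv; try (by apply: ab; lra); right; exact: nz.
Qed.

(** On the square of half-side [t] the integrand is at most (e / 8) / t, while the perimeter is 8
    t. *)
Let outer0 : rectint phi (- r) r (- r) r = 0.
Proof.
apply/eqP; rewrite -normr_le0; apply/ler_addgt0Pr => e e0; rewrite add0r.
have e80 : 0 < e / 8 by lra.
have [d d0 Hd] := phi_small e80.
pose t := Num.min (d / 3) (1 / 4).
have t0 : 0 < t by rewrite /t lt_min; apply/andP; split; lra.
have td : t <= d / 3 by rewrite /t ge_min lexx.
have tr : t <= 1 / 4 by rewrite /t ge_min lexx orbT.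
rewrite (outer_inner t0); last by rewrite /r; lra.
have nz : t != 0 by rewrite gt_eqF.
have ab x : - t <= x -> x <= t -> `|x| <= r by move=> *; rewrite ler_norml /r; lra.
have side x y : `|x| <= t -> `|y| <= t -> t <= `|x| \/ t <= `|y| ->
    normc (phi (x +i* y)) <= e / 8 / t.
  move=> xt yt H.
  have zt : t <= normc (x +i* y).
    case: H => H; apply: (le_trans H); first exact: (normc_Re (x +i* y)).
    exact: (normc_Im (x +i* y)).
  have z0 : x +i* y != 0 by rewrite -normc_gt0; exact: lt_le_trans zt.
  apply: (le_trans (Hd _ z0 _)).
    by apply: le_lt_trans (normc_le_ReIm _) _ => /=; lra.
  by rewrite ler_pM2l// lef_pV2// posrE// normc_gt0.
have tt : `|t| = t by rewrite gtr0_norm.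
have tN : `|- t| = t by rewrite normrN.
have E : e = 2 * (e / 8 / t) * ((t - - t) + (t - - t)).
  by field; rewrite nz.
rewrite {}[leRHS]E; apply: (rectint_near (l := 0)); try lra.
- move=> x ? ?; split; apply: square_deriv; try (by apply: ab; lra); right; by rewrite ?oppr_eq0.
- move=> x ? ?; split; apply: square_deriv; try (by apply: ab; lra); left; by rewrite ?oppr_eq0.
- move=> x xt tx; rewrite mul0r subr0; apply: (le_trans (ler_normB _ _)).
  have xa : `|x| <= t by rewrite ler_norml xt.
  have h1 := side x (- t) xa ltac:(by rewrite tN) ltac:(by right; rewrite tN).
  have h2 := side x t xa ltac:(by rewrite tt) ltac:(by right; rewrite tt).
  rewrite mulr_natl mulr2n; apply: lerD.
    exact: le_trans (normc_Re _) h1.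
  exact: le_trans (normc_Re _) h2.
- move=> x xt tx; rewrite mul0r subr0; apply: (le_trans (ler_normB _ _)).
  have xa : `|x| <= t by rewrite ler_norml xt.
  have h1 := side (- t) x ltac:(by rewrite tN) xa ltac:(by left; rewrite tN).
  have h2 := side t x ltac:(by rewrite tt) xa ltac:(by left; rewrite tt).
  rewrite mulr_natl mulr2n; apply: lerD.
    exact: le_trans (normc_Im _) h2.
  exact: le_trans (normc_Im _) h1.
Qed.

Let F_le x y : `|x| <= r -> `|y| <= r -> r <= `|x| \/ r <= `|y| ->
  normc (F (x +i* y)) <= 8 * M.
Proof.
move=> xr yr H.
have zr : r <= normc (x +i* y).
  case: H => H; apply: (le_trans H); first exact: (normc_Re (x +i* y)).
  exact: (normc_Im (x +i* y)).
have z1 : normc (x +i* y) < 1.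
  apply: normc_lt => //.
  have := sqr_le xr.
  have := sqr_le yr.
  rewrite /r; nra.
have r0 : 0 < r by rewrite /r; lra.
rewrite /F !normcM lam1 mul1r normcV.
have f0M : normc (f 0) <= M by apply: fM; rewrite ComplexField.Normc.normc0.
have h1 : normc (f (x +i* y) - f 0) <= 2 * M.
  by apply: (le_trans (normcB _ _)); have := fM z1; lra.
have h2 : (normc (x +i* y))^-1 <= 2.
  by rewrite -[2]invrK lef_pV2 ?posrE ?invr_gt0//; [rewrite /r in zr; lra|exact: lt_le_trans zr].
have h0 : 0 <= (normc (x +i* y))^-1 by rewrite invr_ge0 normc_ge0.
rewrite (_ : 8 * M = 2 * M * (2 * 2)); last by ring.
apply: ler_pM => //; [exact: normc_ge0|exact: mulr_ge0|exact: ler_pM].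
Qed.

Let phiE x y : phi (x +i* y) = F (x +i* y) +
  ((m * (y / (x ^+ 2 + y ^+ 2))) +i* (m * (x / (x ^+ 2 + y ^+ 2)))).
Proof.
rewrite /phi lamD -mulNr; congr (_ + _).
apply/eqP; rewrite eq_complex/=; apply/andP; split; apply/eqP; ring.
Qed.

(** By [lamD], [phi] is [F] plus i m / z. On the square of half-side 1/2 the second term adds at
    least m, always with the same sign, to the integrand of each side, because r / (x^2 + r^2) >= 1
    there; [F] takes away at most 8 M. Since the total vanishes, m <= 8 M. *)
Lemma cauchy_estimate_twisted : m <= 8 * M.
Proof.
have r0 : 0 < r by rewrite /r; lra.
have rN : `|- r| = r by rewrite normrN gtr0_norm.
have rP : `|r| = r by rewrite gtr0_norm.
have m0 : 0 <= m by exact: normc_ge0.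
have ker x : - r <= x -> x <= r -> 1 <= r / (x ^+ 2 + r ^+ 2).
  move=> rx xr.
  have H : x ^+ 2 <= r ^+ 2.
    by apply: sqr_le; rewrite ler_norml rx.
  have x2 := sqr_ge0 x.
  rewrite ler_pdivlMr; last by rewrite /r in H *; nra.
  by rewrite mul1r; rewrite /r in H *; nra.
have cA : continuous_on (bottom_top phi (- r) r) (- r) r.
  apply: bottom_top_cont => x xr rx; apply: square_deriv; rewrite ?rN ?rP// ?ler_norml ?xr//;
   by right; rewrite ?oppr_eq0 gt_eqF.
have cB : continuous_on (right_left phi (- r) r) (- r) r.
  apply: right_left_cont => x xr rx; apply: square_deriv; rewrite ?rN ?rP// ?ler_norml ?xr//;
   by left; rewrite ?oppr_eq0 gt_eqF.
have rr : - r <= r by lra.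
have hA : segint (bottom_top phi (- r) r) (- r) r <= (16 * M - 2 * m) * (r - - r).
  apply: segint_le => // x xr rx; rewrite /bottom_top !phiE.
  have xa : `|x| <= r by rewrite ler_norml xr.
  have h1 := F_le xa ltac:(by rewrite rN) ltac:(by right; rewrite rN) (y := - r).
  have h2 := F_le xa ltac:(by rewrite rP) ltac:(by right; rewrite rP) (y := r).
  rewrite !raddfD/= sqrrN mulNr mulrN.
  have := ler_norml (complex.Re (F (x +i* - r))) (8 * M).
  rewrite (le_trans (normc_Re _) h1) => /esym/andP[_ i1].
  have := ler_norml (complex.Re (F (x +i* r))) (8 * M).
  rewrite (le_trans (normc_Re _) h2) => /esym/andP[i2 _].
  have := ler_wpM2l m0 (ker x xr rx); lra.
have hB : (2 * m - 16 * M) * (r - - r) <= segint (right_left phi (- r) r) (- r) r.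
  apply: segint_ge => // x xr rx; rewrite /right_left !phiE.
  have xa : `|x| <= r by rewrite ler_norml xr.
  have h1 := F_le (x := - r) ltac:(by rewrite rN) xa ltac:(by left; rewrite rN).
  have h2 := F_le (x := r) ltac:(by rewrite rP) xa ltac:(by left; rewrite rP).
  rewrite !raddfD/= sqrrN mulNr mulrN.
  have := ler_norml (complex.Im (F (- r +i* x))) (8 * M).
  rewrite (le_trans (normc_Im _) h1) => /esym/andP[_ i1].
  have := ler_norml (complex.Im (F (r +i* x))) (8 * M).
  rewrite (le_trans (normc_Im _) h2) => /esym/andP[i2 _].
  have := ler_wpM2l m0 (ker x xr rx); rewrite (addrC (x ^+ 2)); lra.
have := outer0; rewrite /rectint => H0.
have E : r - - r = 1 by rewrite /r; lra.
rewrite E !mulr1 in hA hB; lra.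
Qed.

End twisted.

Lemma cauchy_estimate : normc ('D_1 f 0) <= 8 * M.
Proof.
have [D0|D0] := eqVneq D 0.
  rewrite -/D D0 ComplexField.Normc.normc0 mulr_ge0//.
  by apply: le_trans (fM (z := 0) _); rewrite ?normc_ge0// ComplexField.Normc.normc0.
have m0 : 0 < m by rewrite normc_gt0.
(* This rotation of [D] to the negative imaginary axis makes the residue contribution real, so that
   the real part of the contour integral sees all of it. *)
apply: (@cauchy_estimate_twisted ((0 +i* (- m)) / D)).
  rewrite normcM normcV /= expr0n/= add0r sqrrN sqrtr_sqr gtr0_norm// divff// gt_eqF//.
by rewrite divfK.
Qed.

End cauchy_estimate.

(** * Kobayashi metric *)

Section euclidean_norm.
Context {R : realType} {n : nat}.
Local Notation V := 'rV[R[i]]_n.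
Implicit Types (x y z v : V) (D : set V).

Lemma enorm_ge0 x : 0 <= enorm x.
Proof. exact: sqrtr_ge0. Qed.

Let sum_ge0 x : 0 <= \sum_(j < n) normc (x 0 j) ^+ 2.
Proof. by apply: sumr_ge0 => j _; exact: sqr_ge0. Qed.

Lemma sqr_enorm x : enorm x ^+ 2 = \sum_(j < n) normc (x 0 j) ^+ 2.
Proof. by rewrite sqr_sqrtr. Qed.

Lemma coord_enorm x j : normc (x 0 j) <= enorm x.
Proof.
rewrite -(ger0_norm (normc_ge0 _)) -sqrtr_sqr ler_wsqrtr// (bigD1 j)//= lerDl.
by apply: sumr_ge0 => k _; exact: sqr_ge0.
Qed.

Lemma enorm0 : enorm (0 : V) = 0.
Proof.
rewrite /enorm big1 ?sqrtr0// => j _.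
by rewrite mxE ComplexField.Normc.normc0 expr0n.
Qed.

Lemma enorm_eq0 x : (enorm x == 0) = (x == 0).
Proof.
apply/eqP/eqP => [x0|->]; last exact: enorm0.
apply/rowP => j; rewrite mxE; apply/eqP; rewrite -normc_eq0 eq_le normc_ge0 andbT.
by rewrite -x0 coord_enorm.
Qed.

Lemma enorm_gt0 x : (0 < enorm x) = (x != 0).
Proof. by rewrite lt_def enorm_ge0 andbT enorm_eq0. Qed.

Lemma enormZ (c : R[i]) x : enorm (c *: x) = normc c * enorm x.
Proof.
rewrite /enorm -[X in X * _](ger0_norm (normc_ge0 _)) -sqrtr_sqr -sqrtrM ?sqr_ge0//.
rewrite mulr_sumr; congr Num.sqrt; apply: eq_bigr => j _.
by rewrite mxE normcM exprMn.
Qed.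

Lemma enormN x : enorm (- x) = enorm x.
Proof. by rewrite -scaleN1r enormZ normcN normc1 mul1r. Qed.

Lemma enorm_distC x y : enorm (x - y) = enorm (y - x).
Proof. by rewrite -enormN opprB. Qed.

Lemma enorm_dot x y :
  \sum_(j < n) normc (x 0 j) * normc (y 0 j) <= enorm x * enorm y.
Proof.
have [->|x0] := eqVneq x 0.
  by rewrite enorm0 mul0r big1// => j _; rewrite mxE ComplexField.Normc.normc0 mul0r.
have [->|y0] := eqVneq y 0.
  by rewrite enorm0 mulr0 big1// => j _; rewrite mxE ComplexField.Normc.normc0 mulr0.
rewrite -enorm_gt0 in x0; rewrite -enorm_gt0 in y0.
set A := enorm x; set B := enorm y.
(* AM-GM: [2 s t <= s^2 B / A + t^2 A / B] *)
suff : 2 * (\sum_(j < n) normc (x 0 j) * normc (y 0 j)) <=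
    \sum_(j < n) (normc (x 0 j) ^+ 2 * (B / A) + normc (y 0 j) ^+ 2 * (A / B)).
  rewrite big_split/= -!mulr_suml -!sqr_enorm -/A -/B.
  rewrite (_ : A ^+ 2 * (B / A) + B ^+ 2 * (A / B) = 2 * (A * B)) ?ler_pM2l//.
  by field; rewrite !gt_eqF.
rewrite mulr_sumr; apply: ler_sum => j _.
set s := normc (x 0 j); set t := normc (y 0 j).
have sq := sqr_ge0 (s * B - t * A); rewrite -(ler_pM2r (mulr_gt0 x0 y0)) -/A -/B.
rewrite (_ : (s ^+ 2 * (B / A) + t ^+ 2 * (A / B)) * (A * B) = s ^+ 2 * B ^+ 2 + t ^+ 2 * A ^+ 2).
  nra.
by field; rewrite !gt_eqF.
Qed.

Lemma enormD x y : enorm (x + y) <= enorm x + enorm y.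
Proof.
rewrite -[leRHS]ger0_norm ?addr_ge0 ?enorm_ge0// -sqrtr_sqr ler_wsqrtr//.
apply: (@le_trans _ _ (\sum_(j < n) (normc (x 0 j) + normc (y 0 j)) ^+ 2)).
  apply: ler_sum => j _; rewrite mxE lerXn2r ?nnegrE ?normc_ge0//.
    by rewrite addr_ge0 ?normc_ge0.
  exact: normcD.
under eq_bigr do rewrite sqrrD.
rewrite big_split/= big_split/= -!sqr_enorm sumrMnl sqrrD lerD2r lerD2l.
by rewrite lerMn2r enorm_dot orbT.
Qed.

Lemma enormB x y : enorm (x - y) <= enorm x + enorm y.
Proof. by rewrite -(enormN y); exact: enormD. Qed.

Lemma enorm_tri y x z : enorm (x - z) <= enorm (x - y) + enorm (y - z).
Proof. by rewrite (_ : x - z = (x - y) + (y - z)) ?enormD// addrA subrK. Qed.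

Lemma enorm_le_sum x : enorm x <= \sum_(j < n) normc (x 0 j).
Proof.
rewrite -[leRHS]ger0_norm; last by apply: sumr_ge0 => j _; exact: normc_ge0.
rewrite -sqrtr_sqr ler_wsqrtr// expr2 mulr_suml; apply: ler_sum => j _.
rewrite expr2 ler_wpM2l ?normc_ge0// (bigD1 j)//= lerDl.
by apply: sumr_ge0 => k _; exact: normc_ge0.
Qed.

Lemma enorm_le_max x M : (forall j, normc (x 0 j) <= M) -> enorm x <= n%:R * M.
Proof.
move=> H; apply: (le_trans (enorm_le_sum x)).
apply: (@le_trans _ _ (\sum_(j < n) M)); first exact: ler_sum.
by rewrite sumr_const card_ord mulr_natl.
Qed.

Lemma nbhs_enormP x (A : set V) :
  nbhs x A <-> exists2 e : R, 0 < e & forall y, enorm (y - x) < e -> A y.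
Proof.
rewrite -nbhs_ballE; split.
  move=> [d /= /gt0_complex[e e0 ->] H]; exists e => // y ye; apply: H.
  split; first by rewrite ltcR.
  move=> i j; rewrite -ball_normE/= normcE ltcR distcC (ord1 i).
  by apply: le_lt_trans ye; have := coord_enorm (y - x) j; rewrite !mxE.
move=> [e e0 H]; exists (e / n.+1%:R)%:C; first by rewrite /= ltcR divr_gt0.
move=> y [_ yx]; apply: H.
apply: (@le_lt_trans _ _ (n%:R * (e / n.+1%:R))).
  apply: enorm_le_max => j; have := yx 0 j.
  by rewrite -ball_normE/= normcE ltcR distcC !mxE => /ltW.
rewrite mulrCA -[ltRHS]mulr1 ltr_pM2l// ltr_pdivrMr// mul1r ltr_nat//.
Qed.

Lemma open_enorm D x : open D -> D x ->
  exists2 e : R, 0 < e & forall y, enorm (y - x) < e -> D y.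
Proof. by move=> oD Dx; apply/nbhs_enormP; exact: oD. Qed.

Lemma closure_enormP D x : closure D x <->
  forall e : R, 0 < e -> exists2 y, D y & enorm (y - x) < e.
Proof.
split => [cD e e0|H B].
  have [|y [Dy yx]] := cD [set y | enorm (y - x) < e]; last by exists y.
  by apply/nbhs_enormP; exists e.
move=> /nbhs_enormP[e e0 He]; have [y Dy yx] := H e e0.
by exists y; split => //; exact: He.
Qed.

Lemma bounded_enorm D : bounded_set D -> exists2 M : R, 0 < M & forall x, D x -> enorm x <= M.
Proof.
move=> [M0 [M0r H]].
have [m mE] : exists m : R, M0 = m%:C by move/complex_realP : M0r.
pose m1 := Num.max 1 (m + 1).
have m10 : 0 < m1 by rewrite /m1 lt_max ltr01.
have mm : m < m1 by rewrite /m1 lt_max; apply/orP; right; lra.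
exists (n.+1%:R * (m1 + 1)); first by rewrite mulr_gt0//; lra.
move=> x Dx; apply: (@le_trans _ _ (n%:R * (m1 + 1))); last first.
  by rewrite ler_wpM2r ?ler_nat//; lra.
apply: enorm_le_max => j.
have xm := H m1%:C; rewrite mE ltcR in xm; have {}xm := xm mm x Dx.
have [_ /(_ 0 j)] : ball (0 : V) (m1 + 1)%:C x.
  rewrite mx_norm_ball /ball_ /= sub0r normrN; apply: le_lt_trans xm _.
  by rewrite ltcR; lra.
by rewrite -ball_normE/= mxE sub0r normrN normcE ltcR => /ltW.
Qed.

Lemma convexP D : convex_set D -> forall x y (t : R), D x -> D y -> 0 <= t -> t <= 1 ->
  D (t%:C *: x + (1 - t)%:C *: y).
Proof.
move=> cD x y t Dx Dy t0 t1.
have t0' : 0 <= t%:C by rewrite lecR.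
have t1' : t%:C <= 1 by rewrite -[1]/(1%:C) lecR.
have := cD x y (Itv01 t0' t1').
by rewrite !inE rmorphB rmorph1; apply.
Qed.

End euclidean_norm.

Section differentials_numField.
Context {K : numFieldType} {W : normedModType K}.
Implicit Types (f : K -> W).

Lemma diff_scale f (z xi : K) : 'd f z xi = xi *: 'd f z (1 : K).
Proof. by rewrite -linearZ; congr ('d f z _); rewrite /GRing.scale/= mulr1. Qed.

Lemma diff_affine_pre f (a r z : K) : differentiable f (a + r * z) ->
  differentiable (fun w => f (a + r * w)) z /\
  'd (fun w => f (a + r * w)) z (1 : K) = r *: 'd f (a + r * z) (1 : K).
Proof.
move=> df; pose h := (fun w : K => a + r *: w).
have Dh : is_diff z h ( *:%R r).
  by rewrite -[X in is_diff _ _ X]add0r; exact: is_diffD.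
have dh : differentiable h z by exact: ex_diff.
have dfh : differentiable f (h z) by exact: df.
have -> : (fun w => f (a + r * w)) = f \o h by [].
split; first exact: differentiable_comp.
by rewrite diff_comp//= diff_val diff_scale /GRing.scale/= mulr1.
Qed.

Lemma diff_affine (x w : W) (z : K) : differentiable (fun u : K => x + u *: w) z /\
  'd (fun u : K => x + u *: w) z (1 : K) = w.
Proof.
have Dh : is_diff z (fun u : K => x + u *: w) ( *:%R ^~ w).
  by rewrite -[X in is_diff _ _ X]add0r; exact: is_diffD.
split; first exact: ex_diff.
by rewrite diff_val scale1r.
Qed.

End differentials_numField.

Section complex_differentials.
Context {R : realType} {n : nat}.
Local Notation V := 'rV[R[i]]_n.
Implicit Types (f : R[i] -> V) (x y v : V) (D : set V).

Lemma diff_coord f z j : differentiable f z ->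
  derivable (fun w => f w 0 j) z 1 /\
  'D_1 (fun w => f w 0 j) z = ('d f z (1 : R[i])) 0 j.
Proof.
move=> df.
have dc := differentiable_coord (f z) 0 j.
have dfc : differentiable ((fun N : V => N 0 j : R[i]) \o f) z by exact: differentiable_comp.
split; first exact/derivable1_diffP.
have -> : (fun w => f w 0 j) = (fun N : V => N 0 j : R[i]) \o f by [].
rewrite deriveE// diff_comp//=.
have @g : {linear V -> R[i]}.
  by exists (fun N : V => N 0 j); do 2![eexists]; do ?[constructor];
     rewrite ?mxE// => ? *; rewrite ?mxE//; move=> ?; rewrite !mxE.
rewrite (_ : (fun N : V => N 0 j : R[i]) = g) // diff_lin//.
exact: coord_continuous.
Qed.

End complex_differentials.

Section kobayashi_metric.
Context {R : realType} {n : nat}.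
Local Notation V := 'rV[R[i]]_n.
Implicit Types (f : R[i] -> V) (x y v : V) (D E : set V).

Lemma hol_discP D f : hol_disc D f <->
  forall z, normc z < 1 -> differentiable f z /\ D (f z).
Proof.
have E (z : R[i]) : (`|z| < 1) = (normc z < 1) by rewrite normcE -[1]/(1%:C) ltcR.
by split => H z; have := H z; rewrite E.
Qed.

Lemma hol_disc_sub D E f : D `<=` E -> hol_disc D f -> hol_disc E f.
Proof. by move=> DE H z z1; have [? /DE] := H z z1. Qed.

Lemma hol_disc_restrict D E f (a : R[i]) (r : R) : hol_disc D f ->
  0 <= r -> normc a + r <= 1 ->
  (forall z, normc (z - a) < r -> E (f z)) ->
  0 < r -> hol_disc E (fun w => f (a + r%:C * w)) /\
  'd (fun w => f (a + r%:C * w)) (0 : R[i]) (1 : R[i]) = r%:C *: 'd f a (1 : R[i]).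
Proof.
move=> /hol_discP Hf r0 ar HE r_gt0.
have nr z : normc (r%:C * z) = r * normc z by rewrite normcM normc_real ger0_norm.
have H z : normc z < 1 -> normc (a + r%:C * z) < 1.
  move=> z1; apply: (le_lt_trans (normcD _ _)); rewrite nr.
  by apply: lt_le_trans ar; rewrite ltrD2l -[ltRHS]mulr1 ltr_pM2l.
split.
  apply/hol_discP => z z1; have [df _] := Hf _ (H z z1).
  split; first by have [] := diff_affine_pre df.
  by apply: HE; rewrite addrAC subrr add0r nr -[ltRHS]mulr1 ltr_pM2l.
have /H : normc (0 : R[i]) < 1 by rewrite ComplexField.Normc.normc0.
move=> /Hf[df _]; have dE := (diff_affine_pre df).2.
by rewrite mulr0 addr0 in dE; exact: dE.
Qed.

Lemma kobayashi_metric_ge0 D x v : (0 <= kobayashi_metric D x v)%E.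
Proof.
by apply: le_ereal_inf_tmp => _ [xi _ <-]; rewrite lee_fin normc_ge0.
Qed.

Lemma le_kobayashi_metric D f x (xi : R[i]) v : hol_disc D f -> f 0 = x ->
  xi *: 'd f (0 : R[i]) (1 : R[i]) = v ->
  (kobayashi_metric D x v <= (normc xi)%:E)%E.
Proof.
move=> fD fx fv; apply: ereal_inf_lbound; exists xi => //=; exists f; split => //.
by rewrite diff_scale.
Qed.

Lemma kobayashi_metric_ge D x v (c : R) :
  (forall f xi, hol_disc D f -> f 0 = x -> xi *: 'd f (0 : R[i]) (1 : R[i]) = v ->
     c <= normc xi) ->
  (c%:E <= kobayashi_metric D x v)%E.
Proof.
move=> H; apply: le_ereal_inf_tmp => _ [xi [f [fD fx fv]] <-]; rewrite lee_fin.
by apply: (H f) => //; rewrite -diff_scale.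
Qed.

Lemma kobayashi_metric_sub D E x v : D `<=` E ->
  (kobayashi_metric E x v <= kobayashi_metric D x v)%E.
Proof.
move=> DE; apply: ereal_inf_le_tmp => _ [xi [f [fD fx fv]] <-].
by exists xi => //; exists f; split => //; exact: hol_disc_sub fD.
Qed.

Lemma kobayashi_metricN D x v : (kobayashi_metric D x (- v) <= kobayashi_metric D x v)%E.
Proof.
apply: le_ereal_inf_tmp => _ [xi [f [fD fx fv]] <-].
rewrite -normcN; apply: (le_kobayashi_metric fD fx).
by rewrite scaleNr -diff_scale fv.
Qed.

(** The competitor is the affine disc of radius [rho] in the direction of [v]. *)
Lemma kobayashi_metric_ball D x v (rho : R) : 0 < rho ->
  (forall y, enorm (y - x) < rho -> D y) ->
  (kobayashi_metric D x v <= (enorm v / rho)%:E)%E.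
Proof.
move=> rho0 xD; have [->|v0] := eqVneq v 0.
  rewrite enorm0 mul0r -[X in (_ <= X%:E)%E](@ComplexField.Normc.normc0 R).
  apply: (@le_kobayashi_metric _ (fun z : R[i] => x + z *: (0 : V))).
  - apply/hol_discP => z _; split; first by have [] := diff_affine x (0 : V) z.
    by apply: xD; rewrite scaler0 addr0 subrr enorm0.
  - by rewrite scale0r addr0.
  - by rewrite scale0r.
have nv : 0 < enorm v by rewrite enorm_gt0.
have q0 : 0 < enorm v / rho by rewrite divr_gt0.
pose w := (rho / enorm v)%:C *: v.
rewrite -[X in (_ <= X%:E)%E](ger0_norm (ltW q0)) -normc_real.
apply: (@le_kobayashi_metric _ (fun z : R[i] => x + z *: w)).
- apply/hol_discP => z z1; split; first by have [] := diff_affine x w z.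
  apply: xD; rewrite addrAC subrr add0r !enormZ normc_real gtr0_norm ?divr_gt0//.
  by rewrite divfK ?gt_eqF// -[ltRHS]mul1r ltr_pM2r.
- by rewrite scale0r addr0.
- have [_ ->] := diff_affine x w 0.
  have E : enorm v / rho * (rho / enorm v) = 1 by field; rewrite !gt_eqF.
  by rewrite scalerA -rmorphM/= E scale1r.
Qed.

Lemma hol_disc_recenter D f (a : R[i]) (r := 1 - normc a) :
  hol_disc D f -> normc a < 1 ->
  hol_disc D (fun w => f (a + r%:C * w)) /\
  'd (fun w => f (a + r%:C * w)) (0 : R[i]) (1 : R[i]) = r%:C *: 'd f a (1 : R[i]).
Proof.
move=> fD a1; have r0 : 0 < r by rewrite subr_gt0.
have ar : normc a + r <= 1 by rewrite /r subrKC.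
have fr z : normc (z - a) < r -> D (f z).
  move=> za; have /hol_discP H := fD; apply: (H z _).2.
  rewrite -[z](subrK a); apply: (le_lt_trans (normcD _ _)).
  by rewrite -ltrBrDr.
exact: hol_disc_restrict fD (ltW r0) ar fr r0.
Qed.

(* [f] is recentered at [a] on the disc of radius [1 - |a|]. *)
Lemma kobayashi_metric_disc D f (a c : R[i]) : hol_disc D f -> normc a < 1 ->
  (kobayashi_metric D (f a) (c *: 'd f a (1%R : R[i])) <= (normc c / (1 - normc a))%:E)%E.
Proof.
move=> fD a1; have r0 : 0 < 1 - normc a by rewrite subr_gt0.
have [gD dg] := hol_disc_recenter fD a1.
rewrite (_ : normc c / _ = normc (c / (1 - normc a)%:C)); last first.
  by rewrite normcM normcV normc_real gtr0_norm.
apply: (le_kobayashi_metric gD); first by rewrite mulr0 addr0.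
apply: (etrans (congr1 (fun t => (c / (1 - normc a)%:C) *: t) dg)).
rewrite scalerA mulfVK//; by apply/eqP => -[/eqP]; rewrite gt_eqF.
Qed.

(** Cauchy's estimate for each coordinate of the recentered disc. It makes the image of a radius
    Lipschitz on compact parts, hence an admissible curve. *)
Lemma disc_diff_bound D f (a : R[i]) M : hol_disc D f -> normc a < 1 ->
  (forall x, D x -> enorm x <= M) ->
  enorm ('d f a (1 : R[i])) <= n%:R * (8 * M) / (1 - normc a).
Proof.
move=> fD a1 DM; have r0 : 0 < 1 - normc a by rewrite subr_gt0.
have [/hol_discP gD dg] := hol_disc_recenter fD a1.
have E := congr1 (@enorm R n) dg; rewrite enormZ normc_real gtr0_norm// in E.
rewrite ler_pdivlMr// mulrC -E.
apply: enorm_le_max => j.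
have z01 : normc (0 : R[i]) < 1 by rewrite ComplexField.Normc.normc0.
have [_ <-] := diff_coord j (gD 0 z01).1.
apply: cauchy_estimate => z /gD[dgz Dgz].
  by have [] := diff_coord j dgz.
by apply: le_trans (DM _ Dgz); exact: coord_enorm.
Qed.

(** A bound independent of the boundary distance, for the region where log-type convexity says
    little. The factor [n.+1] keeps the denominator positive in every dimension. *)
Lemma kobayashi_metric_bounded D M x v : 0 < M -> (forall y, D y -> enorm y <= M) ->
  ((enorm v / (n.+1%:R * (8 * M)))%:E <= kobayashi_metric D x v)%E.
Proof.
move=> M0 DM; apply: kobayashi_metric_ge => f xi fD fx <-.
have z01 : normc (0 : R[i]) < 1 by rewrite ComplexField.Normc.normc0.
have := disc_diff_bound fD z01 DM; rewrite ComplexField.Normc.normc0 subr0 divr1 => H.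
rewrite enormZ ler_pdivrMr ?mulr_gt0// ler_wpM2l ?normc_ge0//.
by apply: (le_trans H); rewrite ler_wpM2r// ?ler_nat// mulr_ge0// ltW.
Qed.

End kobayashi_metric.

(** * Half-plane estimate and lower bound on convex domains *)

Section halfplane.
Context {R : realType}.
Implicit Types (g : R[i] -> R[i]).

Lemma sqr_normc (a b : R) : normc (a +i* b) ^+ 2 = a ^+ 2 + b ^+ 2.
Proof. by rewrite /= sqr_sqrtr// addr_ge0 ?sqr_ge0. Qed.

Lemma normc_cayley_le (w a : R[i]) : 0 < complex.Re w -> 0 < complex.Re a ->
  normc (w - a) <= normc (w + a^*).
Proof.
case: w a => [w1 w2] [a1 a2] /= w0 a0; rewrite ler_wsqrtr//; nra.
Qed.

Lemma halfplane_estimate g :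
  (forall z, normc z < 1 -> derivable g z 1 /\ 0 < complex.Re (g z)) ->
  normc ('D_1 g 0) <= 16 * complex.Re (g 0).
Proof.
move=> Hg; set a := g 0.
have z01 : normc (0 : R[i]) < 1 by rewrite ComplexField.Normc.normc0.
have [dg0 a0] := Hg 0 z01; rewrite -/a in a0.
have nz z : normc z < 1 -> g z + a^* != 0.
  move=> /Hg[_]; move: a0; case: (a) (g z) => [a1 a2] [g1 g2] /= a0 g0.
  by rewrite eq_complex/= negb_and gt_eqF ?addr_gt0.
pose k z := (g z + a^*)^-1.
have dk z : normc z < 1 -> derivable k z 1.
  move=> z1; have [dg _] := Hg z z1; apply: derivableV; first exact: nz.
  exact: (derivableD dg (derivable_cst (a^*) z 1)).
have dga z : normc z < 1 -> derivable (fun w => g w - a) z 1.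
  by move=> z1; have [dg _] := Hg z z1; exact: (derivableB dg (derivable_cst a z 1)).
pose h z := (g z - a) * k z.
have dh z : normc z < 1 -> derivable h z 1.
  by move=> z1; exact: (derivableM (dga z z1) (dk z z1)).
have hle z : normc z < 1 -> normc (h z) <= 1.
  move=> z1; rewrite /h /k normcM normcV ler_pdivrMr ?normc_gt0 ?nz// mul1r.
  by apply: normc_cayley_le => //; case: (Hg z z1).
have := cauchy_estimate dh hle; rewrite mulr1.
have D1 : is_derive (0 : R[i]) (1 : R[i]) g ('D_1 g 0) by exact: DeriveDef.
have D2 : is_derive (0 : R[i]) (1 : R[i]) (fun w => g w - a) ('D_1 g 0 - 0).
  exact: (is_deriveB D1 (is_derive_cst a (0 : R[i]) (1 : R[i]))).
have D3 : is_derive (0 : R[i]) (1 : R[i]) k ('D_1 k 0) by exact: (DeriveDef (dk 0 z01) erefl).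
have D4 := is_deriveM D2 D3.
have D5 : is_derive (0 : R[i]) (1 : R[i]) h (k 0 * 'D_1 g 0).
  by apply: (is_derive_eq D4); rewrite subr0 subrr scale0r add0r.
rewrite (@derive_val _ _ _ _ _ _ _ D5).
have -> : k 0 = (2 * complex.Re a)^-1%:C.
  rewrite /k -/a; move: a0; case: (a) => [a1 a2] /= a0.
  apply/eqP; rewrite eq_complex/= subrr expr0n/= addr0 mul0r oppr0 eqxx andbT.
  by apply/eqP; field; rewrite !gt_eqF ?addr_gt0.
rewrite normcM normc_real gtr0_norm ?invr_gt0 ?mulr_gt0// mulrC.
rewrite ler_pdivrMr ?mulr_gt0//; lra.
Qed.

End halfplane.

Section convex_kobayashi.
Context {R : realType} {n : nat}.
Local Notation V := 'rV[R[i]]_n.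
Implicit Types (f : R[i] -> V) (x y z v u : V) (D : set V).

(** Complex linear in the first argument, so that [dot (p - f w) u] is holomorphic in [w] along a
    holomorphic disc [f]. *)
Definition dot u v : R[i] := \sum_(j < n) u 0 j * (v 0 j)^*.

Lemma dotDl u v (w : V) : dot (u + v) w = dot u w + dot v w.
Proof. by rewrite -big_split/=; apply: eq_bigr => j _; rewrite mxE mulrDl. Qed.

Lemma dotZl (c : R[i]) u v : dot (c *: u) v = c * dot u v.
Proof. by rewrite mulr_sumr; apply: eq_bigr => j _; rewrite mxE mulrA. Qed.

Lemma enormB_sqr u v (s : R) : enorm (u - s%:C *: v) ^+ 2 =
  enorm u ^+ 2 - 2 * s * complex.Re (dot v u) + s ^+ 2 * enorm v ^+ 2.
Proof.
rewrite !sqr_enorm raddf_sum !mulr_sumr -sumrB -big_split/=.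
apply: eq_bigr => j _; rewrite !mxE.
case: (u 0 j) (v 0 j) => [u1 u2] [v1 v2].
rewrite [X in normc X](_ : _ = (u1 - s * v1) +i* (u2 - s * v2)); last first.
  by apply/eqP; rewrite eq_complex/=; apply/andP; split; apply/eqP; ring.
rewrite !sqr_normc/=; ring.
Qed.

Lemma dot_self u : complex.Re (dot u u) = enorm u ^+ 2.
Proof.
rewrite sqr_enorm raddf_sum; apply: eq_bigr => j _.
by case: (u 0 j) => a b; rewrite sqr_normc/=; ring.
Qed.

(* [D] is not closed: a point of [D] almost nearest to [xi] replaces the projection
   of [xi], and [rho] leaves room for the error. *)
Lemma convex_separation D M (xi : V) (rho : R) : convex_set D -> D !=set0 ->
  (forall x, D x -> enorm x <= M) -> 0 < rho ->
  (forall y, D y -> rho <= enorm (xi - y)) ->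
  exists u, forall x, D x -> 0 < complex.Re (dot (xi - x) u).
Proof.
move=> cD [x0 Dx0] DM rho0 far.
pose S := [set enorm (xi - y) ^+ 2 | y in D].
have S0 : S !=set0 by exists (enorm (xi - x0) ^+ 2); exists x0.
have lS : lbound S (rho ^+ 2).
  move=> _ [y Dy <-]; rewrite lerXn2r// ?nnegrE ?enorm_ge0 ?(ltW rho0)//; exact: far.
pose d := inf S.
have d0 : 0 < d.
  by apply: (@lt_le_trans _ _ (rho ^+ 2)); [rewrite exprn_gt0|exact: lb_le_inf].
have dle y : D y -> d <= enorm (xi - y) ^+ 2.
  by move=> Dy; apply: ge_inf; [exists (rho ^+ 2)|exists y].
pose B := (2 * M) ^+ 2 + d.
have B0 : 0 < B by rewrite ltr_pwDr// sqr_ge0.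
(* Moving from [y] towards [x] by the fraction [s] changes the squared distance linearly in [s], up
   to a quadratic term; this [s] keeps the latter below s d / 2. *)
pose s := d / (2 * B).
have s0 : 0 < s by rewrite divr_gt0// mulr_gt0.
have s1 : s <= 1.
  by rewrite ler_pdivrMr ?mulr_gt0// mul1r /B; have := sqr_ge0 (2 * M); lra.
have sB : s * B = d / 2 by rewrite /s; field; rewrite gt_eqF.
have [_ [y Dy <-] ylt] := inf_adherent (mulr_gt0 s0 d0) (conj S0 (ex_intro _ _ lS)).
rewrite -/d in ylt.
exists (xi - y) => x Dx.
have -> : xi - x = (xi - y) + (-1) *: (x - y) by rewrite scaleN1r opprB addrA subrK.
rewrite dotDl dotZl mulN1r raddfB/= dot_self subr_gt0.
have Dp : D (s%:C *: x + (1 - s)%:C *: y) by apply: convexP => //; exact: ltW.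
have := dle _ Dp.
rewrite [X in enorm X](_ : _ = (xi - y) - s%:C *: (x - y)); last first.
  by apply/rowP => j; rewrite !mxE rmorphB rmorph1/=; ring.
rewrite enormB_sqr.
have xy : enorm (x - y) ^+ 2 <= B.
  apply: (@le_trans _ _ ((2 * M) ^+ 2)); last by rewrite lerDl ltW.
  rewrite lerXn2r ?nnegrE ?enorm_ge0//.
    by have := le_trans (enorm_ge0 _) (DM _ Dx); lra.
  by apply: (le_trans (enormB _ _)); have := DM _ Dx; have := DM _ Dy; lra.
have s2 : s ^+ 2 * enorm (x - y) ^+ 2 <= s * (d / 2).
  by rewrite expr2 -mulrA ler_pM2l// -sB ler_pM2l.
move=> H.
have H2 : 2 * s * complex.Re (dot (x - y) (xi - y)) < s * (2 * d).
  have sd : 0 < s * d by rewrite mulr_gt0.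
  by lra.
have : complex.Re (dot (x - y) (xi - y)) < d.
  rewrite -(ltr_pM2l s0); lra.
by move=> /lt_le_trans; apply; exact: dle.
Qed.

(** If [y] in [D] were at distance less than [r * t] from z + (1 + t) u, then z + u would be a
    convex combination of [y] and a point [z'] of the ball of radius [r] around [z], hence in
    [D]. *)
Lemma convex_ray D z u (t : R) : open D -> convex_set D -> D z -> ~ D (z + u) ->
  0 < t -> exists2 rho : R, 0 < rho &
    forall y, D y -> rho <= enorm ((z + (1 + t)%:C *: u) - y).
Proof.
move=> oD cD Dz nD t0; have [r r0 Hr] := open_enorm oD Dz.
exists (r * t); first by rewrite mulr_gt0.
move=> y Dy; rewrite leNgt; apply/negP => ylt; apply: nD.
set e := (z + (1 + t)%:C *: u) - y in ylt.
pose z' := z + t^-1%:C *: e.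
have Dz' : D z'.
  apply: Hr; rewrite addrAC subrr add0r enormZ normc_real gtr0_norm ?invr_gt0//.
  by rewrite mulrC ltr_pdivrMr.
pose s := (1 + t)^-1.
have s0 : 0 < s by rewrite invr_gt0 addr_gt0.
have s1 : s <= 1 by rewrite invf_le1 ?addr_gt0// lerDl ltW.
have := convexP cD Dy Dz' (ltW s0) s1.
congr (D _); rewrite /z' /e.
apply/rowP => j; rewrite !mxE.
have -> : (1 - s) = t * s by rewrite /s; field; rewrite gt_eqF ?addr_gt0.
have tC : t%:C != 0 :> R[i] by apply/eqP => -[/eqP]; rewrite gt_eqF.
have sC : 1 + t%:C != 0 :> R[i].
  by apply/eqP => -[/eqP]; rewrite gt_eqF ?addr_gt0.
rewrite /s !rmorphM !fmorphV !rmorphD rmorph1/=; field.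
by rewrite tC sC.
Qed.

(** A separating functional maps [D] into the right half-plane. It sends [f] to some [g] with g(0)
    equal to (1 + t) c xi times -g'(0), so [halfplane_estimate] gives 1 <= 16 (1 + t) |c| |xi|. The
    point is pushed beyond z + c v by the factor 1 + t because z + c v may lie on the boundary; at
    the end t tends to 0. *)
Lemma kobayashi_metric_convex D M z v (c : R[i]) : open D -> convex_set D ->
  (forall x, D x -> enorm x <= M) -> D z -> ~ D (z + c *: v) ->
  ((16 * normc c)^-1%:E <= kobayashi_metric D z v)%E.
Proof.
move=> oD cD DM Dz nD; apply: kobayashi_metric_ge => f xi fD f0 fv.
have c0 : 0 < normc c.
  by rewrite normc_gt0; apply/eqP => c0; apply: nD; rewrite c0 scale0r addr0.
suff H : 1 <= 16 * normc c * normc xi.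
  by rewrite -[leLHS]mul1r ler_pdivrMr ?mulr_gt0// mulrC.
have z01 : normc (0 : R[i]) < 1 by rewrite ComplexField.Normc.normc0.
suff H t : 0 < t -> 1 <= (1 + t) * (16 * normc c * normc xi).
  set K := 16 * normc c * normc xi; rewrite -/K in H.
  have K0 : 0 <= K by rewrite !mulr_ge0 ?normc_ge0.
  rewrite leNgt; apply/negP => K1.
  have := H ((1 - K) / 2); rewrite divr_gt0 ?subr_gt0// => /(_ isT); nra.
move=> t0; have [rho rho0 far] := convex_ray oD cD Dz nD t0.
set p := z + (1 + t)%:C *: (c *: v) in far.
have [u Hu] := convex_separation cD (ex_intro _ z Dz) DM rho0 far.
have /hol_discP fH := fD.
pose g w := dot (p - f w) u.
have dg w : normc w < 1 -> is_derive w 1 g (- dot ('d f w (1 : R[i])) u).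
  move=> /fH[dfw _].
  have -> : g = \sum_(j < n) (fun w => (p 0 j - f w 0 j) * (u 0 j)^*).
    by apply/funext => w'; rewrite /g /dot fct_sumE; apply: eq_bigr => j _; rewrite !mxE.
  rewrite /dot -sumrN; apply: is_derive_sum => j.
  have [dfj Dfj] := diff_coord j dfw.
  rewrite -Dfj -mulNr.
  have D1 : is_derive w (1 : R[i]) (fun w => f w 0 j) ('D_1 (fun w => f w 0 j) w).
    exact: DeriveDef.
  have D2 := is_deriveM (is_deriveB (is_derive_cst (p 0 j) w (1 : R[i])) D1)
    (is_derive_cst ((u 0 j)^*) w (1 : R[i])).
  by apply: (is_derive_eq D2); rewrite scaler0 add0r sub0r /GRing.scale/= mulrC.
have Hg w : normc w < 1 -> derivable g w 1 /\ 0 < complex.Re (g w).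
  by move=> w1; split; [exact: (@ex_derive _ _ _ _ _ _ _ (dg w w1))|apply: Hu; case: (fH w w1)].
have := halfplane_estimate Hg; rewrite (@derive_val _ _ _ _ _ _ _ (dg 0 z01)) normcN.
set q := dot _ u => hp.
have g0 : g 0 = ((1 + t)%:C * c * xi) * q.
  by rewrite /g f0 /p addrAC subrr add0r !scalerA -fv scalerA dotZl.
have [_ gpos] := Hg 0 z01.
have : complex.Re (g 0) <= (1 + t) * normc c * normc xi * (16 * complex.Re (g 0)).
  apply: (le_trans (ler_norm _)); apply: (le_trans (normc_Re _)).
  rewrite {1}g0 !normcM normc_real gtr0_norm ?addr_gt0//.
  by rewrite ler_wpM2l// !mulr_ge0 ?normc_ge0// addr_ge0 ?ltW.
move=> H; rewrite -(ler_pM2r gpos) mul1r; apply: (le_trans H).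
by rewrite le_eqVlt; apply/orP; left; apply/eqP; ring.
Qed.

End convex_kobayashi.

(** * Lower integrals over intervals *)

Section lower_integral_line.
Context {R : realType}.
Local Notation mu := (@lebesgue_measure R).
Local Open Scope ereal_scope.
Implicit Types (phi psi : R -> \bar R) (a b c : R).

Import HBNNSimple.

Let mh (h : {nnsfun (measurableTypeR R) >-> R}) (D : set R) :
  measurable_fun D (fun x : R => (h x)%:E).
Proof.
by apply/measurable_EFinP; apply: measurable_funTS; exact: (@measurable_funPT _ _ _ _ h).
Qed.

Let h0 (h : {nnsfun (measurableTypeR R) >-> R}) (x : R) : 0 <= (h x)%:E.
Proof. by rewrite lee_fin fun_ge0. Qed.

Lemma lint_scale (D : set R) phi psi (c : R) : measurable D -> (0 < c)%R ->
  (forall x, D x -> 0 <= phi x) -> (forall x, D x -> 0 <= psi x) ->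
  (forall x, D x -> psi x <= c%:E * phi x) ->
  \int[mu]_(x in D) psi x <= c%:E * \int[mu]_(x in D) phi x.
Proof.
move=> mD c0 phi0 psi0 H; apply: lint_ub => // h hpsi.
have ci0 : (0 <= c^-1)%R by rewrite invr_ge0 ltW.
have E : \int[mu]_(x in D) (c^-1%:E * (h x)%:E) = c^-1%:E * \int[mu]_(x in D) (h x)%:E.
  by apply: ge0_integralZl_EFin => //; exact: mh.
have cc t : c%:E * (c^-1%:E * t) = t by rewrite muleA -EFinM divff ?gt_eqF// mul1e.
rewrite -[leLHS]cc lee_pmul2l// -E; apply: lint_le => // x Dx.
  by rewrite mule_ge0// lee_fin.
split => //; rewrite -(@lee_pmul2l _ c%:E)// cc.
by apply: le_trans (hpsi x Dx) _; exact: H.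
Qed.

Lemma lebesgue_measure_segment a b : (a <= b)%R -> mu `[a, b]%classic = (b - a)%:E.
Proof.
move=> ab; rewrite lebesgue_measure_itv/= lte_fin; case: ltP => [_|ba].
  by rewrite EFinB.
by rewrite (_ : b = a) ?subrr//; apply/eqP; rewrite eq_le ba.
Qed.

Lemma lint_const_le a b phi (m : R) : (a <= b)%R -> (0 <= m)%R ->
  (forall x, 0 <= phi x) ->
  (forall x, (a <= x)%R -> (x <= b)%R -> phi x <= m%:E) ->
  \int[mu]_(x in `[a, b]) phi x <= (m * (b - a))%:E.
Proof.
move=> ab m0 phi0 H; apply: (@le_trans _ _ (\int[mu]_(x in `[a, b]) cst m%:E x)).
  apply: lint_le => [x _|x _|x /=]; [exact: phi0|by rewrite lee_fin|].
  by rewrite in_itv/= => /andP[ax xb]; rewrite ax xb; split => //; exact: H.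
rewrite integral_cst; last exact: measurable_itv.
rewrite [X in _ * X](_ : _ = (b - a)%:E); first by rewrite -EFinM.
exact: lebesgue_measure_segment.
Qed.

Let open_left (h : {nnsfun (measurableTypeR R) >-> R}) a (b : itv_bound R) :
  \int[mu]_(x in [set` Interval (BRight a) b]) (h x)%:E =
  \int[mu]_(x in [set` Interval (BLeft a) b]) (h x)%:E.
Proof. by apply: integral_itv_obnd_cbnd; exact: mh. Qed.

Let open_right (h : {nnsfun (measurableTypeR R) >-> R}) (a : itv_bound R) b :
  \int[mu]_(x in [set` Interval a (BLeft b)]) (h x)%:E =
  \int[mu]_(x in [set` Interval a (BRight b)]) (h x)%:E.
Proof. by apply: integral_itv_bndo_bndc; exact: mh. Qed.

Let split_itv (h : {nnsfun (measurableTypeR R) >-> R}) a c b : (a <= c)%R -> (c <= b)%R ->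
  \int[mu]_(x in `[a, b]) (h x)%:E =
  \int[mu]_(x in `[a, c[) (h x)%:E + \int[mu]_(x in `]c, b]) (h x)%:E.
Proof.
move=> ac cb.
rewrite (_ : `[a, b]%classic = `[a, c[ `|` `[c, b]).
  rewrite ge0_integral_setU//=; [|exact: mh|].
    by congr (_ + _); rewrite -open_left.
  apply/disj_setPS => x [/=]; rewrite !in_itv/= => /andP[_ xc] /andP[cx _].
  by have := lt_le_trans xc cx; rewrite ltxx.
apply/seteqP; split => x /=; rewrite !in_itv/=.
  by move=> /andP[ax xb]; have [xc|xc] := ltP x c; [left; rewrite ax|right].
by move=> [/andP[-> /ltW/le_trans ->]//|/andP[cx ->]]; rewrite (le_trans ac cx).
Qed.

(** Nothing is asked at [a], [c] and [b]: the velocity of a glued curve at [c] is unrelated to those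
    of its pieces, and single points do not count in the integral of a simple function. *)
Lemma lint_glue a c b phi phi1 phi2 : (a <= c)%R -> (c <= b)%R ->
  (forall x, 0 <= phi x) -> (forall x, 0 <= phi1 x) -> (forall x, 0 <= phi2 x) ->
  (forall x, (a < x)%R -> (x < c)%R -> phi x <= phi1 x) ->
  (forall x, (c < x)%R -> (x < b)%R -> phi x <= phi2 x) ->
  \int[mu]_(x in `[a, b]) phi x <=
  \int[mu]_(x in `[a, c]) phi1 x + \int[mu]_(x in `[c, b]) phi2 x.
Proof.
move=> ac cb p0 p10 p20 H1 H2; apply: lint_ub => // h hphi.
have {}hphi x : (a <= x)%R -> (x <= b)%R -> (h x)%:E <= phi x.
  by move=> ax xb; apply: hphi; rewrite /= in_itv/= ax.
rewrite (split_itv _ ac cb); apply: leeD.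
  rewrite -open_left.
  apply: lint_le => // x /=; rewrite !in_itv/= => /andP[ax xc].
  split; first by rewrite !ltW.
  apply: le_trans (hphi _ (ltW ax) _) _; last exact: H1.
  by rewrite ltW// (lt_le_trans xc).
rewrite -open_right.
apply: lint_le => // x /=; rewrite !in_itv/= => /andP[cx xb].
split; first by rewrite !ltW.
apply: le_trans (hphi _ _ (ltW xb)) _; last exact: H2.
by rewrite ltW// (le_lt_trans ac).
Qed.

(** Simple functions below [phi] on the two halves are joined into the measurable [g]. When the
    right-hand side is finite, the two suprema can be taken one after the other by subtraction. *)
Lemma lint_superadd a c b phi : (a <= c)%R -> (c <= b)%R -> (forall x, 0 <= phi x) ->
  \int[mu]_(x in `[a, c]) phi x + \int[mu]_(x in `[c, b]) phi x <=
  \int[mu]_(x in `[a, b]) phi x.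
Proof.
move=> ac cb p0; set Z := \int[mu]_(x in `[a, b]) phi x.
have [->|Zoo] := eqVneq Z +oo; first exact: leey.
have Z0 : 0 <= Z by exact: integral_ge0.
have Zfin : Z \is a fin_num by rewrite ge0_fin_numE// ltey.
have fin (D : set R) (f : R -> \bar R) : (forall x, 0 <= f x) -> D `<=` `[a, b]%classic ->
    (forall x, D x -> f x <= phi x) -> \int[mu]_(x in D) f x \is a fin_num.
  move=> f0 Dab Df; rewrite ge0_fin_numE; last exact: integral_ge0.
  apply: (@le_lt_trans _ _ Z); last by rewrite ltey.
  by apply: lint_le => // x Dx; split; [exact: Dab|exact: Df].
have sub1 : `[a, c]%classic `<=` `[a, b]%classic.
  by move=> x /=; rewrite !in_itv/= => /andP[-> /le_trans ->].
have sub2 : `[c, b]%classic `<=` `[a, b]%classic.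
  by move=> x /=; rewrite !in_itv/= => /andP[cx ->]; rewrite (le_trans ac).
have F2 : \int[mu]_(x in `[c, b]) phi x \is a fin_num by exact: fin.
rewrite -leeBrDr//; apply: lint_ub => // h1 Hh1.
have G1 : \int[mu]_(x in `[a, c]) (h1 x)%:E \is a fin_num by exact: fin.
rewrite leeBrDr// addeC -leeBrDr//; apply: lint_ub => // h2 Hh2.
have G2 : \int[mu]_(x in `[c, b]) (h2 x)%:E \is a fin_num by exact: fin.
rewrite leeBrDr//.
pose g : R -> \bar R := fun x => if (x < c)%R then (h1 x)%:E else (h2 x)%:E.
have mg : measurable_fun setT g.
  apply: measurable_fun_ifT => //; try exact: mh.
  by apply: measurable_fun_ltr => //; exact: measurable_cst.
have g0 x : 0 <= g x by rewrite /g; case: ifP.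
apply: (@le_trans _ _ (\int[mu]_(x in `[a, b]) g x)); last first.
  apply: lint_le => // x /= xab; split => //; move: xab; rewrite in_itv/= => /andP[ax xb].
  rewrite /g; case: ltP => xc; [apply: Hh1|apply: Hh2]; rewrite /= in_itv/=.
    by rewrite ax ltW.
  by rewrite xc.
rewrite (_ : `[a, b]%classic = `[a, c[ `|` `[c, b]); last first.
  apply/seteqP; split => x /=; rewrite !in_itv/=.
    by move=> /andP[ax xb]; have [xc|xc] := ltP x c; [left; rewrite ax|right].
  by move=> [/andP[-> /ltW/le_trans ->]//|/andP[cx ->]]; rewrite (le_trans ac cx).
rewrite ge0_integral_setU//=; [|exact: measurable_funTS|]; last first.
  apply/disj_setPS => x [/=]; rewrite !in_itv/= => /andP[_ xc] /andP[cx _].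
  by have := lt_le_trans xc cx; rewrite ltxx.
rewrite addeC; apply: leeD.
  rewrite -open_right.
  apply: lint_le => // x /=; rewrite !in_itv/= => /andP[ax xc].
  by split; [rewrite ax xc|rewrite /g xc].
apply: lint_le => // x /=; rewrite !in_itv/= => /andP[cx xb].
by split; [rewrite cx xb|rewrite /g ltNge cx].
Qed.

Let mreflect c : measurable_fun [set: R] (fun t : R => c - t)%R.
Proof. by apply: measurable_funB => //; exact: measurable_cst. Qed.

Lemma lebesgue_measure_reflect c (A : set R) : measurable A ->
  mu ((fun t => c - t)%R @^-1` A) = mu A.
Proof.
move=> mA; pose f : measurableTypeR R -> measurableTypeR R := (fun t : R => c - t)%R.
have mf : measurable_fun [set: measurableTypeR R] f by exact: mreflect.
pose m' : {measure set (measurableTypeR R) -> \bar R} := pushforward mu f.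
suff H : forall A, measurable A -> mu A = m' mf A by rewrite [RHS]H.
apply: lebesgue_measure_unique => X /ocitvP[->|[[x y] /= xy ->]].
  by rewrite !measure0.
rewrite /m' /= /pushforward (_ : f @^-1` _ = [set` `[(c - y)%R, (c - x)%R[]).
  rewrite !lebesgue_measure_itv/= !lte_fin xy ifT; last by lra.
  by rewrite -!EFinB; congr (_%:E); ring.
apply/seteqP; split => t /=; rewrite !in_itv/= /f => /andP[h1 h2]; apply/andP; split; lra.
Qed.

Lemma lint_reflect a b c phi : (a <= b)%R -> (forall x, 0 <= phi x) ->
  \int[mu]_(x in `[(c - b)%R, (c - a)%R]) phi (c - x)%R <= \int[mu]_(x in `[a, b]) phi x.
Proof.
move=> ab p0; apply: lint_ub => // h hphi.
pose f : measurableTypeR R -> measurableTypeR R := (fun t : R => c - t)%R.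
have mf : measurable_fun [set: measurableTypeR R] f by exact: mreflect.
pose D : set R := `[(c - b)%R, (c - a)%R]%classic.
have mD : measurable D by exact: measurable_itv.
pose m' : {measure set (measurableTypeR R) -> \bar R} := pushforward mu f.
have -> : \int[mu]_(x in D) (h x)%:E = \int[m' mf]_(x in D) (h x)%:E.
  apply: eq_measure_integral => A mA _; rewrite /m' /= /pushforward.
  by rewrite (lebesgue_measure_reflect c).
rewrite ge0_integral_pushforward//; last exact: mh.
apply: lint_le => [x _|x _|x]; [exact: h0|exact: p0|].
rewrite /= /D /= !in_itv/= => /andP[h1 h2].
split; first by apply/andP; split; rewrite /f in h1 h2; lra.
have := hphi (f x); rewrite /= in_itv/= h1 h2 => /(_ isT).
by rewrite /f subKr.
Qed.

End lower_integral_line.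

(** * Velocities of curves *)

Section velocity.
Context {R : realType} {n : nat}.
Local Notation V := 'rV[R[i]]_n.
Implicit Types (s : R -> V) (g : R -> R) (a b c t : R).

Lemma derive1_dvg g t : ~ derivable g t 1 -> derive1 g t = 0.
Proof. by move=> dg; rewrite derive1E /derive dvgP. Qed.

(** No differentiability is assumed: reflection preserves its absence, and then [derive1] has its
    default value 0 on both sides. *)
Lemma derive1_reflect g c t : derive1 (fun u => g (c - u)) t = - derive1 g (c - t).
Proof.
have H (k : R -> R) u : derivable k (c - u) 1 ->
    is_derive u 1 (fun w => k (c - w)) (- derive1 k (c - u)).
  move=> dk; have Dk : is_derive (c - u) 1 k (derive1 k (c - u)).
    by rewrite derive1E; exact: (DeriveDef dk erefl).
  have Dr : is_derive u 1 (fun w => c - w) (-1).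
    by apply: (is_derive_eq (is_deriveB (is_derive_cst c u 1) (is_derive_id u 1))); rewrite sub0r.
  rewrite -[X in is_derive _ _ _ X]mulrN1.
  exact: (@is_derive1_comp _ k (fun w => c - w)).
have [dg|dg] := pselect (derivable g (c - t) 1).
  by rewrite derive1E (@derive_val _ _ _ _ _ _ _ (H _ _ dg)).
rewrite (derive1_dvg dg) oppr0; apply: derive1_dvg => dg'; apply: dg.
have := H (fun u => g (c - u)) (c - t); rewrite subKr => /(_ dg') Dg.
have -> : g = (fun w => g (c - (c - w))) by apply/funext => w; rewrite subKr.
exact: (@ex_derive _ _ _ _ _ _ _ Dg).
Qed.

Lemma velocity_reflect s c t : velocity (fun u => s (c - u)) t = - velocity s (c - t).
Proof.
apply/rowP => j; rewrite !mxE.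
rewrite (derive1_reflect (fun u => complex.Re (s u 0 j))).
by rewrite (derive1_reflect (fun u => complex.Im (s u 0 j))).
Qed.

Lemma velocity_near s1 s2 t : (\forall u \near t, s1 u = s2 u) -> velocity s1 t = velocity s2 t.
Proof.
move=> H; apply/rowP => j; rewrite !mxE; congr (_ +i* _).
  rewrite !derive1E; apply: near_eq_derive.
  by apply: filterS H => u ->.
rewrite !derive1E; apply: near_eq_derive.
by apply: filterS H => u ->.
Qed.

(** [G] stands for the real and the imaginary part, which are treated together. *)
Lemma is_derive_real_line (h : R[i] -> R[i]) (G : R[i] -> R) (zeta : R[i]) t :
  (forall z w, G (z - w) = G z - G w) -> (forall (r : R) z, G (r%:C * z) = r * G z) ->
  (forall z, `|G z| <= normc z) ->
  derivable h (t%:C * zeta) 1 ->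
  is_derive t 1 (fun u => G (h (u%:C * zeta))) (G (zeta * 'D_1 h (t%:C * zeta))).
Proof.
move=> GB GZ Gn dh; set D := 'D_1 h _.
suff cv : (fun k : R => k^-1 *: (((fun u => G (h (u%:C * zeta))) \o shift t) (k *: 1) -
    G (h (t%:C * zeta)))) @ 0^' --> G (zeta * D).
  by apply: DeriveDef; [apply/cvg_ex; exists (G (zeta * D))|exact: cvg_lim cv].
apply/cvgrPdist_le => e e0.
have nz1 : 0 < normc zeta + 1 by rewrite ltr_wpDl ?normc_ge0.
have [d d0 Hd] := derivable_normc dh (divr_gt0 e0 nz1).
rewrite near_withinE; near=> k => k0.
have kd : `|k| < d / (normc zeta + 1).
  near: k; apply/nbhs_ballP; exists (d / (normc zeta + 1)) => /=; first by rewrite divr_gt0.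
  by move=> y; rewrite -ball_normE/= sub0r normrN.
rewrite /= [_ *: 1]mulr1.
set w := (k + t)%:C * zeta.
have wz : w - t%:C * zeta = k%:C * zeta by rewrite /w rmorphD/= mulrDl addrK.
have := Hd w; rewrite wz normcM normc_real => H.
have {}H : normc (h w - h (t%:C * zeta) - D * (k%:C * zeta)) <= e / (normc zeta + 1) * (`|k| * normc zeta).
  apply: H; apply: (@le_lt_trans _ _ (`|k| * (normc zeta + 1))).
    by rewrite ler_wpM2l//; lra.
  by rewrite -ltr_pdivlMr.
have k00 : 0 < `|k| by rewrite normr_gt0.
rewrite -(@ler_pM2r _ `|k|)// -normrM.
rewrite [X in `|X|](_ : _ = - G (h w - h (t%:C * zeta) - D * (k%:C * zeta))); last first.
  rewrite !GB (_ : D * (k%:C * zeta) = k%:C * (zeta * D)); last by ring.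
  rewrite GZ /GRing.scale/= mulrBl mulrAC mulVf//; ring.
rewrite normrN; apply: (le_trans (Gn _)); apply: (le_trans H).
rewrite (mulrC `|k|) mulrA ler_pM2r// -mulrA ler_piMr ?(ltW e0)//.
by rewrite mulrC ler_pdivrMr// mul1r; lra.
Unshelve. all: by end_near. Qed.

Lemma ReZ (r : R) (z : R[i]) : complex.Re (r%:C * z) = r * complex.Re z.
Proof. by case: z => x y /=; ring. Qed.

Lemma ImZ (r : R) (z : R[i]) : complex.Im (r%:C * z) = r * complex.Im z.
Proof. by case: z => x y /=; ring. Qed.

Lemma velocity_disc (f : R[i] -> V) (zeta : R[i]) t : differentiable f (t%:C * zeta) ->
  velocity (fun u => f (u%:C * zeta)) t = zeta *: 'd f (t%:C * zeta) (1 : R[i]).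
Proof.
move=> df; apply/rowP => j; rewrite !mxE.
have [dj <-] := diff_coord j df.
set h := (fun w : R[i] => f w 0 j) in dj *.
have DR := is_derive_real_line (@raddfB _ _ (@complex.Re R)) ReZ normc_Re dj.
have DI := is_derive_real_line (@raddfB _ _ (@complex.Im R)) ImZ normc_Im dj.
rewrite !derive1E (@derive_val _ _ _ _ _ _ _ DR) (@derive_val _ _ _ _ _ _ _ DI).
by case: (zeta * _).
Qed.

(* [2 n]: the mean value theorem is applied to both parts of each coordinate. *)
Lemma disc_lipschitz (f : R[i] -> V) (zeta : R[i]) a b L : a <= b ->
  (forall t, a <= t -> t <= b -> differentiable f (t%:C * zeta)) ->
  (forall t, a <= t -> t <= b -> enorm ('d f (t%:C * zeta) (1 : R[i])) <= L) ->
  enorm (f (b%:C * zeta) - f (a%:C * zeta)) <= n%:R * (2 * (normc zeta * L)) * (b - a).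
Proof.
move=> ab df dL.
have lip (G : R[i] -> R) j : (forall z w, G (z - w) = G z - G w) ->
    (forall (r : R) z, G (r%:C * z) = r * G z) -> (forall z, `|G z| <= normc z) ->
    `|G (f (b%:C * zeta) 0 j) - G (f (a%:C * zeta) 0 j)| <= normc zeta * L * (b - a).
  move=> GB GZ Gn.
  pose g u := G (f (u%:C * zeta) 0 j).
  pose dg u := G (zeta * 'D_1 (fun w : R[i] => f w 0 j) (u%:C * zeta)).
  have Dg u : a <= u -> u <= b -> is_derive u 1 g (dg u).
    move=> au ub; have [dj _] := diff_coord j (df u au ub).
    exact: (is_derive_real_line GB GZ Gn dj).
  have [||c /itvP cab ->] := @MVT_segment _ g dg a b ab.
  - by move=> x /itvP xab; apply: Dg; rewrite xab.
  - apply: continuous_in_subspaceT => x; rewrite inE/= in_itv/= => /andP[ax xb].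
    apply: differentiable_continuous; apply/derivable1_diffP.
    exact: (@ex_derive _ _ _ _ _ _ _ (Dg x ax xb)).
  rewrite normrM (ger0_norm (x := b - a)) ?subr_ge0// ler_wpM2r ?subr_ge0//.
  apply: (le_trans (Gn _)); rewrite normcM ler_wpM2l ?normc_ge0//.
  have [_ ->] := diff_coord j (df c ltac:(by rewrite cab) ltac:(by rewrite cab)).
  by apply: le_trans (coord_enorm _ _) _; apply: dL; rewrite cab.
rewrite -mulrA; apply: enorm_le_max => j; rewrite !mxE.
apply: (le_trans (normc_le_ReIm _)).
have := lip _ j (@raddfB _ _ (@complex.Re R)) ReZ normc_Re.
have := lip _ j (@raddfB _ _ (@complex.Im R)) ImZ normc_Im.
rewrite -!raddfB/=; lra.
Qed.

End velocity.

(** * Kobayashi length and distance *)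

Section abs_continuous_curves.
Context {R : realType} {n : nat}.
Local Notation V := 'rV[R[i]]_n.
Implicit Types (s : R -> V) (a b c t : R).

Lemma abs_continuousS a b a' b' s : a <= a' -> b' <= b ->
  abs_continuous a b s -> abs_continuous a' b' s.
Proof.
move=> aa bb H e e0; have [d d0 Hd] := H e e0; exists d => // m l r lr dis.
apply: Hd => // i; have [al [lri rb]] := lr i; split; first exact: le_trans al.
by split => //; exact: le_trans bb.
Qed.

Lemma lipschitz_abs_continuous a b s L : 0 <= L ->
  (forall t u, a <= t -> t <= u -> u <= b -> enorm (s u - s t) <= L * (u - t)) ->
  abs_continuous a b s.
Proof.
move=> L0 H e e0; have L10 : 0 < L + 1 by lra.
exists (e / (L + 1)); first by rewrite divr_gt0.
move=> m l r lr dis sd; apply: (@le_lt_trans _ _ (\sum_(i < m) L * (r i - l i))).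
  by apply: ler_sum => i _; have [? [? ?]] := lr i; exact: H.
have S0 : 0 <= \sum_(i < m) (r i - l i).
  by apply: sumr_ge0 => i _; have [? [? ?]] := lr i; rewrite subr_ge0.
rewrite -mulr_sumr; move: sd; rewrite ltr_pdivlMr//; nra.
Qed.

Lemma abs_continuous_coord a b s (G : R[i] -> R) j :
  (forall z w, `|G z - G w| <= normc (z - w)) ->
  abs_continuous a b s -> acR a b (fun t => G (s t 0 j)).
Proof.
move=> HG H e e0; have [d d0 Hd] := H e e0; exists d => // m l r lr dis sd.
apply: le_lt_trans (Hd m l r lr dis sd); apply: ler_sum => i _.
apply: (le_trans (HG _ _)).
by have := coord_enorm (s (r i) - s (l i)) j; rewrite !mxE.
Qed.

Lemma abs_continuous_cont a b s e : abs_continuous a b s -> 0 < e ->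
  exists2 d, 0 < d & forall t u, a <= t -> t <= b -> a <= u -> u <= b ->
    `|t - u| < d -> enorm (s t - s u) < e.
Proof.
move=> H e0; have [d d0 Hd] := H e e0; exists d => // .
have W t u : a <= t -> t <= u -> u <= b -> u - t < d -> enorm (s u - s t) < e.
  move=> at_ tu ub ut; have := Hd 1%N (fun=> t) (fun=> u); rewrite !big_ord1.
  by apply => // i j; rewrite !ord1 eqxx.
move=> t u at_ tb au ub; have [tu|/ltW ut] := leP t u.
  by rewrite distrC ger0_norm ?subr_ge0// enorm_distC => ?; exact: W.
by rewrite ger0_norm ?subr_ge0// => ?; exact: W.
Qed.

Lemma abs_continuous_reflect a b c s : abs_continuous a b s ->
  abs_continuous (c - b) (c - a) (fun u => s (c - u)).
Proof.
move=> H e e0; have [d d0 Hd] := H e e0; exists d => // m l r lr dis sd.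
apply: (@le_lt_trans _ _ (\sum_(i < m) enorm (s (c - l i) - s (c - r i)))).
  by apply: ler_sum => i _; rewrite enorm_distC.
apply: (Hd m (fun i => c - r i) (fun i => c - l i)).
- by move=> i; have [? [? ?]] := lr i; split; [|split]; lra.
- by move=> i j /dis[?|?]; [right|left]; lra.
- by apply: le_lt_trans sd; apply: ler_sum => i _; lra.
Qed.

Lemma abs_continuous_glue a c b s1 s2 : a <= c -> c <= b -> abs_continuous a c s1 -> abs_continuous c b s2 ->
  s1 c = s2 c -> abs_continuous a b (fun t => if t <= c then s1 t else s2 t).
Proof.
move=> ac cb H1 H2 s12 e e0; have e20 : 0 < e / 2 by lra.
have [d1 d10 Hd1] := H1 _ e20; have [d2 d20 Hd2] := H2 _ e20.
exists (Num.min d1 d2); first by rewrite lt_min d10.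
move=> m l r lr dis; rewrite lt_min => /andP[sd1 sd2].
pose mn x := Num.min x c; pose mx x := Num.max x c.
have mnle x y : x <= y -> mn x <= mn y /\ mn y - mn x <= y - x.
  by rewrite /mn => xy; have [?|?] := leP x c; have [?|?] := leP y c; split; lra.
have mxle x y : x <= y -> mx x <= mx y /\ mx y - mx x <= y - x.
  by rewrite /mx => xy; have [?|?] := leP x c; have [?|?] := leP y c; split; lra.
have h1 : \sum_(i < m) enorm (s1 (mn (r i)) - s1 (mn (l i))) < e / 2.
  apply: (Hd1 m (fun i => mn (l i)) (fun i => mn (r i))).
  - move=> i; have [al [lri rb]] := lr i; have [mlr _] := mnle _ _ lri.
    by rewrite mlr /mn le_min al ac ge_min lexx orbT.
  - by move=> i j /dis[/mnle[]|/mnle[]]; [left|right].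
  - apply: le_lt_trans sd1; apply: ler_sum => i _.
    by have [_ [/mnle[]]] := lr i.
have h2 : \sum_(i < m) enorm (s2 (mx (r i)) - s2 (mx (l i))) < e / 2.
  apply: (Hd2 m (fun i => mx (l i)) (fun i => mx (r i))).
  - move=> i; have [al [lri rb]] := lr i; have [mlr _] := mxle _ _ lri.
    by rewrite mlr /mx le_max lexx orbT ge_max rb cb.
  - by move=> i j /dis[/mxle[]|/mxle[]]; [left|right].
  - apply: le_lt_trans sd2; apply: ler_sum => i _.
    by have [_ [/mxle[]]] := lr i.
have := ltrD h1 h2; rewrite -splitr -big_split/=; apply: le_lt_trans.
apply: ler_sum => i _; have [al [lri rb]] := lr i.
rewrite /mn /mx; have [lc|lc] := leP (l i) c; have [rc|rc] := leP (r i) c.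
- by rewrite lerDl enorm_ge0.
- by rewrite s12 addrC; exact: enorm_tri.
- by have := le_lt_trans rc lc; rewrite ltNge lri.
- by rewrite lerDr enorm_ge0.
Qed.

End abs_continuous_curves.

Section kobayashi_length.
Context {R : realType} {n : nat}.
Local Notation V := 'rV[R[i]]_n.
Local Notation mu := (@lebesgue_measure R).
Implicit Types (s : R -> V) (a b c t : R) (x y z v : V) (D E : set V).

Definition curve_in D a b s := [/\ a <= b, abs_continuous a b s &
  forall t, a <= t -> t <= b -> D (s t)].

Lemma curve_inS D a b a' b' s : a <= a' -> a' <= b' -> b' <= b ->
  curve_in D a b s -> curve_in D a' b' s.
Proof.
move=> aa ab bb [_ H sD]; split => //; first exact: abs_continuousS H.
by move=> t at_ tb; apply: sD; [exact: le_trans at_|exact: le_trans bb].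
Qed.

Lemma kobayashi_length_ge0 D a b s : (0 <= kobayashi_length D a b s)%E.
Proof. by apply: integral_ge0 => t _; exact: kobayashi_metric_ge0. Qed.

Lemma kobayashi_length_superadd D a c b s : a <= c -> c <= b ->
  (kobayashi_length D a c s + kobayashi_length D c b s <= kobayashi_length D a b s)%E.
Proof.
by move=> ac cb; apply: lint_superadd => // t; exact: kobayashi_metric_ge0.
Qed.

Lemma kobayashi_length_sub D a b a' b' s : a <= a' -> a' <= b' -> b' <= b ->
  (kobayashi_length D a' b' s <= kobayashi_length D a b s)%E.
Proof.
move=> aa ab bb; apply: lint_le => [t _|t _|t /=]; try exact: kobayashi_metric_ge0.
by rewrite !in_itv/= => /andP[h1 h2]; rewrite (le_trans aa h1) (le_trans h2 bb).
Qed.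

Lemma kobayashi_length_scale D E a b s (k : R) : 0 < k ->
  (forall t v, a <= t -> t <= b ->
     (kobayashi_metric E (s t) v <= k%:E * kobayashi_metric D (s t) v)%E) ->
  (kobayashi_length E a b s <= k%:E * kobayashi_length D a b s)%E.
Proof.
move=> k0 H; apply: lint_scale; first exact: measurable_itv.
- exact: k0.
- by move=> t _; exact: kobayashi_metric_ge0.
- by move=> t _; exact: kobayashi_metric_ge0.
by move=> t /=; rewrite in_itv/= => /andP[]; exact: H.
Qed.

Lemma kobayashi_length_le D a b s (k : R) : a <= b -> 0 <= k ->
  (forall t, a <= t -> t <= b -> (kobayashi_metric D (s t) (velocity s t) <= k%:E)%E) ->
  (kobayashi_length D a b s <= (k * (b - a))%:E)%E.
Proof.
move=> ab k0 H; apply: lint_const_le => // t; exact: kobayashi_metric_ge0.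
Qed.

Lemma kobayashi_length_reflect D a b c s : a <= b ->
  (kobayashi_length D (c - b) (c - a) (fun u => s (c - u)%R) <= kobayashi_length D a b s)%E.
Proof.
move=> ab; have := @lint_reflect R a b c (fun t => kobayashi_metric D (s t) (velocity s t)) ab
  (fun t => kobayashi_metric_ge0 _ _ _).
apply: le_trans; apply: lint_le => [t _|t _|t tab]; try exact: kobayashi_metric_ge0.
by split; [exact: tab|rewrite velocity_reflect; exact: kobayashi_metricN].
Qed.

Lemma kobayashi_length_glue D a c b s1 s2 : a <= c -> c <= b -> s1 c = s2 c ->
  (kobayashi_length D a b (fun t => if (t <= c)%R then s1 t else s2 t)
   <= kobayashi_length D a c s1 + kobayashi_length D c b s2)%E.
Proof.
move=> ac cb s12; apply: lint_glue => //; try (by move=> t; exact: kobayashi_metric_ge0).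
  move=> t at_ tc; rewrite (ltW tc) (@velocity_near _ _ _ s1)//.
  near=> u; have uc : u < c by near: u; exact: lt_nbhsl.
  by rewrite (ltW uc).
move=> t ct tb; rewrite (leNgt t c) ct/= (@velocity_near _ _ _ s2)//.
near=> u; have uc : c < u by near: u; exact: lt_nbhsr.
by rewrite (leNgt u c) uc.
Unshelve. all: by end_near. Qed.

Lemma velocity_ge_Re s t j : `|derive1 (fun u => complex.Re (s u 0 j)) t| <= enorm (velocity s t).
Proof.
apply: le_trans (coord_enorm _ j); rewrite mxE.
exact: (normc_Re (_ +i* _)).
Qed.

Lemma velocity_ge_Im s t j : `|derive1 (fun u => complex.Im (s u 0 j)) t| <= enorm (velocity s t).
Proof.
apply: le_trans (coord_enorm _ j); rewrite mxE.
exact: (normc_Im (_ +i* _)).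
Qed.

(** The metric divided by [c] dominates the speed, so [acR_le_lint] bounds the increment of each
    real coordinate by l / c; there are 2 n of them. *)
Lemma kobayashi_length_displacement D a b s (c l : R) : curve_in D a b s -> 0 < c ->
  (forall t v, a <= t -> t <= b -> ((c * enorm v)%:E <= kobayashi_metric D (s t) v)%E) ->
  (kobayashi_length D a b s <= l%:E)%E ->
  c * enorm (s b - s a) <= n%:R * (2 * l).
Proof.
move=> [ab acs _] c0 H Ll.
pose phi t := (c^-1%:E * kobayashi_metric D (s t) (velocity s t))%E.
have phi0 t : (0 <= phi t)%E.
  by rewrite mule_ge0 ?kobayashi_metric_ge0// lee_fin invr_ge0 ltW.
have phil : (\int[mu]_(t in `[a, b]) phi t <= (c^-1 * l)%:E)%E.
  apply: (@le_trans _ _ (c^-1%:E * kobayashi_length D a b s)%E).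
    apply: lint_scale; first exact: measurable_itv.
    - by rewrite invr_gt0.
    - by move=> t _; exact: kobayashi_metric_ge0.
    - by move=> t _; exact: phi0.
    - by [].
  by rewrite EFinM lee_pmul2l// lte_fin invr_gt0.
have phiv t : a <= t -> t <= b -> ((enorm (velocity s t))%:E <= phi t)%E.
  move=> at_ tb; rewrite /phi -(@lee_pmul2l _ c%:E)// muleA -[X in (_ <= X * _)%E]EFinM.
  by rewrite divff ?gt_eqF// mul1e -EFinM; exact: H.
have co (G : R[i] -> R) j : (forall z w : R[i], `|G z - G w| <= normc (z - w)) ->
    (forall t, `|derive1 (fun u => G (s u 0 j)) t| <= enorm (velocity s t)) ->
    `|G (s b 0 j) - G (s a 0 j)| <= c^-1 * l.
  move=> HG Hd; rewrite -lee_fin; apply: le_trans phil.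
  have acG := abs_continuous_coord j HG acs.
  apply: (@acR_le_lint R a b (fun t => G (s t 0 j)) phi ab acG) => [t _ _|t at_ tb].
    exact: phi0.
  by apply: le_trans (phiv _ (ltW at_) (ltW tb)); rewrite lee_fin.
rewrite mulrC -ler_pdivlMr// -!mulrA; apply: enorm_le_max => j; rewrite !mxE.
apply: (le_trans (normc_le_ReIm _)).
have := co _ j Re_lip (fun t => velocity_ge_Re s t j).
have := co _ j Im_lip (fun t => velocity_ge_Im s t j).
rewrite -!raddfB/= => h1 h2.
by rewrite (mulrC l); lra.
Qed.

End kobayashi_length.

Section kobayashi_distance.
Context {R : realType} {n : nat}.
Local Notation V := 'rV[R[i]]_n.
Implicit Types (s : R -> V) (a b c t : R) (x y z v : V) (D E : set V).

Lemma kobayashi_dist_le D a b s : curve_in D a b s ->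
  (kobayashi_dist D (s a) (s b) <= kobayashi_length D a b s)%E.
Proof. by move=> [ab ac sD]; apply: ereal_inf_lbound; exists a, b, s; split. Qed.

Lemma kobayashi_dist_ge0 D x y : (0 <= kobayashi_dist D x y)%E.
Proof.
apply: le_ereal_inf_tmp => _ [a [b [s [_ _ _ _ ->]]]]; exact: kobayashi_length_ge0.
Qed.

Lemma kobayashi_dist_near D x y (e : R) : 0 < e -> (kobayashi_dist D x y < +oo)%E ->
  exists a b s, [/\ curve_in D a b s, s a = x, s b = y &
    (kobayashi_length D a b s <= kobayashi_dist D x y + e%:E)%E].
Proof.
move=> e0 fin; have Kfin : kobayashi_dist D x y \is a fin_num.
  by rewrite ge0_fin_numE// kobayashi_dist_ge0.
have [_ [a [b [s [ab ac sD [sa sb] ->]]]] /ltW H] := lb_ereal_inf_adherent e0 Kfin.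
by exists a, b, s.
Qed.

Lemma kobayashi_dist_sub D E x y : D `<=` E -> (kobayashi_dist E x y <= kobayashi_dist D x y)%E.
Proof.
move=> DE; apply: le_ereal_inf_tmp => _ [a [b [s [ab ac sD [<- <-] ->]]]].
apply: (@le_trans _ _ (kobayashi_length E a b s)).
  by apply: kobayashi_dist_le; split => // t at_ tb; exact/DE/sD.
apply: lint_le => [t _|t _|t tab]; try exact: kobayashi_metric_ge0.
by split; [exact: tab|exact: kobayashi_metric_sub].
Qed.

Lemma curve_in_reflect D a b c s : curve_in D a b s ->
  curve_in D (c - b) (c - a) (fun u => s (c - u)).
Proof.
move=> [ab ac sD]; split; [lra|exact: abs_continuous_reflect|].
by move=> t h1 h2; apply: sD; lra.
Qed.

Let dist_sym_le D x y : (kobayashi_dist D x y <= kobayashi_dist D y x)%E.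
Proof.
apply: le_ereal_inf_tmp => _ [a [b [s [ab ac sD [sa sb] ->]]]].
have cs : curve_in D a b s by split.
apply: le_trans (kobayashi_length_reflect D 0 s ab).
have := kobayashi_dist_le (curve_in_reflect 0 cs).
by rewrite !sub0r !opprK sa sb.
Qed.

Lemma kobayashi_dist_sym D x y : kobayashi_dist D x y = kobayashi_dist D y x.
Proof. by apply/eqP; rewrite eq_le !dist_sym_le. Qed.

(* Two reflections translate the parameter interval. *)
Let translate D a b s a' : curve_in D a b s -> exists b' s',
  [/\ curve_in D a' b' s', s' a' = s a, s' b' = s b &
    (kobayashi_length D a' b' s' <= kobayashi_length D a b s)%E].
Proof.
move=> cs; have [ab _ _] := cs.
have c1 := curve_in_reflect 0 cs; have [ab1 _ _] := c1.
have c2 := curve_in_reflect (a' + (0 - a)) c1.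
have E : a' + (0 - a) - (0 - a) = a' by ring.
rewrite E in c2; eexists; eexists; split; first exact: c2.
- by congr s; ring.
- by congr s; ring.
- have := kobayashi_length_reflect D (a' + (0 - a)) (fun u => s (0 - u)) ab1.
  rewrite E => /le_trans; apply; exact: kobayashi_length_reflect.
Qed.

Lemma kobayashi_dist_triangle D x y z :
  (kobayashi_dist D x z <= kobayashi_dist D x y + kobayashi_dist D y z)%E.
Proof.
have [Hxy|] := ltP (kobayashi_dist D x y) +oo%E; last first.
  by rewrite leye_eq => /eqP ->; rewrite addye ?leey// gt_eqF// (lt_le_trans _ (kobayashi_dist_ge0 _ _ _)).
have [Hyz|] := ltP (kobayashi_dist D y z) +oo%E; last first.
  by rewrite leye_eq => /eqP ->; rewrite addey ?leey// gt_eqF// (lt_le_trans _ (kobayashi_dist_ge0 _ _ _)).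
apply/lee_addgt0Pr => e e0; have e20 : 0 < e / 2 by lra.
have [a [b [s1 [c1 s1a s1b L1]]]] := kobayashi_dist_near e20 Hxy.
have [a' [b' [s2' [c2' s2a' s2b' L2']]]] := kobayashi_dist_near e20 Hyz.
have [d [s2 [c2 s2a s2b L2]]] := translate b c2'.
have [ab ac1 D1] := c1; have [bd ac2 D2] := c2.
have s12 : s1 b = s2 b by rewrite s1b s2a s2a'.
pose s t := if t <= b then s1 t else s2 t.
have cs : curve_in D a d s.
  split; first exact: le_trans bd.
    exact: abs_continuous_glue.
  move=> t at_ td; rewrite /s; have [tb|bt] := leP t b; first exact: D1.
  by apply: D2 => //; exact: ltW.
have sa : s a = x by rewrite /s ab s1a.
have sd : s d = z.
  rewrite /s; have [db|_] := leP d b; last by rewrite s2b s2b'.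
  have db' : d = b by apply/eqP; rewrite eq_le db bd.
  by rewrite db' s12 -db' s2b s2b'.
have := kobayashi_dist_le cs; rewrite sa sd => /le_trans; apply.
apply: (le_trans (kobayashi_length_glue D ab bd s12)).
rewrite (_ : e%:E = ((e / 2)%:E + (e / 2)%:E)%E); last by rewrite -EFinD -splitr.
by rewrite [leRHS]addeACA; exact: leeD L1 (le_trans L2 L2').
Qed.

(** [L] makes the image of the segment absolutely continuous, while [B] controls its Kobayashi
    length. *)
Lemma kobayashi_dist_disc D (f : R[i] -> V) (zeta : R[i]) a b L B : a <= b -> 0 <= L -> 0 <= B ->
  (forall t, a <= t -> t <= b -> differentiable f (t%:C * zeta) /\ D (f (t%:C * zeta))) ->
  (forall t, a <= t -> t <= b -> enorm ('d f (t%:C * zeta) (1 : R[i])) <= L) ->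
  (forall t, a <= t -> t <= b ->
     (kobayashi_metric D (f (t%:C * zeta)%R) (zeta *: 'd f (t%:C * zeta)%R (1%R : R[i]))%R <= B%:E)%E) ->
  (kobayashi_dist D (f (a%:C * zeta)%R) (f (b%:C * zeta)%R) <= (B * (b - a))%:E)%E.
Proof.
move=> ab L0 B0 fD dL kB; pose s t := f (t%:C * zeta).
have cs : curve_in D a b s.
  split => //; last by move=> t at_ tb; case: (fD t at_ tb).
  apply: (@lipschitz_abs_continuous _ _ _ _ _ (n%:R * (2 * (normc zeta * L)))).
    by rewrite !mulr_ge0 ?normc_ge0.
  move=> t u at_ tu ub; apply: disc_lipschitz => // w tw wu.
    by case: (fD w (le_trans at_ tw) (le_trans wu ub)).
  exact: dL (le_trans at_ tw) (le_trans wu ub).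
apply: (le_trans (kobayashi_dist_le cs)); apply: kobayashi_length_le => // t at_ tb.
by rewrite velocity_disc; [exact: kB|case: (fD t at_ tb)].
Qed.

Lemma kobayashi_dist_segment D x v a b B : a <= b -> 0 <= B ->
  (forall t, a <= t -> t <= b -> D (x + t%:C *: v)) ->
  (forall t, a <= t -> t <= b -> (kobayashi_metric D (x + t%:C *: v)%R v <= B%:E)%E) ->
  (kobayashi_dist D (x + a%:C *: v)%R (x + b%:C *: v)%R <= (B * (b - a))%:E)%E.
Proof.
move=> ab B0 xD kB; pose f (z : R[i]) := x + z *: v.
have fE t : f (t%:C * 1) = x + t%:C *: v by rewrite /f mulr1.
have df (z : R[i]) : 'd f z (1 : R[i]) = v by have [] := diff_affine x v z.
rewrite -!fE; apply: (@kobayashi_dist_disc D f 1 a b (enorm v)) => //.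
- exact: enorm_ge0.
- by move=> t at_ tb; rewrite fE; split; [have [] := diff_affine x v (t%:C * 1)|exact: xD].
- by move=> t _ _; rewrite df.
- by move=> t at_ tb; rewrite df scale1r fE; exact: kB.
Qed.

Lemma kobayashi_dist_ball D x y (rho : R) : 0 < rho ->
  (forall w, enorm (w - x) < rho -> D w) -> enorm (y - x) <= rho / 2 ->
  (kobayashi_dist D x y <= (2 / rho * enorm (y - x))%:E)%E.
Proof.
move=> rho0 xD yx; have r20 : 0 < rho / 2 by lra.
have near t w : 0 <= t -> t <= 1 -> enorm (w - (x + t%:C *: (y - x))) < rho / 2 -> D w.
  move=> t0 t1 wt; apply: xD; apply: (le_lt_trans (enorm_tri (x + t%:C *: (y - x)) _ _)).
  rewrite [X in _ + enorm X]addrAC subrr add0r enormZ normc_real ger0_norm//.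
  by have := ler_wpM2r (enorm_ge0 (y - x)) t1; lra.
have := @kobayashi_dist_segment D x (y - x) 0 1 (enorm (y - x) / (rho / 2)) ler01.
rewrite scale0r addr0 scale1r addrCA subrr addr0 subr0 mulr1.
rewrite (_ : enorm (y - x) / (rho / 2) = 2 / rho * enorm (y - x)); last first.
  by field; rewrite gt_eqF.
apply.
- by rewrite mulr_ge0 ?enorm_ge0// divr_ge0// ltW.
- by move=> t t0 t1; apply: (near t) => //; rewrite subrr enorm0.
- move=> t t0 t1; rewrite (_ : 2 / rho * enorm (y - x) = enorm (y - x) / (rho / 2)); last first.
    by field; rewrite gt_eqF.
  by apply: kobayashi_metric_ball => // w; exact: near.
Qed.

(** Going back from [t] to [s = max 0 (2 t - 1)] at most doubles 1 - t and costs at most [B]. This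
    stands in for integrating 1 / (1 - t), and serves both radii of discs and segments running
    towards the boundary. *)
Lemma kobayashi_dist_dyadic D (g : R -> V) B : 0 <= B ->
  (forall u t, 0 <= u -> u <= t -> t < 1 ->
     (kobayashi_dist D (g u) (g t) <= (B * ((t - u) / (1 - t)))%:E)%E) ->
  forall k t, 0 <= t -> (2 ^+ k)^-1 <= 1 - t ->
    (kobayashi_dist D (g 0%R) (g t) <= (B * k%:R)%:E)%E.
Proof.
move=> B0 H; elim => [|k IH] t t0 tk.
  have {tk} -> : t = 0 by move: tk; rewrite expr0 invr1; lra.
  by have := H 0 0 (lexx _) (lexx _) ltr01; rewrite subrr mul0r.
have t1 : 0 < 1 - t by apply: lt_le_trans tk; rewrite invr_gt0 exprn_gt0.
pose s := Num.max 0 (2 * t - 1).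
have s0 : 0 <= s by rewrite le_max lexx.
have st : s <= t by rewrite ge_max t0/=; lra.
have ks : (2 ^+ k)^-1 <= 1 - s.
  rewrite /s; have [_|_] := leP 0 (2 * t - 1).
    by move: tk; rewrite exprS invfM; lra.
  by rewrite subr0 invf_le1 ?exprn_gt0// exprn_ege1//; lra.
apply: (le_trans (kobayashi_dist_triangle _ _ (g s) _)).
rewrite -natr1 mulrDr mulr1 EFinD; apply: leeD; first exact: IH.
apply: (le_trans (H s t s0 st _)); first lra.
rewrite lee_fin -[leRHS]mulr1 ler_wpM2l// ler_pdivrMr// mul1r.
by rewrite /s; have [?|?] := leP 0 (2 * t - 1); lra.
Qed.

End kobayashi_distance.

(** * Localization of the Kobayashi metric *)

Section localization.
Context {R : realType} {n : nat}.
Local Notation V := 'rV[R[i]]_n.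
Implicit Types (f : R[i] -> V) (x y z v : V) (D U : set V).

(** Along the radius through [z] the metric is at most 1 / (1 - t), so the dyadic estimate applies
    with constant 1; [M] provides the regularity of the curve. *)
Lemma disc_dist D f (M : R) (z : R[i]) k : hol_disc D f -> 0 < M ->
  (forall x, D x -> enorm x <= M) -> normc z < 1 -> (2 ^+ k)^-1 <= 1 - normc z ->
  (kobayashi_dist D (f 0%R) (f z) <= k%:R%:E)%E.
Proof.
move=> fD M0 DM z1 zk; have /hol_discP fH := fD.
have [zeta zeta1 zE] : exists2 zeta : R[i], normc zeta = 1 & z = (normc z)%:C * zeta.
  have [->|z0] := eqVneq z 0.
    by exists 1; rewrite ?normc1// ComplexField.Normc.normc0 rmorph0 mul0r.
  have nz : normc z != 0 by rewrite normc_eq0.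
  exists (z / (normc z)%:C).
    by rewrite normcM normcV normc_real ger0_norm ?normc_ge0// divff.
  by rewrite mulrC divfK//; apply/eqP => -[/eqP]; rewrite (negbTE nz).
have nt t : 0 <= t -> normc (t%:C * zeta) = t.
  by move=> t0; rewrite normcM zeta1 mulr1 normc_real ger0_norm.
pose g t := f (t%:C * zeta).
have H u t : 0 <= u -> u <= t -> t < 1 ->
    (kobayashi_dist D (g u) (g t) <= (1 * ((t - u) / (1 - t)))%:E)%E.
  move=> u0 ut t1; rewrite mul1r mulrC.
  have t10 : 0 < 1 - t by rewrite subr_gt0.
  have w1 w : u <= w -> w <= t -> normc (w%:C * zeta) < 1.
    by move=> uw wt; rewrite nt; [exact: le_lt_trans t1|exact: le_trans uw].
  have inv w : u <= w -> w <= t -> (1 - w)^-1 <= (1 - t)^-1.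
    by move=> uw wt; rewrite lef_pV2 ?posrE//; lra.
  apply: (@kobayashi_dist_disc _ _ D f zeta u t (n%:R * (8 * M) * (1 - t)^-1)) => //.
  - by rewrite !mulr_ge0 ?invr_ge0// ltW.
  - by rewrite invr_ge0 ltW.
  - by move=> w uw wt; exact: fH (w1 w uw wt).
  - move=> w uw wt; apply: (le_trans (disc_diff_bound fD (w1 w uw wt) DM)).
    rewrite nt; last exact: le_trans uw.
    by rewrite ler_wpM2l ?inv// !mulr_ge0// ltW.
  - move=> w uw wt; apply: (le_trans (kobayashi_metric_disc zeta fD (w1 w uw wt))).
    rewrite nt; last exact: le_trans uw.
    by rewrite zeta1 mul1r lee_fin inv.
have := kobayashi_dist_dyadic ler01 H (normc_ge0 z) zk.
by rewrite mul1r /g rmorph0 mul0r -zE.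
Qed.

(** Shrinking a disc of [D] to radius [rho] puts it into [U] and multiplies its derivative at 0 by
    [rho]. *)
Lemma kobayashi_metric_restrict D U x v (rho : R) : 0 < rho -> rho <= 1 ->
  (forall f, hol_disc D f -> f 0 = x -> forall z : R[i], normc z < rho -> U (f z)) ->
  (kobayashi_metric (D `&` U) x v <= rho^-1%:E * kobayashi_metric D x v)%E.
Proof.
move=> r0 r1 HU; rewrite -(@lee_pmul2l _ rho%:E)// muleA -[X in (_ <= X * _)%E]EFinM.
rewrite divff ?gt_eqF// mul1e.
apply: le_ereal_inf_tmp => _ [xi [f [fD fx fv]] <-].
have ar : normc (0 : R[i]) + rho <= 1 by rewrite ComplexField.Normc.normc0 add0r.
have fDU (z : R[i]) : normc (z - 0) < rho -> (D `&` U) (f z).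
  rewrite subr0 => zr; split; last exact: (HU f fD fx).
  by have /hol_discP H := fD; apply: (H z _).2; exact: lt_le_trans r1.
have [gD dg] := hol_disc_restrict fD (ltW r0) ar fDU r0.
have rC : rho%:C != 0 :> R[i] by apply/eqP => -[/eqP]; rewrite gt_eqF.
have := @le_kobayashi_metric _ _ (D `&` U) _ x (xi / rho%:C) v gD.
rewrite mulr0 addr0 normcM normcV normc_real gtr0_norm// => H.
have {}H : (kobayashi_metric (D `&` U) x v <= (normc xi / rho)%:E)%E.
  have fv' := etrans (esym (diff_scale f 0 xi)) fv.
  apply: (H fx); apply: (etrans (congr1 (fun t => (xi / rho%:C) *: t) dg)).
  by rewrite scalerA mulfVK//; exact: fv'.
rewrite (_ : normc xi = rho * (normc xi / rho)); last by field; rewrite gt_eqF.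
by rewrite EFinM lee_pmul2l.
Qed.

(* Royden localization: a disc of [D] centered at [x] leaves [U] only after
   Kobayashi length at least the distance from [x] to the complement of [U], and
   the disc of radius [1 - 2^-k] has hyperbolic radius at most [k]. *)
Lemma royden D U x v (M : R) k : (0 < k)%N -> 0 < M -> (forall y, D y -> enorm y <= M) ->
  (forall y, D y -> ~ U y -> (k%:R%:E < kobayashi_dist D x y)%E) ->
  (kobayashi_metric (D `&` U) x v <= (1 - (2 ^+ k)^-1)^-1%:E * kobayashi_metric D x v)%E.
Proof.
move=> k0 M0 DM far; have p0 : 0 < (2 : R) ^+ k by rewrite exprn_gt0.
have p1 : 1 < (2 : R) ^+ k by rewrite exprn_egt1 ?lt0n_neq0//; lra.
apply: kobayashi_metric_restrict.
- by rewrite subr_gt0 invf_lt1.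
- by rewrite gerBl invr_ge0 ltW.
- move=> f fD fx z zr; apply: contrapT => nU.
  have z1 : normc z < 1 by apply: (lt_le_trans zr); rewrite gerBl invr_ge0 ltW.
  have /hol_discP fH := fD; have := far _ (fH z z1).2 nU.
  rewrite ltNge => /negP; apply; rewrite -fx.
  by apply: (disc_dist fD M0 DM z1); lra.
Qed.

(** Discs in a bounded set are equicontinuous at the centre: [K] is a Lipschitz constant on the half
    disc, so for |z| < rho they stay within [r] of [x]. This crude comparison starts the argument
    that [metric_comparison] refines. *)
Lemma kobayashi_metric_local D U (M r : R) : 0 < M -> (forall y, D y -> enorm y <= M) ->
  0 < r -> exists2 C, 1 <= C & forall x v, D x ->
    (forall y, D y -> enorm (y - x) < r -> U y) ->
    (kobayashi_metric (D `&` U) x v <= C%:E * kobayashi_metric D x v)%E.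
Proof.
move=> M0 DM r0.
pose L := n.+1%:R * (8 * M) / (1 / 2).
have L0 : 0 < L by rewrite divr_gt0 ?mulr_gt0//; lra.
pose K := n.+1%:R * (2 * L).
have K0 : 0 < K by rewrite !mulr_gt0.
pose rho := Num.min (1 / 2) (r / K).
have rho0 : 0 < rho by rewrite lt_min; apply/andP; split; [lra|exact: divr_gt0].
have rho2 : rho <= 1 / 2 by rewrite ge_min lexx.
have rhor : rho <= r / K by rewrite ge_min lexx orbT.
exists rho^-1; first by rewrite -invr1 lef_pV2 ?posrE//; lra.
move=> x v Dx xU; apply: kobayashi_metric_restrict => //; first by lra.
move=> f fD fx z zr; have /hol_discP fH := fD.
have z2 : normc z <= 1 / 2 by apply/ltW/(lt_le_trans zr).
have t1 t : 0 <= t -> t <= 1 -> normc (t%:C * z) <= normc z.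
  move=> t0 t1; rewrite normcM normc_real ger0_norm//.
  by rewrite ler_piMl ?normc_ge0.
have tz t : 0 <= t -> t <= 1 -> normc (t%:C * z) < 1.
  by move=> t0 t1'; have := t1 t t0 t1'; lra.
apply: xU; first by apply: (fH z _).2; lra.
have := @disc_lipschitz R n f z 0 1 L ler01.
rewrite rmorph0 mul0r rmorph1 mul1r fx subr0 mulr1 => H.
apply: le_lt_trans (H _ _) _.
- by move=> t t0 t1'; have [] := fH _ (tz t t0 t1').
- move=> t t0 t1'; apply: (le_trans (disc_diff_bound fD (tz t t0 t1') DM)).
  have h : normc (t%:C * z) <= 1 / 2 by apply: le_trans z2; exact: t1.
  rewrite /L; apply: ler_pM.
  + by rewrite !mulr_ge0// ltW.
  + by rewrite invr_ge0 subr_ge0; lra.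
  + by rewrite ler_wpM2r ?ler_nat// mulr_ge0// ltW.
  + by rewrite lef_pV2 ?posrE//; lra.
- apply: (@le_lt_trans _ _ (normc z * K)).
    rewrite /K (_ : n%:R * (2 * (normc z * L)) = normc z * (n%:R * (2 * L))); last by ring.
    rewrite ler_wpM2l ?normc_ge0// ler_wpM2r ?ler_nat// mulr_ge0// ltW//.
  by rewrite -ltr_pdivlMr//; exact: lt_le_trans rhor.
Qed.

End localization.

(** * Log-type convex domains *)

Section boundary_distance.
Context {R : realType} {n : nat}.
Local Notation V := 'rV[R[i]]_n.
Implicit Types (x y z v : V) (D : set V).

Lemma boundary_notin D x : open D -> boundary D x -> ~ D x.
Proof. by move=> oD [_ nI] Dx; apply: nI; exact: oD. Qed.

Lemma boundary_segment D x v : open D -> D x -> ~ D (x + v) ->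
  exists t : R, [/\ 0 <= t, t <= 1 & boundary D (x + t%:C *: v)].
Proof.
move=> oD Dx nD.
pose S := [set t : R | [/\ 0 <= t, t <= 1 & forall s, 0 <= s -> s <= t -> D (x + s%:C *: v)]].
have S0 : S 0.
  split=> // s s0 s1; rewrite (_ : s = 0) ?scale0r ?addr0//.
  by apply/eqP; rewrite eq_le s0 s1.
have uS : ubound S 1 by move=> t [].
have hS : has_ubound S by exists 1.
pose t := sup S.
have t0 : 0 <= t by exact: ub_le_sup.
have t1 : t <= 1 by apply: ge_sup => //; exists 0.
have below s : 0 <= s -> s < t -> D (x + s%:C *: v).
  move=> s0 st; have [u [u0 u1 Hu] su] : exists2 u, S u & s < u.
    by apply: sup_gt => //; exists 0.
  by apply: Hu => //; exact: ltW.
have dist (s u : R) : enorm ((x + s%:C *: v) - (x + u%:C *: v)) = `|s - u| * enorm v.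
  by rewrite opprD addrACA subrr add0r -scalerBl -rmorphB enormZ normc_real.
have nv : 0 <= enorm v := enorm_ge0 v.
exists t; split => //; split.
  apply/closure_enormP => e e0.
  have [teq|tne] := eqVneq t 0.
    by exists x; rewrite // teq scale0r addr0 subrr enorm0.
  have tpos : 0 < t by rewrite lt_def tne.
  pose s := Num.max 0 (t - e / (enorm v + 1)).
  have q0 : 0 < e / (enorm v + 1) by rewrite divr_gt0//; lra.
  have s0 : 0 <= s by rewrite le_max lexx.
  have st : s < t by rewrite gt_max tpos/=; lra.
  exists (x + s%:C *: v); first exact: below.
  rewrite dist distrC ger0_norm; last by rewrite subr_ge0 ltW.
  apply: (@le_lt_trans _ _ (e / (enorm v + 1) * enorm v)).
    rewrite ler_wpM2r//.
    by rewrite /s; have [?|?] := leP 0 (t - e / (enorm v + 1)); lra.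
  by rewrite mulrAC ltr_pdivrMr ?ltr_pM2l//; lra.
move=> /interior_subset; rewrite -/(D _) => Dt.
have [e e0 He] := open_enorm oD Dt.
have [teq|tne] := eqVneq t 1; first by apply: nD; rewrite teq scale1r in Dt.
have tlt : t < 1 by rewrite lt_neqAle tne.
have q0 : 0 < e / (enorm v + 1) by rewrite divr_gt0//; lra.
pose u := Num.min 1 (t + e / (enorm v + 1) / 2).
have tu : t < u by rewrite lt_min tlt/=; lra.
have u1 : u <= 1 by rewrite ge_min lexx.
have Su : S u.
  split => //; first by apply: le_trans (ltW tu).
  move=> s s0 su; have [st|ts] := ltP s t; first exact: below.
  apply: He; rewrite dist ger0_norm ?subr_ge0//.
  apply: (@le_lt_trans _ _ (e / (enorm v + 1) / 2 * enorm v)).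
    rewrite ler_wpM2r//.
    have : u <= t + e / (enorm v + 1) / 2 by rewrite ge_min lexx orbT.
    lra.
  have : e / (enorm v + 1) * enorm v <= e.
    by rewrite mulrAC ler_pdivrMr ?ler_pM2l//; lra.
  by rewrite mulrAC; lra.
by have := ub_le_sup hS Su; rewrite leNgt tu.
Qed.

Lemma bounded_notin D x v (M : R) : (forall y, D y -> enorm y <= M) -> v != 0 ->
  exists r : R, 0 < r /\ ~ D (x + r%:C *: v).
Proof.
move=> DM; rewrite -enorm_gt0 => v0.
pose r := (`|M| + enorm x + 1) / enorm v.
have k0 : 0 < `|M| + enorm x + 1 by have := normr_ge0 M; have := enorm_ge0 x; lra.
exists r; split; first by rewrite divr_gt0.
move=> /DM H; have := enormB (x + r%:C *: v) x.
rewrite addrAC subrr add0r enormZ normc_real gtr0_norm ?divr_gt0// divfK ?gt_eqF//.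
by have := ler_norm M; lra.
Qed.

Lemma complex_line_boundary D x v (M : R) : open D -> (forall y, D y -> enorm y <= M) ->
  D x -> v != 0 -> exists c : R[i], boundary D (x + c *: v).
Proof.
move=> oD DM Dx v0; have [r [r0 nD]] := bounded_notin x DM v0.
have [t [_ _ bt]] := boundary_segment oD Dx nD.
by exists (t%:C * r%:C); rewrite -scalerA.
Qed.

Let S D x := [set enorm (x - xi) | xi in boundary D].

Let S_nonempty D x (M : R) : (0 < n)%N -> open D -> (forall y, D y -> enorm y <= M) -> D x ->
  S D x !=set0.
Proof.
move=> n0 oD DM Dx; pose v : V := \row_(j < n) 1.
have v0 : v != 0.
  apply/eqP => /rowP/(_ (Ordinal n0)); rewrite !mxE => /eqP.
  by rewrite oner_eq0.
have [c bc] := complex_line_boundary oD DM Dx v0.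
by exists (enorm (x - (x + c *: v))); exists (x + c *: v).
Qed.

Let S_lb D x : lbound (S D x) 0.
Proof. by move=> _ [y _ <-]; exact: enorm_ge0. Qed.

Lemma delta_ball D x y : open D -> D x -> enorm (y - x) < delta D x -> D y.
Proof.
move=> oD Dx yx; apply: contrapT => nD.
have nD' : ~ D (x + (y - x)) by rewrite addrC subrK.
have [t [t0 t1 bt]] := boundary_segment oD Dx nD'.
have : delta D x <= enorm (x - (x + t%:C *: (y - x))).
  by apply: ge_inf; [exists 0; exact: S_lb|exists (x + t%:C *: (y - x))].
rewrite opprD addrA subrr sub0r enormN enormZ normc_real ger0_norm//.
apply/negP; rewrite -ltNge; apply: le_lt_trans yx.
by rewrite ler_piMl ?enorm_ge0.
Qed.

Lemma delta_gt0 D x (M : R) : (0 < n)%N -> open D -> (forall y, D y -> enorm y <= M) -> D x ->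
  0 < delta D x.
Proof.
move=> n0 oD DM Dx; have [e e0 He] := open_enorm oD Dx.
apply: (lt_le_trans e0); apply: lb_le_inf; first exact: S_nonempty DM Dx.
move=> _ [y by_ <-]; rewrite leNgt; apply/negP; rewrite enorm_distC => /He.
exact: boundary_notin by_.
Qed.

(** [kobayashi_metric_convex] is applied to each boundary point z + c v of the complex line, whose
    distance from [z] is |c| |v|; the infimum over these points is taken for a fixed competing
    disc. *)
Lemma delta_dir_metric D z v (M : R) : open D -> convex_set D ->
  (forall x, D x -> enorm x <= M) -> D z -> v != 0 ->
  0 < delta_dir D z v /\
  ((enorm v / (16 * delta_dir D z v))%:E <= kobayashi_metric D z v)%E.
Proof.
move=> oD cD DM Dz v0; have v0' : 0 < enorm v by rewrite enorm_gt0.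
pose T := [set enorm (z - xi) | xi in boundary D `&` [set z + c *: v | c in [set: R[i]]]].
have T0 : T !=set0.
  have [c bc] := complex_line_boundary oD DM Dz v0.
  by exists (enorm (z - (z + c *: v))); exists (z + c *: v) => //; split => //; exists c.
have d0 : 0 < delta_dir D z v.
  have [e e0 He] := open_enorm oD Dz.
  apply: (lt_le_trans e0); apply: lb_le_inf => //.
  move=> _ [y [by_ _] <-]; rewrite leNgt; apply/negP; rewrite enorm_distC => /He.
  exact: boundary_notin by_.
split => //.
apply: kobayashi_metric_ge => f xi fD fz fv.
rewrite ler_pdivrMr ?mulr_gt0//.
have xi0 : 0 < normc xi.
  rewrite normc_gt0; apply/eqP => xi0; move: v0; rewrite -fv xi0 scale0r eqxx//.
suff : enorm v / (16 * normc xi) <= delta_dir D z v.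
  by rewrite ler_pdivrMr ?mulr_gt0//; lra.
apply: lb_le_inf => // _ [y [by_ [c _ cy]] <-].
rewrite -cy in by_ *; have nD := boundary_notin oD by_.
have := kobayashi_metric_convex oD cD DM Dz nD => H.
have : (16 * normc c)^-1 <= normc xi.
  by rewrite -lee_fin; apply: (le_trans H); exact: le_kobayashi_metric fv.
have c0 : 0 < normc c.
  by rewrite normc_gt0; apply/eqP => c0; apply: nD; rewrite c0 scale0r addr0.
rewrite opprD addrA subrr sub0r enormN enormZ -[leLHS]mul1r ler_pdivrMr ?mulr_gt0// => h.
rewrite ler_pdivrMr ?mulr_gt0// mulrAC -mulrA -[leLHS]mulr1.
rewrite [leRHS](_ : _ = enorm v * (normc xi * (16 * normc c))); last by ring.
by rewrite ler_pM2l.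
Qed.

End boundary_distance.

Section convex_growth.
Context {R : realType} {n : nat}.
Local Notation V := 'rV[R[i]]_n.
Implicit Types (x y v o : V) (D : set V).

(** A point displaced by [e] from the centre is a convex combination of points of the two given
    balls, displaced by (rho / r) e and (d / r) e. *)
Lemma convex_ball D o x (rho d t : R) : convex_set D -> 0 < rho -> 0 < d ->
  (forall y, enorm (y - o) < rho -> D y) -> (forall y, enorm (y - x) < d -> D y) ->
  0 <= t -> t <= 1 ->
  forall y, enorm (y - (o + t%:C *: (x - o))) < (1 - t) * rho + t * d -> D y.
Proof.
move=> cD rho0 d0 Do Dx t0 t1 y; set r := (1 - t) * rho + t * d.
set e := y - _ => er; have r0 : 0 < r by apply: le_lt_trans er; exact: enorm_ge0.
have er1 : enorm e / r < 1 by rewrite ltr_pdivrMr// mul1r.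
have in_ball (c : V) (s : R) : 0 < s -> enorm ((c + (s / r)%:C *: e) - c) < s.
  move=> s0; rewrite addrAC subrr add0r enormZ normc_real ger0_norm ?divr_ge0 ?ltW//.
  by rewrite mulrAC -mulrA -[ltRHS]mulr1 ltr_pM2l.
have := convexP cD (Dx _ (in_ball x d d0)) (Do _ (in_ball o rho rho0)) t0 t1.
congr (D _); rewrite rmorphB rmorph1.
have E : t%:C * (d / r)%:C + (1 - t%:C) * (rho / r)%:C = 1 :> R[i].
  rewrite -[1]/(1%:C) -rmorphB -!rmorphM -rmorphD !mulrA -mulrDl addrC divff//.
  by rewrite gt_eqF.
apply/rowP => j; rewrite /e !mxE.
set T := t%:C in E *; set a := (d / r)%:C in E *; set b := (rho / r)%:C in E *.
transitivity (T * x 0 j + (1 - T) * o 0 j +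
  (T * a + (1 - T) * b) * (y 0 j - (o 0 j + T * (x 0 j - o 0 j)))); first by ring.
by rewrite E; ring.
Qed.

Lemma kobayashi_dist_pow2 D o x (rho d M : R) k : convex_set D -> 0 < M ->
  (forall y, D y -> enorm y <= M) -> 0 < rho -> 0 < d -> d <= rho ->
  (forall y, enorm (y - o) < rho -> D y) -> (forall y, enorm (y - x) < d -> D y) ->
  (2 ^+ k)^-1 <= d ->
  (kobayashi_dist D o x <= (2 * M / rho * k%:R + 2 * M)%:E)%E.
Proof.
move=> cD M0 DM rho0 d0 drho Do Dx kd.
have xo : enorm (x - o) <= 2 * M.
  apply: (le_trans (enormB _ _)).
  by rewrite mulr_natl mulr2n lerD// DM//; [apply: Dx|apply: Do]; rewrite subrr enorm0.
pose g (t : R) := o + t%:C *: (x - o).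
have rad t (s : R) : 0 <= t -> t <= 1 -> 0 < s -> s <= (1 - t) * rho + t * d ->
    D (g t) /\ (kobayashi_metric D (g t) (x - o) <= (2 * M / s)%:E)%E.
  move=> t0 t1 s0 sr; have H := convex_ball cD rho0 d0 Do Dx t0 t1.
  split; first by apply: H; rewrite /g subrr enorm0; exact: lt_le_trans sr.
  apply: le_trans (kobayashi_metric_ball (x - o) s0 _) _.
    by move=> y ys; apply: H; exact: lt_le_trans sr.
  by rewrite lee_fin ler_wpM2r// invr_ge0 ltW.
have B0 : 0 <= 2 * M / rho by rewrite divr_ge0 ?mulr_ge0// ltW.
have dya u t : 0 <= u -> u <= t -> t < 1 ->
    (kobayashi_dist D (g u) (g t) <= (2 * M / rho * ((t - u) / (1 - t)))%:E)%E.
  move=> u0 ut t1; have s0 : 0 < (1 - t) * rho by rewrite mulr_gt0// subr_gt0.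
  have rad' w : u <= w -> w <= t -> D (g w) /\
      (kobayashi_metric D (g w) (x - o) <= (2 * M / ((1 - t) * rho))%:E)%E.
    move=> uw wt; apply: rad => //; [lra|lra|nra].
  apply: (@le_trans _ _ (2 * M / ((1 - t) * rho) * (t - u))%:E); last first.
    rewrite lee_fin le_eqVlt; apply/orP; left; apply/eqP.
    by field; rewrite !gt_eqF// subr_gt0.
  apply: kobayashi_dist_segment => //.
  - by rewrite divr_ge0 ?mulr_ge0// ?subr_ge0 ltW.
  - by move=> w uw wt; have [] := rad' w uw wt.
  - by move=> w uw wt; have [] := rad' w uw wt.
have p0 : 0 < (2 ^+ k)^-1 :> R by rewrite invr_gt0 exprn_gt0.
have p1 : (2 ^+ k)^-1 <= 1 :> R by rewrite invf_le1 ?exprn_gt0// exprn_ege1//; lra.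
set p : R := (2 ^+ k)^-1 in kd p0 p1.
have t0 : 0 <= 1 - p by lra.
have pt : p <= 1 - (1 - p) by lra.
have h1 := kobayashi_dist_dyadic B0 dya t0 pt.
have g0 : g 0 = o by rewrite /g scale0r addr0.
have g1 : g 1 = x by rewrite /g scale1r addrCA subrr addr0.
rewrite EFinD -{1}g0 -{1}g1.
apply: (le_trans (kobayashi_dist_triangle _ _ (g (1 - p)) _)).
apply: leeD; first exact: h1.
have rad' w : 1 - p <= w -> w <= 1 -> D (g w) /\
    (kobayashi_metric D (g w) (x - o) <= (2 * M / d)%:E)%E.
  by move=> pw w1; apply: rad => //; [lra|nra].
apply: (@le_trans _ _ (2 * M / d * (1 - (1 - p)))%:E).
  apply: kobayashi_dist_segment => //.
  - by lra.
  - by rewrite divr_ge0 ?mulr_ge0// ltW.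
  - by move=> w pw w1; have [] := rad' w pw w1.
  - by move=> w pw w1; have [] := rad' w pw w1.
rewrite lee_fin subKr mulrAC ler_pdivrMr// ler_pM2l// mulr_gt0//.
Qed.

Lemma kobayashi_dist_log D o (M : R) : (0 < n)%N -> open D -> convex_set D -> 0 < M ->
  (forall y, D y -> enorm y <= M) -> D o ->
  exists A B : R, [/\ 0 < A, 0 < B & forall x, D x ->
    (kobayashi_dist D o x <= (A + B * `|ln (delta D x)|)%:E)%E].
Proof.
move=> n0 oD cD M0 DM Do; have [rho rho0 Hrho] := open_enorm oD Do.
have B0 : 0 < 2 * M / rho by rewrite divr_gt0// mulr_gt0.
have l2 : 0 < ln 2 :> R by rewrite ln_gt0//; lra.
exists (2 * M / rho * (`|ln rho| / ln 2 + 1) + 2 * M), (2 * M / rho / ln 2); split.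
- apply: addr_gt0; last by rewrite mulr_gt0.
  by apply: mulr_gt0 => //; rewrite ltr_wpDl// divr_ge0// ltW.
- by rewrite divr_gt0.
move=> x Dx; have dl0 := delta_gt0 n0 oD DM Dx.
pose d := Num.min (delta D x) rho.
have d0 : 0 < d by rewrite lt_min dl0.
have lnd : `|ln d| <= `|ln (delta D x)| + `|ln rho|.
  by rewrite /d; have [_|_] := leP (delta D x) rho; rewrite ?lerDl ?lerDr.
(* Rounding up makes 2^-k <= d, with k still linear in |ln d|. *)
pose k := (Num.truncn (`|ln d| / ln 2)).+1.
have q0 : 0 <= `|ln d| / ln 2 by rewrite divr_ge0// ltW.
have /andP[k1 k2] := truncn_itv q0.
have kd : (2 ^+ k)^-1 <= d.
  rewrite -ler_ln ?posrE ?invr_gt0 ?exprn_gt0// lnV ?posrE ?exprn_gt0// lnXn//.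
  rewrite lerNl; apply: (@le_trans _ _ `|ln d|); first by rewrite -normrN ler_norm.
  by rewrite -[leRHS]mulr_natl -ler_pdivrMr// ltW.
have drho : d <= rho by rewrite ge_min lexx orbT.
have Hd y : enorm (y - x) < d -> D y.
  by move=> yd; apply: (delta_ball oD Dx); apply: (lt_le_trans yd); rewrite ge_min lexx.
apply: (le_trans (kobayashi_dist_pow2 cD M0 DM rho0 d0 drho Hrho Hd kd)).
have kle : k%:R <= `|ln (delta D x)| / ln 2 + (`|ln rho| / ln 2 + 1).
  rewrite addrA /k -[leLHS]natr1 lerD2r; apply: (le_trans k1).
  by rewrite -mulrDl ler_pM2r// invr_gt0.
have {kle} := ler_wpM2l (ltW B0) kle.
have E : 2 * M / rho / ln 2 * `|ln (delta D x)| = 2 * M / rho * (`|ln (delta D x)| / ln 2).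
  by rewrite mulrAC -mulrA.
rewrite lee_fin E mulrDr; clear; lra.
Qed.

(* With [kappa = K_D(o, .) + 1], log-type convexity becomes an intrinsic growth
   condition on the Kobayashi metric. *)
Lemma log_type_growth D o : (0 < n)%N -> log_type_convex D -> D o ->
  (forall x, D x -> (kobayashi_dist D o x < +oo)%E) /\
  exists c nu : R, [/\ 0 < c, 0 < nu & forall x v, D x ->
    ((c * (fine (kobayashi_dist D o x) + 1) `^ (1 + nu) * enorm v)%:E
       <= kobayashi_metric D x v)%E].
Proof.
move=> n0 [[_ oD _] bD cD [nu [C [nu0 C0 HC]]]] Do.
have [M M0 DM] := bounded_enorm bD.
have [A [B [A0 B0 HAB]]] := kobayashi_dist_log n0 oD cD M0 DM Do.
split; first by move=> x Dx; apply: le_lt_trans (HAB x Dx) (ltry _).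
have AB0 : 0 < A + B + 1 by lra.
pose p := (A + B + 1) `^ (1 + nu).
have p0 : 0 < p by rewrite powR_gt0.
pose N : R := n.+1%:R * (8 * M).
have N0 : 0 < N by rewrite !mulr_gt0.
exists (Num.min (16 * C)^-1 N^-1 / p), nu; split => //.
  by rewrite divr_gt0// lt_min !invr_gt0 N0 mulr_gt0.
move=> x v Dx; have [->|v0] := eqVneq v 0.
  by rewrite enorm0 mulr0; exact: kobayashi_metric_ge0.
have ev : 0 < enorm v by rewrite enorm_gt0.
set ka := fine _ + 1.
set L := `|ln (delta D x)|.
have L0 : 0 <= L by exact: normr_ge0.
have ka1 : 1 <= ka by rewrite lerDr fine_ge0// kobayashi_dist_ge0.
have kaL : ka <= A + B * L + 1.
  rewrite lerD2r -lee_fin fineK; first exact: HAB.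
  by rewrite ge0_fin_numE ?kobayashi_dist_ge0// (le_lt_trans (HAB x Dx)) ?ltry.
have nu1 : 0 <= 1 + nu by lra.
(* For L < 1 the depth is at most A + B + 1 and the bound for bounded domains suffices. Otherwise A
   + B L + 1 <= (A + B + 1) L, so a power of [L] dominates the same power of the depth. *)
have [L1|L1] := ltP L 1.
  apply: le_trans (kobayashi_metric_bounded x v M0 DM); rewrite lee_fin -/N.
  rewrite [leRHS]mulrC ler_pM2r//.
  apply: (@le_trans _ _ (N^-1 / p * ka `^ (1 + nu))).
    by rewrite ler_wpM2r ?powR_ge0// ler_pM2r ?invr_gt0// ge_min lexx orbT.
  rewrite -mulrA ler_piMr//; first by rewrite invr_ge0 ltW.
  rewrite mulrC ler_pdivrMr// mul1r.
  by apply: ge0_ler_powR; rewrite ?nnegrE//; nra.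
have [dd0 Hdd] := delta_dir_metric oD cD DM Dx v0.
apply: le_trans Hdd; rewrite lee_fin [leRHS]mulrC ler_pM2r//.
have Lp0 : 0 < L `^ (1 + nu) by rewrite powR_gt0//; lra.
have ddC : delta_dir D x v <= C / L `^ (1 + nu).
  by have := HC x v Dx v0; rewrite -/L inver gt_eqF// -EFinM lee_fin.
apply: (@le_trans _ _ ((16 * C)^-1 / p * ka `^ (1 + nu))).
  by rewrite ler_wpM2r ?powR_ge0// ler_pM2r ?invr_gt0// ge_min lexx.
apply: (@le_trans _ _ ((16 * C)^-1 * L `^ (1 + nu))).
  rewrite -mulrA ler_pM2l ?invr_gt0 ?mulr_gt0// mulrC ler_pdivrMr// mulrC -powRM//; last lra.
  by apply: ge0_ler_powR; rewrite ?nnegrE//; nra.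
rewrite -[X in _ * X]invrK -invfM lef_pV2 ?posrE ?mulr_gt0 ?invr_gt0//.
by rewrite -mulrA ler_pM2l.
Qed.

End convex_growth.

(** * Near-geodesics *)

Section dyadic_levels.
Context {R : realType}.
Implicit Types (a b s t u w e C nu : R) (kappa : R -> R) (l m : R -> R -> R).

Definition cont_on a b kappa := forall t e, a <= t -> t <= b -> 0 < e ->
  exists2 d, 0 < d &
    forall u, a <= u -> u <= b -> `|t - u| < d -> `|kappa t - kappa u| < e.

(* [l s t] and [m s t] are two measures of the arc of a curve over [[s, t]], and
   [kappa t] is the depth of the point with parameter [t].  Visibility takes the
   displacement for [m]; the additive comparison of the distances takes the excess
   of the distance in [Omega `&` U] over the length in [Omega]. *)
Definition arc_control a b kappa l m C nu := [/\ cont_on a b kappa,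
  forall t, a <= t -> t <= b -> 1 <= kappa t,
  forall s t, a <= s -> s <= t -> t <= b -> l s t <= kappa s + kappa t + 1,
  forall s u t, a <= s -> s <= u -> u <= t -> t <= b -> m s t <= m s u + m u t &
  forall s t (lam : R), a <= s -> s <= t -> t <= b -> 0 < lam ->
    (forall w, s <= w -> w <= t -> lam <= kappa w) ->
    m s t * lam `^ (1 + nu) <= C * l s t].

Lemma cont_onS a b a' b' kappa : a <= a' -> b' <= b ->
  cont_on a b kappa -> cont_on a' b' kappa.
Proof.
move=> aa bb H t e at_ tb e0.
have [d d0 Hd] := H t e (le_trans aa at_) (le_trans tb bb) e0.
exists d => // u au ub; apply: Hd; [exact: le_trans au|exact: le_trans bb].
Qed.

Lemma cont_on_reflect a b kappa : cont_on a b kappa ->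
  cont_on (- b) (- a) (fun t => kappa (- t)).
Proof.
move=> H t e at_ tb e0.
have [|||d d0 Hd] := H (- t) e; [lra|lra|by []|].
exists d => // u au ub tu; apply: Hd; [lra|lra|].
by rewrite -opprD normrN.
Qed.

Lemma arc_controlS a b a' b' kappa l m C nu : a <= a' -> b' <= b ->
  arc_control a b kappa l m C nu -> arc_control a' b' kappa l m C nu.
Proof.
move=> aa bb [H0 H1 H2 H3 H4]; split.
- exact: cont_onS H0.
- by move=> t at_ tb; apply: H1; [exact: le_trans at_|exact: le_trans bb].
- by move=> s t as_ st tb; apply: H2; [exact: le_trans as_| |exact: le_trans bb].
- by move=> s u t as_ su ut tb; apply: H3; [exact: le_trans as_| | |exact: le_trans bb].
- by move=> s t lam as_ st tb; apply: H4; [exact: le_trans as_| |exact: le_trans bb].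
Qed.

Lemma arc_control_reflect a b kappa l m C nu : arc_control a b kappa l m C nu ->
  arc_control (- b) (- a) (fun t => kappa (- t)) (fun s t => l (- t) (- s))
    (fun s t => m (- t) (- s)) C nu.
Proof.
move=> [H0 H1 H2 H3 H4]; split.
- exact: cont_on_reflect.
- by move=> t at_ tb; apply: H1; lra.
- by move=> s t as_ st tb; rewrite (addrC (kappa _)); apply: H2; lra.
- by move=> s u t as_ su ut tb; rewrite addrC; apply: H3; lra.
- move=> s t lam as_ st tb l0 H; apply: H4 => //; try lra.
  by move=> w w1 w2; have := H (- w); rewrite opprK; apply; lra.
Qed.

Lemma first_exit a b kappa w : a <= b -> cont_on a b kappa -> kappa a <= w -> w <= kappa b ->
  exists t, [/\ a <= t, t <= b, w <= kappa t & forall s, a <= s -> s <= t -> kappa s <= w].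
Proof.
move=> ab H0 aw wb.
pose S := [set u : R | [/\ a <= u, u <= b & w <= kappa u]].
have Sb : S b by split.
have hS : has_lbound S by exists a => u [].
pose t := inf S.
have at_ : a <= t by apply: lb_le_inf; [exists b|move=> u []].
have tb : t <= b by exact: ge_inf.
have below s : a <= s -> s < t -> kappa s < w.
  move=> as_ st; rewrite ltNge; apply/negP => ws; suff : t <= s by lra.
  by apply: ge_inf => //; split => //; apply: ltW (lt_le_trans st tb).
exists t; split => //.
  rewrite leNgt; apply/negP => h; have e0 : 0 < w - kappa t by lra.
  have [d d0 Hd] := H0 t _ at_ tb e0.
  have [u [au ub wu] ud] : exists2 u, S u & u < t + d.
    by apply: inf_lt; [exists b|rewrite ltrDl].
  have tu : t <= u by apply: ge_inf => //; split.
  have := Hd u au ub; rewrite distrC (ger0_norm (_ : 0 <= u - t)) ?subr_ge0// => h1.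
  have := h1 ltac:(lra); rewrite distrC => /ltr_normlW; lra.
move=> s as_; rewrite le_eqVlt => /predU1P[->|st]; last exact/ltW/below.
move: at_; rewrite le_eqVlt => /predU1P[<-//|at_].
rewrite leNgt; apply/negP => h; have e0 : 0 < kappa t - w by lra.
have [d d0 Hd] := H0 t _ (ltW at_) tb e0.
pose u := Num.max a (t - d / 2).
have ut : u < t by rewrite gt_max at_/=; lra.
have au : a <= u by rewrite le_max lexx.
have ud : t - d / 2 <= u by rewrite le_max lexx orbT.
have := Hd u au (le_trans (ltW ut) tb).
rewrite (ger0_norm (_ : 0 <= t - u)) ?subr_ge0 ?ltW// => h1.
have /ltr_normlW := h1 ltac:(lra); have := below u au ut; lra.
Qed.

Let q nu : R := (2 `^ nu)^-1.

(** The 3 comes from the lowest piece, where l <= 2 kappa t0 + 1; 4 / (1 - q) is the sum of the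
    terms 4 q^k of the dyadic pieces above it. *)
Definition arc_const nu : R := 3 + 4 / (1 - q nu).

Let q_lt1 nu : 0 < nu -> 0 < q nu /\ 0 < 1 - q nu.
Proof.
move=> nu0; rewrite subr_gt0 /q invr_gt0 powR_gt0//; split => //.
have p0 : 0 < 2 `^ nu :> R by rewrite powR_gt0.
rewrite invf_lt1//.
by have := @gt0_ltr_powR R nu nu0 1 2; rewrite powR1; apply; rewrite ?nnegrE//; lra.
Qed.

Lemma arc_const_gt0 nu : 0 < nu -> 0 < arc_const nu.
Proof.
by move=> nu0; have [_ ?] := q_lt1 nu0; rewrite addr_gt0// divr_gt0.
Qed.

(* The arc is cut at the last times [kappa] is below [2^k * kappa t0]: on the
   k-th piece [kappa >= 2^k * kappa t0] while [l] is at most [4 * 2^k * kappa t0],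
   so the pieces contribute the terms of a geometric series to [m]. *)
Lemma arc_bound_left t0 b kappa l m C nu : 0 < nu -> 0 <= C -> t0 <= b ->
  arc_control t0 b kappa l m C nu ->
  (forall t, t0 <= t -> t <= b -> kappa t0 <= kappa t) ->
  m t0 b * kappa t0 `^ nu <= C * arc_const nu.
Proof.
move=> nu0 C0 t0b [H0 H1 H2 H3 H4] kmin.
have [q0 q1] := q_lt1 nu0; set r := q nu in q0 q1.
set k0 := kappa t0; have k01 : 1 <= k0 by apply: H1.
have k00 : 0 < k0 by lra.
have kn0 : 0 < k0 `^ nu by rewrite powR_gt0.
have cut (s t lam B : R) : t0 <= s -> s <= t -> t <= b -> 0 < lam ->
    (forall w, s <= w -> w <= t -> lam <= kappa w) -> l s t <= B * lam ->
    m s t * lam `^ nu <= C * B.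
  move=> s0 st tb lam0 lamk lB; have := H4 s t lam s0 st tb lam0 lamk.
  rewrite addrC powRD ?gt_eqF ?implybT//; last by rewrite addr_gt0.
  rewrite (powRr1 (ltW lam0)) mulrA => h; rewrite -(ler_pM2r lam0); apply: (le_trans h).
  by rewrite -mulrA ler_wpM2l.
suff H N : forall t, t0 <= t -> t <= b -> kappa t <= 2 ^+ N * k0 ->
    m t0 t * k0 `^ nu <= C * (3 + 4 * ((1 - r ^+ N) / (1 - r))).
  pose N := (Num.truncn (kappa b)).+1.
  have kb : kappa b <= 2 ^+ N * k0.
    have kb0 : 0 <= kappa b by have := H1 b t0b (lexx _); lra.
    have /andP[_ /ltW h] := truncn_itv kb0.
    apply: (le_trans h); apply: (@le_trans _ _ (2 ^+ N)).
      by rewrite -natrX ler_nat ltnW// ltn_expl.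
    by rewrite ler_peMr// exprn_ge0.
  apply: (le_trans (H N b t0b (lexx _) kb)); rewrite ler_wpM2l//.
  rewrite lerD2l ler_pM2l// ler_pdivrMr// mulVf ?gt_eqF// gerBl exprn_ge0// ltW//.
elim: N => [|N IH] t tt tb kt.
  rewrite expr0 subrr mul0r mulr0 addr0; apply: cut => //.
    by move=> w w1 w2; apply: kmin => //; exact: le_trans w2 tb.
  apply: (le_trans (H2 t0 t (lexx _) tt tb)); rewrite -/k0.
  by move: kt; rewrite expr0 mul1r; lra.
set Lam := 2 ^+ N * k0 in IH.
have pN : 0 < (2 : R) ^+ N by rewrite exprn_gt0.
have pN1 : 1 <= (2 : R) ^+ N by rewrite exprn_ege1//; lra.
have Lam0 : 0 < Lam by rewrite mulr_gt0.
have Lamk : k0 <= Lam by rewrite ler_peMl// ltW.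
pose S := [set u : R | [/\ t0 <= u, u <= t & kappa u <= Lam]].
have S0 : S t0 by split.
have hS : has_ubound S by exists t => u [].
pose be := sup S.
have be0 : t0 <= be by exact: ub_le_sup.
have bet : be <= t by apply: ge_sup; [exists t0|move=> u []].
have beb : be <= b by exact: le_trans tb.
have bel : kappa be <= Lam.
  rewrite leNgt; apply/negP => h; have e0 : 0 < kappa be - Lam by lra.
  have [d d0 Hd] := H0 be _ be0 beb e0.
  have [u [u0 ut uL] ud] : exists2 u, S u & be - d < u.
    by apply: sup_gt; [exists t0|rewrite gtrBl].
  have ube : u <= be by apply: ub_le_sup => //; split.
  have := Hd u u0 (le_trans ut tb).
  rewrite (ger0_norm (_ : 0 <= be - u)) ?subr_ge0// => /(_ _)/ltr_normlW; lra.
have step : m be t * k0 `^ nu <= C * (4 * r ^+ N) \/ be = t.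
  have [/eqP bt|bt] := boolP (be == t); [by right|left].
  have {}bt : be < t by rewrite lt_neqAle bt.
  have above w : be < w -> w <= t -> Lam < kappa w.
    move=> bw wt; rewrite ltNge; apply/negP => kw; suff : w <= be by lra.
    by apply: ub_le_sup => //; split => //; apply: le_trans be0 (ltW bw).
  have abe : Lam <= kappa be.
    rewrite leNgt; apply/negP => h; have e0 : 0 < Lam - kappa be by lra.
    have [d d0 Hd] := H0 be _ be0 beb e0.
    pose w := Num.min t (be + d / 2).
    have bw : be < w by rewrite lt_min bt/=; lra.
    have wt : w <= t by rewrite ge_min lexx.
    have wd : w <= be + d / 2 by rewrite ge_min lexx orbT.
    have := Hd w (le_trans be0 (ltW bw)) (le_trans wt tb).
    rewrite distrC (distrC (kappa be)) (ger0_norm (_ : 0 <= w - be)) ?subr_ge0 ?ltW// => h1.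
    have /ltr_normlW := h1 ltac:(lra); have := above w bw wt; lra.
  have abv w : be <= w -> w <= t -> Lam <= kappa w.
    by rewrite le_eqVlt => /predU1P[<-//|bw wt]; exact/ltW/above.
  have lB : l be t <= 4 * Lam.
    apply: (le_trans (H2 be t be0 bet tb)); move: kt bel; rewrite exprS /Lam; nra.
  have := cut be t Lam 4 be0 bet tb Lam0 abv lB.
  rewrite /Lam (powRM _ (ltW pN) (ltW k00)) => h.
  have rN : (2 ^+ N) `^ nu = (r ^+ N)^-1 :> R.
    by rewrite -powR_mulrn// -powRrM mulrC powRrM powR_mulrn ?powR_ge0// /r /q exprVn invrK.
  rewrite rN in h; have rN0 : 0 < r ^+ N by rewrite exprn_gt0.
  move: h; rewrite mulrCA mulrC ler_pdivrMr// => h.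
  by rewrite mulrA.
have rr : (1 - r ^+ N.+1) / (1 - r) = (1 - r ^+ N) / (1 - r) + r ^+ N.
  by rewrite exprSr; field; rewrite gt_eqF.
have rN0 : 0 <= r ^+ N by rewrite exprn_ge0// ltW.
have ih := IH be be0 beb bel.
rewrite rr; set X := _ / _ in ih *.
rewrite (_ : C * _ = C * (3 + 4 * X) + C * (4 * r ^+ N)); last by ring.
case: step => [st|bt].
  apply: (@le_trans _ _ ((m t0 be + m be t) * k0 `^ nu)).
    by rewrite ler_pM2r//; exact: H3.
  by rewrite mulrDl; exact: lerD.
by rewrite -bt; apply: (le_trans ih); rewrite lerDl mulr_ge0// mulr_ge0.
Qed.

(** The curve is cut at a point [t] of least depth; [arc_bound_left] bounds the part after [t], and,
    applied to the reversed curve, the part before it. *)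
Lemma arc_bound a b kappa l m C nu : 0 < nu -> 0 <= C -> a <= b ->
  arc_control a b kappa l m C nu ->
  exists t, [/\ a <= t, t <= b & m a b * kappa t `^ nu <= 2 * (C * arc_const nu)].
Proof.
move=> nu0 C0 ab H; have [H0 _ _ H3 _] := H.
have kc : {within `[a, b]%classic, continuous kappa}.
  have fc : continuous (kappa \o clamp a b).
    move=> x; apply/cvgrPdist_lt => e e0.
    have [d d0 Hd] := H0 (clamp a b x) e (clamp_ge _ _ _) (clamp_le _ ab) e0.
    near=> y; have : `|x - y| < d by near: y; apply: cvgr_dist_lt.
    move=> xyd; apply: Hd; rewrite ?clamp_ge ?clamp_le//.
    have [xy|/ltW yx] := leP x y.
      rewrite distrC ger0_norm ?subr_ge0 ?clamp_homo//.
      apply: (le_lt_trans (clamp_lip _ _ xy)).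
      by move: xyd; rewrite distrC ger0_norm ?subr_ge0.
    rewrite ger0_norm ?subr_ge0 ?clamp_homo//.
    apply: (le_lt_trans (clamp_lip _ _ yx)).
    by move: xyd; rewrite ger0_norm ?subr_ge0.
  apply: (@subspace_eq_continuous _ _ _ (kappa \o clamp a b)).
    move=> x; rewrite inE/= in_itv/= => /andP[ax xb].
    by rewrite /= clamp_id.
  exact: continuous_subspaceT.
have [t tab tmin] := EVT_min ab kc.
move: tab; rewrite in_itv/= => /andP[at_ tb].
exists t; split => //.
have r1 := arc_bound_left nu0 C0 tb (arc_controlS at_ (lexx _) H).
have {}r1 : m t b * kappa t `^ nu <= C * arc_const nu.
  by apply: r1 => w tw wb; apply: tmin; rewrite in_itv/= wb (le_trans at_ tw).
have nab : - t <= - a by rewrite lerN2.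
have r2 := arc_bound_left nu0 C0 nab (arc_control_reflect (arc_controlS (lexx _) tb H)).
have {}r2 : m a t * kappa t `^ nu <= C * arc_const nu.
  rewrite !opprK in r2; apply: r2 => w tw wb; apply: tmin; rewrite in_itv/=; lra.
have kt0 : 0 <= kappa t `^ nu by exact: powR_ge0.
have := H3 a t b (lexx _) at_ tb (lexx _) => /(ler_wpM2r kt0).
rewrite mulrDl; lra.
Unshelve. all: by end_near. Qed.

End dyadic_levels.

Section near_geodesics.
Context {R : realType} {n : nat}.
Local Notation V := 'rV[R[i]]_n.
Implicit Types (x y z v o p : V) (D E W : set V) (a b s t u : R) (sg : R -> V).

(** This is kappa; the summand 1 makes the levels of the dyadic cutting start at a positive
    value. *)
Definition depth D o x : R := fine (kobayashi_dist D o x) + 1.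

(** The defect 1 is imposed on every subarc, which makes the notion hereditary. *)
Definition near_geodesic E a b sg := [/\ curve_in E a b sg,
  (kobayashi_length E a b sg < +oo)%E &
  forall s t, a <= s -> s <= t -> t <= b ->
    (kobayashi_length E s t sg <= kobayashi_dist E (sg s) (sg t) + 1%:E)%E].

Let fin_ex (c d : \bar R) : (0 <= c)%E -> (c <= d)%E -> (d < +oo)%E -> exists r : R, c = r%:E.
Proof.
move=> c0 cd dy; exists (fine c); rewrite fineK// ge0_fin_numE//; exact: le_lt_trans dy.
Qed.

Let fin_lt (c : \bar R) : (0 <= c)%E -> (c < +oo)%E -> c = (fine c)%:E.
Proof. by move=> c0 cy; rewrite fineK// ge0_fin_numE. Qed.

Lemma near_geodesicS E a b a' b' sg : a <= a' -> a' <= b' -> b' <= b ->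
  near_geodesic E a b sg -> near_geodesic E a' b' sg.
Proof.
move=> aa ab bb [cE Ly H]; split.
- exact: curve_inS cE.
- by apply: le_lt_trans Ly; exact: kobayashi_length_sub.
- by move=> s t as_ st tb; apply: H => //; [exact: le_trans as_|exact: le_trans bb].
Qed.

Lemma near_geodesic_length E a b sg s t : near_geodesic E a b sg ->
  a <= s -> s <= t -> t <= b ->
  kobayashi_length E s t sg = (fine (kobayashi_length E s t sg))%:E.
Proof.
move=> [_ Ly _] as_ st tb; apply: fin_lt; first exact: kobayashi_length_ge0.
by apply: le_lt_trans Ly; exact: kobayashi_length_sub.
Qed.

(** A curve minimal up to 1 between its ends is so on [s, t] too: the length over [s, t] is at most
    the total length minus those over [a, s] and [t, b], which are at least the corresponding
    distances; the triangle inequality concludes. *)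
Lemma near_geodesic_exists E x y : (kobayashi_dist E x y < +oo)%E ->
  exists a b sg, [/\ near_geodesic E a b sg, sg a = x, sg b = y &
    (kobayashi_length E a b sg <= kobayashi_dist E x y + 1%:E)%E].
Proof.
move=> Ky; have [a [b [sg [cE sa sb L]]]] := kobayashi_dist_near ltr01 Ky.
have Ly : (kobayashi_length E a b sg < +oo)%E.
  by apply: (le_lt_trans L); rewrite lte_add_pinfty// ltry.
exists a, b, sg; split => //; split => // s t as_ st tb.
have [ab _ _] := cE.
have sb' := le_trans st tb; have at_ := le_trans as_ st.
have h1 := kobayashi_length_superadd E sg as_ sb'.
have h2 := kobayashi_length_superadd E sg st tb.
have k1 := kobayashi_dist_le (curve_inS (lexx _) as_ sb' cE).
have k2 := kobayashi_dist_le (curve_inS at_ tb (lexx _) cE).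
have fl u w : a <= u -> u <= w -> w <= b -> exists r : R, kobayashi_length E u w sg = r%:E.
  move=> au uw wb; apply: (fin_ex (kobayashi_length_ge0 _ _ _ _) _ Ly).
  exact: kobayashi_length_sub.
have fk z w (r : R) : (kobayashi_dist E z w <= r%:E)%E -> exists r : R, kobayashi_dist E z w = r%:E.
  by move=> zr; exact: fin_ex (kobayashi_dist_ge0 _ _ _) zr (ltry _).
have k3 := kobayashi_dist_le (curve_inS as_ st tb cE).
have t1 := kobayashi_dist_triangle E x (sg s) y.
have t2 := kobayashi_dist_triangle E (sg s) (sg t) y.
have [las E1] := fl a s (lexx _) as_ sb'.
have [lst E2] := fl s t as_ st tb.
have [ltb E3] := fl t b at_ tb (lexx _).
have [lab E4] := fl a b (lexx _) ab (lexx _).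
have [lsb E5] := fl s b as_ sb' (lexx _).
rewrite sa {}E1 in k1 h1; rewrite sb {}E3 in k2 h2; rewrite {}E2 in k3 h2 *.
rewrite {}E5 in h1 h2; rewrite {}E4 in h1 L.
have [kas F1] := fk _ _ _ k1; have [ktb F2] := fk _ _ _ k2; have [kst F3] := fk _ _ _ k3.
rewrite {}F1 in k1 t1; rewrite {}F2 in k2 t2; rewrite {}F3 in k3 t2 *.
have [ksb F4] := fk _ _ _ t2.
rewrite {}F4 in t1 t2; have [kab F5] := fk _ _ _ t1.
rewrite {}F5 in t1 L; move: h1 h2 k1 k2 t1 t2 L; rewrite -!EFinD !lee_fin; lra.
Qed.

Section depth.
Variables (D : set V) (o : V).
Hypotheses (oD : open D)
  (finD : forall x, D x -> (kobayashi_dist D o x < +oo)%E).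

Let distE x : D x -> kobayashi_dist D o x = (depth D o x - 1)%:E.
Proof.
by move=> Dx; rewrite /depth addrK -fin_lt ?kobayashi_dist_ge0//; exact: finD.
Qed.

Lemma depth_ge1 x : 1 <= depth D o x.
Proof. by rewrite lerDr fine_ge0// kobayashi_dist_ge0. Qed.

Lemma kobayashi_dist_depth x y : D x -> D y ->
  (kobayashi_dist D x y <= (depth D o x + depth D o y - 2)%:E)%E.
Proof.
move=> Dx Dy; apply: (le_trans (kobayashi_dist_triangle _ _ o _)).
rewrite kobayashi_dist_sym !distE// -EFinD lee_fin; lra.
Qed.

Lemma depth_dist x y : D x -> D y ->
  ((depth D o x - depth D o y)%:E <= kobayashi_dist D x y)%E.
Proof.
move=> Dx Dy; have := kobayashi_dist_triangle D o y x.
rewrite (kobayashi_dist_sym D y x) !distE//.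
by rewrite -leeBlDl// -EFinB; congr (_ <= _)%E; congr (_%:E); lra.
Qed.

Lemma depth_cont_on a b sg : curve_in D a b sg -> cont_on a b (depth D o \o sg).
Proof.
move=> [ab ac sD] t e at_ tb e0.
have [rho rho0 Hrho] := open_enorm oD (sD t at_ tb).
pose d1 := Num.min (rho / 2) (e * rho / 4).
have d10 : 0 < d1 by rewrite lt_min !divr_gt0// mulr_gt0.
have [d d0 Hd] := abs_continuous_cont ac d10.
exists d => // u au ub tu.
have := Hd t u at_ tb au ub tu; rewrite lt_min => /andP[/ltW h1 h2].
rewrite enorm_distC in h1.
have K := kobayashi_dist_ball rho0 Hrho h1.
have Ke : 2 / rho * enorm (sg u - sg t) < e.
  rewrite enorm_distC mulrAC ltr_pdivrMr//.
  by have := mulr_gt0 e0 rho0; lra.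
have a1 := le_trans (depth_dist (sD t at_ tb) (sD u au ub)) K.
have a2 := depth_dist (sD u au ub) (sD t at_ tb).
rewrite kobayashi_dist_sym in a2; have {}a2 := le_trans a2 K.
rewrite !lee_fin in a1 a2; rewrite /= ltr_norml; lra.
Qed.

(** The length condition of [arc_control] is automatic: a near-geodesic of [E] is no longer than the
    distance plus 1, and the latter is at most the distance in [D] through [o]. *)
Lemma arc_controlP E a b sg (m : R -> R -> R) (C nu : R) : D `<=` E -> near_geodesic E a b sg ->
  curve_in D a b sg ->
  (forall s u t, a <= s -> s <= u -> u <= t -> t <= b -> m s t <= m s u + m u t) ->
  (forall s t (lam : R), a <= s -> s <= t -> t <= b -> 0 < lam ->
    (forall w, s <= w -> w <= t -> lam <= depth D o (sg w)) ->
    m s t * lam `^ (1 + nu) <= C * fine (kobayashi_length E s t sg)) ->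
  arc_control a b (depth D o \o sg) (fun s t => fine (kobayashi_length E s t sg)) m C nu.
Proof.
move=> DE ng cD mS mC; split => //.
- exact: depth_cont_on.
- by move=> t _ _; exact: depth_ge1.
move=> s t as_ st tb; have [_ _ H] := ng; have [_ _ sD] := cD.
rewrite -lee_fin -(near_geodesic_length ng)//; apply: (le_trans (H s t as_ st tb)).
apply: (@le_trans _ _ ((depth D o (sg s) + depth D o (sg t) - 2)%:E + 1%:E)%E).
  rewrite leeD2r//; apply: le_trans (kobayashi_dist_sub _ _ DE) _.
  by apply: kobayashi_dist_depth; apply: sD; lra.
by rewrite -EFinD lee_fin /=; lra.
Qed.

End depth.

End near_geodesics.

(** * Visibility and the additive comparison of lengths *)

Section visibility.
Context {R : realType} {n : nat}.
Local Notation V := 'rV[R[i]]_n.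
Implicit Types (x y z v o p : V) (D E W : set V) (a b s t u : R) (sg : R -> V).

Lemma near_geodesic_reflect E a b c sg : near_geodesic E a b sg ->
  near_geodesic E (c - b) (c - a) (fun u => sg (c - u)).
Proof.
move=> [cE Ly H]; have [ab _ _] := cE; split.
- exact: curve_in_reflect.
- by apply: le_lt_trans Ly; exact: kobayashi_length_reflect.
move=> s t as_ st tb; rewrite kobayashi_dist_sym.
have ts : c - t <= c - s by lra.
have := kobayashi_length_reflect E c sg ts; rewrite !subKr => /le_trans; apply.
by apply: H; lra.
Qed.

Lemma enorm_cont_on E a b sg x : curve_in E a b sg ->
  cont_on a b (fun t => enorm (sg t - x)).
Proof.
move=> [_ ac _] t e at_ tb e0; have [d d0 Hd] := abs_continuous_cont ac e0.
exists d => // u au ub tu; apply: le_lt_trans (Hd t u at_ tb au ub tu).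
rewrite ler_norml; apply/andP; split.
  by rewrite lerNl opprB lerBlDr (enorm_distC (sg t)); exact: enorm_tri.
by rewrite lerBlDr; exact: enorm_tri.
Qed.

Section growth.
Variables (D E W : set V) (o : V) (C1 c nu : R).
Hypotheses (oD : open D) (DE : D `<=` E)
  (finD : forall x, D x -> (kobayashi_dist D o x < +oo)%E)
  (C10 : 1 <= C1) (WD : W `<=` D)
  (kW : forall x v, W x -> (kobayashi_metric D x v <= C1%:E * kobayashi_metric E x v)%E)
  (c0 : 0 < c) (nu0 : 0 < nu)
  (kD : forall x v, D x ->
    ((c * depth D o x `^ (1 + nu) * enorm v)%:E <= kobayashi_metric D x v)%E).

(** [arc_bound] with the displacement as [m]: at the shallowest point, displacement times depth^nu
    is bounded, so a displacement of at least [r] bounds that depth. The constant [C] collects the 2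
    n of [kobayashi_length_displacement], the comparison factor [C1] and the growth constant [c]. *)
Lemma visibility (r : R) : 0 < r -> exists2 k0 : R, 1 <= k0 &
  forall a b sg, near_geodesic E a b sg -> (forall t, a <= t -> t <= b -> W (sg t)) ->
    r <= enorm (sg b - sg a) ->
    exists t, [/\ a <= t, t <= b & depth D o (sg t) <= k0].
Proof.
move=> r0; have C1p : 0 < C1 by apply: lt_le_trans C10.
pose C := 2 * n%:R * C1 / c.
have Cp : 0 <= C by rewrite divr_ge0 ?mulr_ge0// ltW.
pose Q := 2 * (C * arc_const nu) / r.
have Q0 : 0 <= Q.
  apply: divr_ge0; last exact: ltW.
  by apply: mulr_ge0 => //; apply: mulr_ge0 => //; exact/ltW/arc_const_gt0.
exists (Num.max 1 (Q `^ nu^-1)); first by rewrite le_max lexx.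
move=> a b sg ng sW rab; have [cE _ _] := ng; have [ab ac _] := cE.
have cD : curve_in D a b sg by split => // t at_ tb; exact/WD/sW.
pose m s t := enorm (sg t - sg s).
have ctl : arc_control a b (depth D o \o sg)
    (fun s t => fine (kobayashi_length E s t sg)) m C nu.
  apply: (arc_controlP oD finD DE ng cD).
    by move=> s u t _ _ _ _; rewrite addrC; exact: enorm_tri.
  move=> s t lam as_ st tb l0 Hl; set l := fine _.
  have p0 : 0 < lam `^ (1 + nu) by rewrite powR_gt0.
  have cp0 : 0 < c * lam `^ (1 + nu) / C1 by rewrite divr_gt0// mulr_gt0.
  have Ll : (kobayashi_length E s t sg <= l%:E)%E by rewrite (near_geodesic_length ng).
  have cst := curve_inS as_ st tb cE.
  have := kobayashi_length_displacement cst cp0 _ Ll.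
  rewrite -/(m s t) => H.
  have {}H : c * lam `^ (1 + nu) / C1 * m s t <= n%:R * (2 * l).
    apply: H => w v sw wt.
    have Ww : W (sg w) by apply: sW; [exact: le_trans sw|exact: le_trans tb].
    have C1E : (0 < C1%:E)%E by rewrite lte_fin.
    rewrite -(@lee_pmul2l _ C1%:E)//; apply: le_trans (kW v Ww).
    apply: le_trans (kD v (WD Ww)); rewrite -EFinM lee_fin.
    rewrite mulrA [C1 * _]mulrC divfK ?gt_eqF// ler_wpM2r ?enorm_ge0// ler_pM2l//.
    apply: ge0_ler_powR; rewrite ?nnegrE; [|exact: ltW| |exact: Hl].
    - by apply/ltW/addr_gt0.
    - by apply: le_trans (depth_ge1 _ _ _).
  have C1c0 : 0 < C1 / c by rewrite divr_gt0.
  have := ler_wpM2l (ltW C1c0) H; rewrite (_ : C1 / c * _ = m s t * lam `^ (1 + nu)).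
    by move=> /le_trans; apply; rewrite le_eqVlt /C; apply/orP; left; apply/eqP; ring.
  by field; rewrite !gt_eqF.
have [t [at_ tb Ht]] := arc_bound nu0 Cp ab ctl.
exists t; split => //.
have d1 : 1 <= depth D o (sg t) := depth_ge1 _ _ _.
rewrite le_max; apply/orP; right.
have d0 : 0 <= depth D o (sg t) by apply: le_trans d1.
have -> : depth D o (sg t) = (depth D o (sg t) `^ nu) `^ nu^-1.
  by rewrite -powRrM divff ?gt_eqF// powRr1.
apply: ge0_ler_powR; rewrite ?nnegrE ?powR_ge0//; first by rewrite invr_ge0 ltW.
rewrite /Q ler_pdivlMr// mulrC; apply: le_trans Ht.
by rewrite ler_wpM2r ?powR_ge0.
Qed.

(** [visibility] asks the curve to stay in [W]; stopping it at its first exit from the ball of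
    radius [r] around its origin ensures this. *)
Lemma visible_exit (r : R) : 0 < r -> exists2 k0 : R, 1 <= k0 &
  forall a b sg, near_geodesic E a b sg ->
    (forall z, E z -> enorm (z - sg a) <= r -> W z) -> r <= enorm (sg b - sg a) ->
    exists t, [/\ a <= t, t <= b, depth D o (sg t) <= k0 &
      forall s, a <= s -> s <= t -> enorm (sg s - sg a) <= r].
Proof.
move=> r0; have [k0 k01 H] := visibility r0; exists k0 => // a b sg ng ball_W rb.
have [cE _ _] := ng; have [ab _ sE] := cE.
have ga : enorm (sg a - sg a) <= r by rewrite subrr enorm0 ltW.
have [t [at_ tb rt tr]] := first_exit ab (enorm_cont_on (sg a) cE) ga rb.
have [|u [au ut uk]] := H a t sg (near_geodesicS (lexx _) at_ tb ng) _ rt.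
  by move=> s as_ st; apply: ball_W; [apply: sE => //; exact: le_trans tb|exact: tr].
exists u; split => //; first exact: le_trans tb.
by move=> s as_ su; apply: tr => //; exact: le_trans ut.
Qed.

(* Curves leaving a ball of fixed radius pass a point of bounded depth, and
   before that point the metrics of [D] and [E] are comparable. *)
Lemma escape (r : R) : 0 < r -> exists2 k0 : R, 1 <= k0 &
  forall x y, (forall z, E z -> enorm (z - x) <= r -> W z) -> E y -> D x ->
    r <= enorm (y - x) ->
    (((depth D o x - k0) / C1 - 1)%:E <= kobayashi_dist E x y)%E.
Proof.
move=> r0; have [k0 k01 H] := visible_exit r0; exists k0 => // x y ball_W Ey Dx rxy.
have [Ky|] := ltP (kobayashi_dist E x y) +oo%E; last first.
  by rewrite leye_eq => /eqP ->; exact: leey.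
have C1p : 0 < C1 by apply: lt_le_trans C10.
have [a [b [sg [ng sa sb L]]]] := near_geodesic_exists Ky.
rewrite -sa in ball_W; rewrite -sa -sb in rxy.
have [t [at_ tb tk tr]] := H a b sg ng ball_W rxy.
have [cE _ _] := ng; have [_ ac sE] := cE.
have sW s : a <= s -> s <= t -> W (sg s).
  move=> as_ st; apply: ball_W; first by apply: sE => //; exact: le_trans tb.
  exact: tr.
have cD : curve_in D a t sg.
  have [_ ac' _] := curve_inS (lexx _) at_ tb cE.
  by split => // s as_ st; apply: WD; exact: sW.
have Ltt : (kobayashi_length D a t sg <= C1%:E * kobayashi_length E a t sg)%E.
  by apply: kobayashi_length_scale => // s v as_ st; apply: kW; exact: sW.
have h1 := depth_dist finD Dx (WD (sW t at_ (lexx _))).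
rewrite -sa in h1; have {}h1 := le_trans h1 (le_trans (kobayashi_dist_le cD) Ltt).
have h2 := kobayashi_length_sub E sg (lexx _) at_ tb.
rewrite (near_geodesic_length ng) // in h1 h2.
rewrite sa -EFinM lee_fin in h1.
have {}h2 := le_trans h2 L; set l := fine _ in h1 h2.
rewrite -leeBlDr// in h2; apply: le_trans h2.
rewrite -EFinB lee_fin lerB// ler_pdivrMr// mulrC; lra.
Qed.

End growth.

(** Turns the exponential error of [royden] into the inverse square required by the dyadic argument
    with nu = 1. *)
Lemma sqr_le_pow2 k : (k ^ 2 <= 2 ^ k.+1)%N.
Proof.
elim: k => [|k IH] //; case: (leqP k 2) => [|k3].
  by case: k {IH} => [|[|[|]]].
have -> : (2 ^ k.+2 = 2 ^ k.+1 + 2 ^ k.+1)%N by rewrite addnn -mul2n -expnS.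
apply: leq_trans (leq_add IH IH); rewrite -!mulnn mulSn mulnS addnA leq_add2r.
apply: leq_trans (leq_mul k3 (leqnn k)); rewrite !mulSn mul0n addn0 addnA addSn.
by rewrite -addn1 leq_add2l; exact: ltn_trans k3.
Qed.

(* Royden localization: its error [2^-K_E(x, E \ U)] is [O(depth^-2)] by [escape]. *)
Lemma metric_comparison E U W W2 o (C1 c nu M r : R) (D := E `&` U) :
  open D -> (forall x, D x -> (kobayashi_dist D o x < +oo)%E) ->
  1 <= C1 -> W `<=` D ->
  (forall x v, W x -> (kobayashi_metric D x v <= C1%:E * kobayashi_metric E x v)%E) ->
  0 < c -> 0 < nu ->
  (forall x v, D x ->
    ((c * depth D o x `^ (1 + nu) * enorm v)%:E <= kobayashi_metric D x v)%E) ->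
  0 < M -> (forall x, E x -> enorm x <= M) -> 0 < r ->
  (forall x z, W2 x -> E z -> enorm (z - x) <= r -> W z) -> W2 `<=` E ->
  exists2 C2 : R, 0 <= C2 & forall x v, W2 x ->
    (kobayashi_metric D x v <= (1 + C2 / depth D o x ^+ 2)%:E * kobayashi_metric E x v)%E.
Proof.
move=> oD finD C10 WD kW c0 nu0 kD M0 EM r0 W2W W2E.
have C1p : 0 < C1 by apply: lt_le_trans C10.
have DE : D `<=` E by move=> x [].
have [k0 k01 Hk] := escape oD DE finD C10 WD kW c0 nu0 kD r0.
pose B := 4 * C1 + k0; have B0 : 0 < B by rewrite /B; lra.
exists (4 * B ^+ 2 + C1 * B ^+ 2).
  by rewrite addr_ge0 ?mulr_ge0 ?exprn_ge0 ?ltW.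
move=> x v W2x.
have Wx : W x by apply: (W2W x) => //; [exact: W2E|rewrite subrr enorm0 ltW].
have Dx := WD _ Wx; set ka := depth D o x.
have ka1 : 1 <= ka by exact: depth_ge1.
have ka20 : 0 < ka ^+ 2 by rewrite exprn_gt0//; lra.
have kE0 := kobayashi_metric_ge0 E x v.
have far y : E y -> ~ U y -> (((ka - k0) / C1 - 1)%:E <= kobayashi_dist E x y)%E.
  move=> Ey nU; apply: Hk => //; first by move=> z Ez zr; exact: W2W zr.
  rewrite leNgt; apply/negP => /ltW yx; apply: nU.
  by have /WD[] := W2W x y W2x Ey yx.
(* One unit is lost in [escape], and another makes the inequality required by [royden] strict. If f
   < 1 the depth is at most [B], and the crude factor [C1] is absorbed into the constant. *)
set f := (ka - k0) / C1 - 2.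
have [f1|f1] := ltP f 1.
  have kaB : ka <= B.
    have : (ka - k0) / C1 <= 3 by rewrite /f in f1; lra.
    by rewrite ler_pdivrMr// /B; lra.
  apply: (le_trans (kW x v Wx)); rewrite lee_wpmul2r// lee_fin.
  rewrite ler_wpDl// ler_pdivlMr//.
  have : ka ^+ 2 <= B ^+ 2 by rewrite lerXn2r ?nnegrE; lra.
  have : 0 <= B ^+ 2 by rewrite exprn_ge0// ltW.
  by nra.
have f0 : 0 <= f by lra.
have [k [kpos k1 k2]] : exists k : nat, [/\ (0 < k)%N, k%:R <= f & f < k%:R + 1].
  exists (Num.truncn f); have /andP[k1 k2] := truncn_itv f0.
  by rewrite natr1 truncn_gt0.
rewrite /f in k1 k2.
have kr1 : 1 <= k%:R :> R by rewrite ler1n.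
have faro y : E y -> ~ U y -> (k%:R%:E < kobayashi_dist E x y)%E.
  move=> Ey nU; apply: lt_le_trans (far y Ey nU); rewrite lte_fin.
  by lra.
apply: (le_trans (royden v kpos M0 EM faro)); rewrite lee_wpmul2r// lee_fin.
have p2 : 2 <= (2 : R) ^+ k by rewrite -[leLHS]expr1 ler_eXn2l//; lra.
have kaB : ka <= B * k%:R.
  have : (ka - k0) / C1 <= k%:R + 3 by lra.
  rewrite ler_pdivrMr// /B; nra.
have kk : (k%:R : R) ^+ 2 <= 2 * 2 ^+ k.
  by rewrite -exprS -!natrX ler_nat sqr_le_pow2.
have sq : ka ^+ 2 <= B ^+ 2 * (2 * 2 ^+ k).
  apply: (@le_trans _ _ ((B * k%:R) ^+ 2)); first by rewrite lerXn2r ?nnegrE; lra.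
  by rewrite exprMn ler_wpM2l// exprn_ge0// ltW.
set P := (2 : R) ^+ k in p2 kk sq *.
have P0 : 0 < P by lra.
have -> : (1 - P^-1)^-1 = 1 + (P - 1)^-1 by field; rewrite !gt_eqF//; lra.
rewrite lerD2l; apply: (@le_trans _ _ (4 * B ^+ 2 / ka ^+ 2)).
  rewrite ler_pdivlMr// mulrC ler_pdivrMr; last lra.
  by have : 0 <= B ^+ 2 by [rewrite exprn_ge0// ltW]; nra.
rewrite ler_pM2r ?invr_gt0// lerDl mulr_ge0 ?exprn_ge0// ltW//.
Qed.

(** [arc_bound] with nu = 1 for the excess [m] of the distance in [D] over the length in [E], which
    is subadditive though of no definite sign. Where the depth is at least [lam], the excess is at
    most C2 / lam^2 times the length; finally depth >= 1 is used at the point provided by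
    [arc_bound]. *)
Lemma length_comparison D E o a b sg (C2 : R) : open D ->
  (forall x, D x -> (kobayashi_dist D o x < +oo)%E) -> D `<=` E -> 0 <= C2 ->
  near_geodesic E a b sg -> curve_in D a b sg ->
  (forall t v, a <= t -> t <= b -> (kobayashi_metric D (sg t) v <=
      (1 + C2 / depth D o (sg t) ^+ 2)%:E * kobayashi_metric E (sg t) v)%E) ->
  (kobayashi_dist D (sg a) (sg b) <=
     kobayashi_length E a b sg + (2 * (C2 * arc_const 1))%:E)%E.
Proof.
move=> oD finD DE C20 ng cD kDE; have [ab _ sD] := cD.
pose l s t := fine (kobayashi_length E s t sg).
pose m s t := fine (kobayashi_dist D (sg s) (sg t)) - l s t.
have Kfin s t : a <= s -> s <= t -> t <= b ->
    kobayashi_dist D (sg s) (sg t) = (fine (kobayashi_dist D (sg s) (sg t)))%:E.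
  move=> as_ st tb; rewrite fineK// ge0_fin_numE ?kobayashi_dist_ge0//.
  apply: le_lt_trans (kobayashi_dist_depth finD _ _) (ltry _); apply: sD; lra.
have lfin s t : a <= s -> s <= t -> t <= b -> kobayashi_length E s t sg = (l s t)%:E.
  exact: near_geodesic_length.
have ctl : arc_control a b (depth D o \o sg) l m C2 1.
  apply: (arc_controlP oD finD DE ng cD) => [s u t as_ su ut tb|s t lam as_ st tb l0 Hl].
    have h1 := kobayashi_dist_triangle D (sg s) (sg u) (sg t).
    have h2 := kobayashi_length_superadd E sg su ut.
    have st := le_trans su ut; have ub := le_trans ut tb; have au := le_trans as_ su.
    rewrite (lfin s u as_ su ub) (lfin u t au ut tb) (lfin s t as_ st tb) in h2.
    rewrite (Kfin s u as_ su ub) (Kfin u t au ut tb) (Kfin s t as_ st tb) in h1.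
    by rewrite -EFinD lee_fin in h1; rewrite -EFinD lee_fin in h2; rewrite /m; lra.
  have p0 : 0 < lam ^+ 2 by rewrite exprn_gt0.
  have k0 : 0 < 1 + C2 / lam ^+ 2 by rewrite ltr_wpDr// divr_ge0// ltW.
  have h : (kobayashi_length D s t sg <= (1 + C2 / lam ^+ 2)%:E * kobayashi_length E s t sg)%E.
    apply: kobayashi_length_scale => // w v sw wt.
    apply: (le_trans (kDE w v (le_trans as_ sw) (le_trans wt tb))).
    rewrite lee_wpmul2r ?kobayashi_metric_ge0// lee_fin lerD2l ler_wpM2l//.
    have lw := Hl w sw wt.
    by rewrite lef_pV2 ?posrE ?exprn_gt0// ?lerXn2r ?nnegrE//; lra.
  have {}h := le_trans (kobayashi_dist_le (curve_inS as_ st tb cD)) h.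
  rewrite (Kfin s t as_ st tb) (lfin s t as_ st tb) -EFinM lee_fin in h.
  rewrite -[1 + 1]/(2%:R) (powR_mulrn 2 (ltW l0)) -/(l s t) -ler_pdivlMr// /m.
  by move: h; rewrite mulrAC; lra.
have [t [at_ tb Ht]] := arc_bound ltr01 C20 ab ctl.
rewrite (Kfin a b)// (lfin a b)// -EFinD lee_fin -lerBlDl -/(m a b).
have d1 : 1 <= depth D o (sg t) := depth_ge1 _ _ _.
rewrite /= powRr1 in Ht; last by lra.
have A0 : 0 <= C2 * arc_const 1 by rewrite mulr_ge0// ltW// arc_const_gt0.
have [m0|m0] := ltP (m a b) 0; first by lra.
by apply: le_trans Ht; rewrite ler_peMr.
Qed.

End visibility.

(** * Uniform distance to the complement of an open set *)

Section compactness.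
Context {R : realType} {n : nat}.
Local Notation V := 'rV[R[i]]_n.

(** Squares rather than discs: a square is the continuous image of a product of two segments. *)
Let square (M : R) : set R[i] := [set z | `|complex.Re z| <= M /\ `|complex.Im z| <= M].

Let square_compact M : compact (square M).
Proof.
pose F (u : R * R) : R[i] := u.1 +i* u.2.
have Fc : continuous F.
  move=> u B /nbhs_normcP[e e0 He].
  have e20 : 0 < e / 2 by lra.
  apply/nbhs_ballP; exists (e / 2) => //= w [w1 w2]; apply: He.
  apply: (le_lt_trans (normc_le_ReIm _)).
  move: w1 w2; rewrite -!ball_normE/= (distrC u.1) (distrC u.2) /F; lra.
have -> : square M = F @` (`[- M, M]%classic `*` `[- M, M]%classic).
  apply/seteqP; split => [z [z1 z2]|_ [[x y] [/= h1 h2] <-]].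
    exists (complex.Re z, complex.Im z); last by case: z {z1 z2}.
    by split => /=; rewrite in_itv/= -ler_norml.
  by rewrite /square /F /= !ler_norml; move: h1 h2; rewrite !in_itv.
apply: continuous_compact; first exact: continuous_subspaceT.
by apply: compact_setX; exact: segment_compact.
Qed.

(** The closure of [A] is compact. Locally half the radius of a ball inside [U] works for all nearby
    points, and compactness makes the choice uniform. *)
Lemma compact_inner_distance (A U : set V) (M : R) : open U ->
  (forall x, A x -> enorm x <= M) -> closure A `<=` U ->
  exists2 r : R, 0 < r & forall x y, A x -> enorm (y - x) < r -> U y.
Proof.
move=> oU AM AU.
have cA : compact (closure A).
  have cb : compact [set v : V | forall i, square (M + 1) (v ord0 i)].
    exact: (@rV_compact R[i] n (fun=> square (M + 1)) (fun=> @square_compact (M + 1))).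
  apply: (subclosed_compact (@closed_closure _ A) cb).
  move=> x /closure_enormP/(_ 1 ltr01)[y Ay yx] i /=.
  have xM : normc (x 0 i) <= M + 1.
    apply: (le_trans (coord_enorm x i)).
    have := enorm_tri y x 0; rewrite !subr0 enorm_distC; have := AM y Ay; lra.
  by split; apply: le_trans xM; [exact: normc_Re|exact: normc_Im].
have /compact_near_coveringP cov := cA.
have [] := @filter_ex _ (0^'+ : set_system R) _ _
  (filterI (cov _ (0^'+) (fun (e : R) x => forall y, enorm (y - x) < e -> U y) _ _)
     (nbhs_right_gt (0 : R))).
  move=> x /AU Ux; have [e e0 He] := open_enorm oU Ux.
  have e20 : 0 < e / 2 by lra.
  exists ([set x' | enorm (x' - x) < e / 2], [set d : R | d < e / 2]).
    split => /=; first by apply/nbhs_enormP; exists (e / 2).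
    exact: nbhs_right_lt.
  move=> [x' d] [/= x'x de] y yx'; apply: He.
  have := enorm_tri x' y x; lra.
move=> r [Hr r0]; exists r => // x y Ax; apply: Hr; exact: subset_closure.
Qed.

End compactness.

(** * Additive localization of the Kobayashi distance *)

Theorem theorem1p4 (R : realType) (n : nat) (Omega U : set 'rV[R[i]]_n) :
  (2 <= n)%N ->
  is_domain Omega -> bounded_set Omega ->
  open U -> connected U ->
  boundary Omega `&` U !=set0 ->
  log_type_convex (Omega `&` U) ->
  forall V : set 'rV[R[i]]_n,
    open V -> V `<=` U -> closure V `<=` U ->
    exists2 K : R, 0 < K &
      forall p q : 'rV[R[i]]_n, (V `&` Omega) p -> (V `&` Omega) q ->
        (kobayashi_dist Omega p q <= kobayashi_dist (Omega `&` U) p q)%E /\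
        (kobayashi_dist (Omega `&` U) p q
           <= kobayashi_dist Omega p q + K%:E)%E.
Proof.
move=> n2 _ bO oU _ _ logD V _ VU cVU; have n0 : (0 < n)%N by exact: ltnW.
have [dD _ _ _] := logD; have [D0 oD _] := dD; have [ o Do] := D0.
set D := Omega `&` U in Do oD logD *.
have DO : D `<=` Omega by move=> x [].
have [finD [c [nu [c0 nu0 kD]]]] := log_type_growth n0 logD Do.
have [M M0 OM] := bounded_enorm bO.
pose V0 := V `&` Omega.
have V0M x : V0 x -> enorm x <= M by move=> [_ /OM].
have V0U : closure V0 `<=` U.
  by move=> x cx; apply: cVU; apply: closure_subset cx => y [].
have [r4 r40 Hr4] := compact_inner_distance oU V0M V0U.
(* Four layers: points within [3 * r] of [V0] keep a margin [r] inside [U], so the crude comparison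
   [kW] holds on [W 3]; the sharp one [kW2] then holds on [W 2], again with a margin [r]. *)
pose r := r4 / 4; have r0 : 0 < r by rewrite divr_gt0.
have r4E : r4 = 4 * r by rewrite /r; field.
pose W (j : R) : set 'rV[R[i]]_n :=
  [set z | Omega z /\ exists2 p, V0 p & enorm (z - p) <= j * r].
have WS j k x y : W j x -> Omega y -> enorm (y - x) <= k * r -> W (j + k) y.
  move=> [_ [p V0p xp]] Oy yx; split => //; exists p => //.
  by have := enorm_tri x y p; rewrite mulrDl; lra.
have WD : W 3 `<=` D.
  move=> z [Oz [p V0p zp]]; split => //; apply: Hr4 V0p _; rewrite r4E; lra.
have W23 : W 2 `<=` W 3.
  by move=> z [Oz [p V0p zp]]; split => //; exists p => //; lra.
have V0W p : V0 p -> W 0 p.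
  by move=> V0p; split; [case: V0p|exists p; rewrite // subrr enorm0 mul0r].
have [C1 C11 kloc] := kobayashi_metric_local U M0 OM r0.
have kW x v : W 3 x -> (kobayashi_metric D x v <= C1%:E * kobayashi_metric Omega x v)%E.
  move=> Wx; have [Ox [p V0p xp]] := Wx; apply: kloc => // y Oy yx.
  by apply: Hr4 V0p _; have := enorm_tri x y p; rewrite r4E; lra.
have W2W x z : W 2 x -> Omega z -> enorm (z - x) <= r -> W 3 z.
  move=> W2x Oz zx; rewrite (_ : 3 = 2 + 1 :> R); last by ring.
  by apply: WS W2x Oz _; rewrite mul1r.
have W2O : W 2 `<=` Omega by move=> x [].
have [C2 C20 kW2] := metric_comparison oD finD C11 WD kW c0 nu0 kD M0 OM r0 W2W W2O.
have [k0 k01 exit] := visible_exit oD DO finD C11 WD kW c0 nu0 kD r0.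
pose C3 := 2 * (C2 * arc_const 1).
have C30 : 0 <= C3.
  by rewrite /C3 !mulr_ge0// ltW// arc_const_gt0.
have compare a b sg : near_geodesic Omega a b sg ->
    (forall t, a <= t -> t <= b -> W 2 (sg t)) ->
    (kobayashi_dist D (sg a) (sg b) <= kobayashi_length Omega a b sg + C3%:E)%E.
  move=> ng sW; have [cO _ _] := ng; have [ab ac _] := cO.
  apply: (length_comparison oD finD DO C20 ng).
    by split => // t at_ tb; apply/WD/W23/sW.
  by move=> t v at_ tb; apply: kW2; exact: sW.
(* Up to its point of bounded depth the curve stays within [r] of its origin in [V0], hence in
   [W 2], so [compare] applies to this initial arc. *)
have vis a b sg : near_geodesic Omega a b sg -> V0 (sg a) -> r <= enorm (sg b - sg a) ->
    exists t, [/\ a <= t, t <= b, D (sg t), depth D o (sg t) <= k0 &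
      (kobayashi_dist D (sg a) (sg t) <= kobayashi_length Omega a t sg + C3%:E)%E].
  move=> ng V0a rab; have [cO _ _] := ng; have [ab _ sO] := cO.
  have [|t [at_ tb tk tr]] := exit a b sg ng _ rab.
    move=> z Oz zr; split => //; exists (sg a) => //; lra.
  have sW s : a <= s -> s <= t -> W 2 (sg s).
    move=> as_ st; split; first by apply: sO => //; exact: le_trans tb.
    by exists (sg a) => //; have := tr s as_ st; lra.
  exists t; split => //; first by apply/WD/W23/sW.
  by apply: compare => //; exact: near_geodesicS ng.
(* [C3] for each of the two outer arcs, at most [2 * k0] for joining the two points of bounded depth
   through [o], and 1 for the defect of the near-geodesic. *)
exists (2 * C3 + 2 * k0 + 1); first by lra.
move=> p q V0p V0q; split; first exact: kobayashi_dist_sub.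
have [Dp Dq] : D p /\ D q.
  by split; apply/WD; [case: (V0W _ V0p) | case: (V0W _ V0q)] => Ox [y V0y xy];
    split => //; exists y => //; lra.
have Kpq : (kobayashi_dist Omega p q < +oo)%E.
  apply: le_lt_trans (kobayashi_dist_sub _ _ DO) _.
  exact: le_lt_trans (kobayashi_dist_depth finD Dp Dq) (ltry _).
have [a [b [sg [ng sa sb L]]]] := near_geodesic_exists Kpq.
have [cO _ _] := ng; have [ab ac sO] := cO.
have [inW|] := pselect (forall t, a <= t -> t <= b -> W 2 (sg t)).
  have := compare a b sg ng inW; rewrite sa sb => /le_trans; apply.
  apply: (le_trans (leeD2r _ L)); rewrite -addeA -EFinD leeD2l// lee_fin; lra.
(* The point at [u] is at distance at least [r] from both ends, so each of the two halves has a
   visible point. As these lie on either side of [u], the outer arcs do not overlap and their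
   lengths add up to at most the total length. *)
move=> /existsNP[u /not_implyP[au /not_implyP[ub nW]]].
have far x : V0 x -> r <= enorm (sg u - x).
  move=> V0x; rewrite leNgt; apply/negP => ux; apply: nW; split; first exact: sO.
  by exists x => //; lra.
have [| |t [at_ tu Dt tk Kt]] := vis a u sg (near_geodesicS (lexx _) au ub ng).
- by rewrite sa.
- by rewrite sa; exact: far.
(* The curve is reversed so that [vis] applies from the end [q]; symmetry of the distance brings the
   estimate back. *)
pose sr w := sg (0 - w).
have bu : 0 - b <= 0 - u by lra.
have uu : 0 - u <= 0 - a by lra.
have [| |t' [bt' tu' Dt' tk' Kt']] :=
    vis (0 - b) (0 - u) sr (near_geodesicS (lexx _) bu uu (near_geodesic_reflect 0 ng)).
- by rewrite /sr subKr sb.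
- by rewrite /sr !subKr sb; exact: far.
rewrite /sr subKr sb in Kt'; rewrite sa in Kt; rewrite /sr in Dt' tk'.
pose w := 0 - t'.
have uw : u <= w by rewrite /w; lra.
have wb : w <= b by rewrite /w; lra.
have tw := le_trans tu uw.
have Lw : (kobayashi_length Omega (0 - b) t' sr <= kobayashi_length Omega w b sg)%E.
  by have := kobayashi_length_reflect Omega 0 sg wb; rewrite [(0 - w)%R]subKr.
rewrite -/w in Kt' Dt' tk'.
have Kw := le_trans Kt' (leeD2r C3%:E Lw).
have Ksup := kobayashi_length_superadd Omega sg at_ (le_trans tw wb).
have Ktw := kobayashi_length_sub Omega sg tw wb (lexx b).
have Kmid := kobayashi_dist_depth finD Dt Dt'.
have tri1 := kobayashi_dist_triangle D p (sg t) q.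
have tri2 := kobayashi_dist_triangle D (sg t) (sg w) q.
rewrite kobayashi_dist_sym in Kw.
have := le_trans tri1 (leeD Kt (le_trans tri2 (leeD Kmid Kw))).
move=> /le_trans; apply.
have E1 := near_geodesic_length ng (lexx a) at_ (le_trans tw wb).
have E2 := near_geodesic_length ng (le_trans au uw) wb (lexx b).
have E3 := near_geodesic_length ng at_ (le_trans tw wb) (lexx b).
have [l1 {}E1] : exists l, kobayashi_length Omega a t sg = l%:E by eexists; exact: E1.
have [l2 {}E2] : exists l, kobayashi_length Omega w b sg = l%:E by eexists; exact: E2.
have [l3 {}E3] : exists l, kobayashi_length Omega t b sg = l%:E by eexists; exact: E3.
have Lab := le_trans Ksup L.
rewrite E1 E3 in Lab; rewrite E2 E3 lee_fin in Ktw; rewrite E1 E2.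
apply: (@le_trans _ _ ((l1 + l3)%:E + (2 * C3 + 2 * k0 - 2)%:E)%E).
  by rewrite -!EFinD lee_fin; lra.
rewrite EFinD; apply: (le_trans (leeD2r _ Lab)).
by rewrite -addeA -EFinD leeD2l// lee_fin; lra.
Qed.
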